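(* Let $A\cong B\cong\mathbb{C}^3$, $C\cong\mathbb{C}^4$, and let $M_6$ denote the module $S_{(2,2,2)}A^*\otimes S_{(2,2,2)}B^*\otimes S_{(3,1,1,1)}C^*$. Then $$M_6=\mathcal{I}_6\left(\sigma_4(\mathbb{P}A\times\mathbb{P}B\times\mathbb{P}C)\right)$$ as $GL(A)\times GL(B)\times GL(C)$-modules.
   Context: All vector spaces are over $\mathbb{C}$. $\mathbb{P}A\times\mathbb{P}B\times\mathbb{P}C$ is embedded in $\mathbb{P}(A\otimes B\otimes C)$ by the Segre map $([u],[v],[w])\mapsto[u\otimes v\otimes w]$. For a projective variety $X\subset\mathbb{P}^N$, $\sigma_k(X)$ is the $k$-secant variety: the Zariski closure of the union of all linear $\mathbb{P}^{k-1}$'s spanned by $k$ points of $X$; $\sigma_k(\mathbb{P}A\times\mathbb{P}B\times\mathbb{P}C)$ refers to the Segre variety. $\mathcal{I}_s(X)$ denotes the space of homogeneous degree $s$ polynomials in the ideal of $X$; for $X\subset\mathbb{P}(A\otimes B\otimes C)$ it is a subspace of $S^s(A^*\otimes B^*\otimes C^* )$. As a $GL(A)\times GL(B)\times GL(C)$-module, $S^d(A^*\otimes B^*\otimes C^* )$ is a direct sum of irreducible modules $S_{\pi_1}A^*\otimes S_{\pi_2}B^*\otimes S_{\pi_3}C^*$ (with multiplicities), where $\pi_1,\pi_2,\pi_3$ are partitions of $d$ and $S_\pi$ is the Schur functor of $\pi$, with the convention $S_{(d)}V=S^dV$ and $S_{(1^d)}V=\bigwedge^dV$. The module $M_6$ occurs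 with multiplicity one in $S^6(A^*\otimes B^*\otimes C^* )$ and is identified with that unique submodule. *)

(* Defs.v *)
From HB Require Import structures.
From mathcomp Require Import all_boot all_order all_fingroup all_algebra.
From mathcomp Require Import mpoly mxtens complex reals.

Set Implicit Arguments.
Unset Strict Implicit.
Unset Printing Implicit Defensive.

Import GRing.Theory.
Local Open Scope ring_scope.

(* A subset X of the projective space P(F^n) is represented by the predicate
   on 'rV[F]_n that holds exactly at the nonzero vectors x with [x] in X. *)
Section ProjectiveSets.
Variables (F : fieldType) (n : nat).
Implicit Types (X : 'rV[F]_n -> Prop) (p : {mpoly F[n]}).

Definition vanishes_on X p : Prop := forall x, X x -> p.@[x 0] = 0.

Definition homog_ideal (s : nat) X p : Prop :=
  p \is s.-homog /\ vanishes_on X p.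

Definition zariski_closure X (x : 'rV[F]_n) : Prop :=
  x != 0 /\ forall s p, homog_ideal s X p -> p.@[x 0] = 0.

(* The k spanning points have to be linearly independent, since their span is
   required to be a linear P^(k-1). *)
Definition spanned_by_points (k : nat) X (x : 'rV[F]_n) : Prop :=
  exists y : k.-tuple 'rV[F]_n,
    [/\ forall i, X (tnth y i), free y, x != 0 & x \in <<y>>%VS].

Definition secant (k : nat) X : 'rV[F]_n -> Prop :=
  zariski_closure (spanned_by_points k X).

(* The action (h . p)(x) = p (h^-1 x) of GL_n on polynomial functions. *)
Definition mpoly_act (h : 'M[F]_n) p : {mpoly F[n]} :=
  p \mPo [tuple \sum_(j < n) invmx h i j *: 'X_j | i < n].

End ProjectiveSets.

(* A = F^a, B = F^b, C = F^c, and A (x) B (x) C is 'rV[F]_(a * b * c). *)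
Definition segre (F : fieldType) (a b c : nat) (x : 'rV[F]_(a * b * c)) : Prop :=
  exists (u : 'rV[F]_a) (v : 'rV[F]_b) (w : 'rV[F]_c),
    [/\ u != 0, v != 0, w != 0 & x = u *t v *t w].

(* (F^n)^{(x) d}: t i is the coordinate of t on e_(i 0) (x) ... (x) e_(i d.-1). *)
Notation tpow F n d := {ffun {ffun 'I_d -> 'I_n} -> F^o}.

Section Schur.
Variables (F : fieldType) (n : nat) (pi : seq nat).
Local Notation d := (sumn pi).
Local Notation V := (tpow F n d).

(* The Young diagram of the partition pi is filled row by row with 0, ..., d.-1;
   reshape_index and reshape_offset give the row and the column of an entry. *)
Definition row_group : {set 'S_d} :=
  [set s : 'S_d | [forall m, reshape_index pi (s m) == reshape_index pi m]].

Definition col_group : {set 'S_d} :=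
  [set s : 'S_d | [forall m, reshape_offset pi (s m) == reshape_offset pi m]].

Definition place_perm (s : 'S_d) (t : V) : V :=
  [ffun i : {ffun 'I_d -> 'I_n} => t [ffun m => i (s m)]].

Definition young_symmetrizer (t : V) : V :=
  \sum_(q in col_group) (-1) ^+ q *:
    place_perm q (\sum_(s in row_group) place_perm s t).

Fact place_perm_is_linear s : linear (place_perm s).
Proof. by move=> k t u; apply/ffunP=> i; rewrite !ffunE. Qed.
HB.instance Definition _ s :=
  GRing.isLinear.Build F V V _ (place_perm s) (place_perm_is_linear s).

Fact young_symmetrizer_is_linear : linear young_symmetrizer.
Proof.
move=> k t u; rewrite /young_symmetrizer scaler_sumr -big_split /=.
apply: eq_bigr => q _; rewrite scalerA mulrC -scalerA -scalerDr -linearP.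
congr (_ *: place_perm q _); rewrite scaler_sumr -big_split /=.
by apply: eq_bigr => s _; rewrite linearP.
Qed.
HB.instance Definition _ :=
  GRing.isLinear.Build F V V _ young_symmetrizer young_symmetrizer_is_linear.

(* The Schur functor S_pi applied to F^n; S_(d) is the space of symmetric tensors
   and S_(1^d) the space of antisymmetric ones. *)
Definition schur : {vspace V} := limg (linfun young_symmetrizer).

End Schur.

Section TensorProduct.
Variables (F : fieldType) (I J K : finType).

Definition tensor3 (x : {ffun I -> F^o}) (y : {ffun J -> F^o})
    (z : {ffun K -> F^o}) : {ffun I * J * K -> F^o} :=
  [ffun m => x m.1.1 * y m.1.2 * z m.2].

Definition tensor3v (U : {vspace {ffun I -> F^o}}) (V : {vspace {ffun J -> F^o}})
    (W : {vspace {ffun K -> F^o}}) : {vspace {ffun I * J * K -> F^o}} :=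
  <<[seq tensor3 xy.1 xy.2 z |
      xy <- [seq (x, y) | x <- vbasis U, y <- vbasis V], z <- vbasis W]>>%VS.

End TensorProduct.

(* Matrix of h (x) ... (x) h on (F^n)^{(x) d}. *)
Definition tpow_coef (F : fieldType) (n d : nat) (h : 'M[F]_n)
    (i j : {ffun 'I_d -> 'I_n}) : F :=
  \prod_(m < d) h (i m) (j m).

(* The matrix by which g in GL(V) acts on V^* in the dual basis. *)
Definition dual_mx (F : fieldType) (n : nat) (g : 'M[F]_n) : 'M[F]_n :=
  (invmx g)^T.

Section Modules.
Variables (F : fieldType) (a b c : nat).
Implicit Types (gA : 'M[F]_a) (gB : 'M[F]_b) (gC : 'M[F]_c).
Implicit Types (M : {mpoly F[a * b * c]} -> Prop).

Definition dual_tpow_act (d1 d2 d3 : nat) gA gB gC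
    (t : {ffun {ffun 'I_d1 -> 'I_a} * {ffun 'I_d2 -> 'I_b} *
               {ffun 'I_d3 -> 'I_c} -> F^o}) :=
  [ffun i => \sum_j tpow_coef (dual_mx gA) i.1.1 j.1.1 *
                    tpow_coef (dual_mx gB) i.1.2 j.1.2 *
                    tpow_coef (dual_mx gC) i.2 j.2 * t j] :
  {ffun {ffun 'I_d1 -> 'I_a} * {ffun 'I_d2 -> 'I_b} *
        {ffun 'I_d3 -> 'I_c} -> F^o}.

(* M is a GL(A) x GL(B) x GL(C)-submodule of S^d(A^* (x) B^* (x) C^* ). *)
Definition submodule (d : nat) M : Prop :=
  [/\ forall p, M p -> p \is d.-homog,
      M 0,
      forall (k : F) p q, M p -> M q -> M (k *: p + q)
    & forall gA gB gC, gA \in unitmx -> gB \in unitmx -> gC \in unitmx ->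
      forall p, M p -> M (mpoly_act (gA *t gB *t gC) p)].

(* M is isomorphic, as a module, to S_pi1 A^* (x) S_pi2 B^* (x) S_pi3 C^*. *)
Definition isomorphic_to_schur (pi1 pi2 pi3 : seq nat) M : Prop :=
  let S := tensor3v (schur F a pi1) (schur F b pi2) (schur F c pi3) in
  exists f : {linear {ffun {ffun 'I_(sumn pi1) -> 'I_a} *
                           {ffun 'I_(sumn pi2) -> 'I_b} *
                           {ffun 'I_(sumn pi3) -> 'I_c} -> F^o}
              -> {mpoly F[a * b * c]}},
  [/\ {in S &, injective f},
      forall p, M p <-> exists2 t, t \in S & p = f t
    & forall gA gB gC, gA \in unitmx -> gB \in unitmx -> gC \in unitmx ->
      {in S, forall t, f (dual_tpow_act gA gB gC t) =
                       mpoly_act (gA *t gB *t gC) (f t)}].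

End Modules.

Definition is_M6 (F : fieldType) (M : {mpoly F[3 * 3 * 4]} -> Prop) : Prop :=
  submodule 6 M /\
  isomorphic_to_schur [:: 2; 2; 2] [:: 2; 2; 2] [:: 3; 1; 1; 1] M.

(* Main.v *)
(* By density, I_6(sigma_4) is the space of sextic forms that vanish on all sums of four
   decomposable tensors. The normal form of a generic pencil of 3 x 4 matrices shows that such a
   form is zero as soon as its degree in one A-slice or B-slice is at most 1; hence all its
   degrees in these slices are 2, and it is semi-invariant under GL(A) x GL(B) with character
   det^2 det^2. Simultaneous diagonalisation of two slices shows that it also vanishes on the
   tensors whose C-slices are linearly dependent. Call a sextic form with these two properties
   admissible. Its weights for the torus of GL(C) are the weights of S_(3,1,1,1), and each weight
   space consists of multiples of one form: two C-slices have degree 1 there, and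
   diagonalising the other two leaves a single value that determines the form.
   Conversely, any copy of the Schur module in the sextic forms consists of admissible forms and
   contains each of these weights, so it is the space of all admissible forms. An explicit copy
   is given by products of determinants; a sign-reversing involution shows that it vanishes in
   rank 4, and its value at a tensor of rank 5 shows that it is not zero. *)

From HB Require Import structures.
Require Import Defs.
From mathcomp Require Import all_boot all_order all_fingroup all_algebra.
From mathcomp Require Import mpoly mxtens complex reals.
From mathcomp Require Import ring zify.

Set Implicit Arguments.
Unset Strict Implicit.
Unset Printing Implicit Defensive.

Import Order.TTheory GRing.Theory Num.Theory.
Local Open Scope ring_scope.

(** * Polynomial functions along lines *)

(** No representation theory of GL is used. It is replaced by the identifications S_(2,2,2) F^3 =
    det^2 and S_(3,1,1,1) F^4 = det (x) S^2 F^4, up to duals: a copy of the Schur module becomes a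
    linear family of sextic forms indexed by symmetric 4 x 4 matrices, on which GL(C) acts by
    congruence and a determinant. Admissibility is the pivot because the statement concerns every
    submodule isomorphic to the Schur module. Such a copy is not known in advance to vanish in rank
    4, whereas both conditions on admissible forms follow from its covariance. The bound on weight
    spaces then identifies all copies with one and the same space, without decomposing the sextic
    forms. The explicit copy cannot be avoided: the bounds alone would also allow the ideal to be
    zero. *)

Section PolynomialsAlongLines.
Variable F : numFieldType.

Lemma poly_zero_off0 (q : {poly F}) :
  (forall s, s != 0 -> q.[s] = 0) -> q = 0.
Proof.
move=> q0; apply: (@roots_geq_poly_eq0 _ _ [seq i.+1%:R | i <- iota 0 (size q)]).
- by apply/allP=> x /mapP[i _ ->]; rewrite rootE q0 // pnatr_eq0.
- rewrite map_inj_uniq ?iota_uniq // => i j /eqP.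
  by rewrite eqr_nat eqSS => /eqP.
- by rewrite size_map size_iota.
Qed.

Lemma poly_eq_off0 (q r : {poly F}) :
  (forall s, s != 0 -> q.[s] = r.[s]) -> q = r.
Proof.
move=> e; apply/eqP; rewrite -subr_eq0; apply/eqP/poly_zero_off0 => s s0.
by rewrite hornerD hornerN e // subrr.
Qed.

(* Density arguments only use restrictions to lines, see lp_dense. *)
Definition linewise_poly (V : lmodType F) (f : V -> F) :=
  forall x y, exists q : {poly F}, forall s, f (x + s *: y) = q.[s].

Section Closure.
Variable V : lmodType F.
Implicit Types f g : V -> F.
Local Notation lp := (@linewise_poly V).

Lemma lp_ext f g : f =1 g -> lp f -> lp g.
Proof. by move=> e lf x y; have [q qE] := lf x y; exists q => s; rewrite -e. Qed.

Lemma lp_const c : lp (fun=> c).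
Proof. by move=> x y; exists c%:P => s; rewrite hornerC. Qed.

Lemma lp_lin f : (forall x y s, f (x + s *: y) = f x + s * f y) -> lp f.
Proof.
move=> lf x y; exists ((f x)%:P + (f y)%:P * 'X) => s.
by rewrite lf !hornerE mulrC.
Qed.

Lemma lp_add f g : lp f -> lp g -> lp (fun x => f x + g x).
Proof.
move=> lf lg x y; have [q qE] := lf x y; have [r rE] := lg x y.
by exists (q + r) => s; rewrite hornerD qE rE.
Qed.

Lemma lp_mul f g : lp f -> lp g -> lp (fun x => f x * g x).
Proof.
move=> lf lg x y; have [q qE] := lf x y; have [r rE] := lg x y.
by exists (q * r) => s; rewrite hornerM qE rE.
Qed.

Lemma lp_scale c f : lp f -> lp (fun x => c * f x).
Proof. by move=> lf; apply: lp_mul => //; apply: lp_const. Qed.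

Lemma lp_sub f g : lp f -> lp g -> lp (fun x => f x - g x).
Proof.
move=> lf lg; apply: (@lp_ext (fun x => f x + -1 * g x)).
  by move=> x; rewrite mulN1r.
by apply: lp_add => //; apply: lp_scale.
Qed.

Lemma lp_sum (I : Type) (r : seq I) (P : pred I) (G : I -> V -> F) :
  (forall i, lp (G i)) -> lp (fun x => \sum_(i <- r | P i) G i x).
Proof.
move=> lG; elim: r => [|i r IH].
  by apply: lp_ext (lp_const 0) => x; rewrite big_nil.
apply: (@lp_ext (fun x => (P i)%:R * G i x + \sum_(i <- r | P i) G i x)).
  by move=> x; rewrite big_cons; case: (P i); rewrite ?mul1r ?mul0r ?add0r.
by apply: lp_add => //; apply: lp_scale.
Qed.

Lemma lp_prod (I : Type) (r : seq I) (P : pred I) (G : I -> V -> F) :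
  (forall i, lp (G i)) -> lp (fun x => \prod_(i <- r | P i) G i x).
Proof.
move=> lG; elim: r => [|i r IH].
  by apply: lp_ext (lp_const 1) => x; rewrite big_nil.
case Pi : (P i).
  apply: (@lp_ext (fun x => G i x * \prod_(i <- r | P i) G i x)).
    by move=> x; rewrite big_cons Pi.
  exact: lp_mul.
by apply: lp_ext IH => x; rewrite big_cons Pi.
Qed.

Lemma lp_exp f n : lp f -> lp (fun x => f x ^+ n).
Proof.
move=> lf; apply: (@lp_ext (fun x => \prod_(i < n) f x)).
  by move=> x; rewrite prodr_const card_ord.
exact: lp_prod.
Qed.

Lemma lp_det n (A : V -> 'M[F]_n) :
  (forall i j, lp (fun x => A x i j)) -> lp (fun x => \det (A x)).
Proof.
by move=> lA; apply: lp_sum => s; apply: lp_scale; apply: lp_prod.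
Qed.

Lemma lp_meval n (p : {mpoly F[n]}) (c : V -> 'I_n -> F) :
  (forall i, lp (fun x => c x i)) -> lp (fun x => p.@[c x]).
Proof.
move=> lc.
apply: (@lp_ext (fun x => \sum_(m <- msupp p) p@_m * \prod_i c x i ^+ m i)).
  by move=> x; rewrite mevalE.
by apply: lp_sum => m; apply: lp_scale; apply: lp_prod => i; apply: lp_exp.
Qed.

(** On the line through [x0] and [x] the product of the two restrictions is the zero polynomial, and
    the restriction of [f] is not, since its value at parameter 0 is [f x0]. So the restriction of
    [g] is zero, in particular at parameter 1. *)
Lemma lp_dense f g x0 : lp f -> lp g -> f x0 != 0 ->
  (forall x, f x != 0 -> g x = 0) -> forall x, g x = 0.
Proof.
move=> lf lg f0 fg x.
have [q qE] := lf x0 (x - x0); have [r rE] := lg x0 (x - x0).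
have /eqP : q * r = 0.
  apply: poly_zero_off0 => s _; rewrite hornerM -qE -rE.
  have [->|/fg ->] := eqVneq (f (x0 + s *: (x - x0))) 0; first exact: mul0r.
  exact: mulr0.
rewrite mulf_eq0 => /orP[]/eqP z.
  by move: f0; have := qE 0; rewrite scale0r addr0 z horner0 => ->; rewrite eqxx.
by have := rE 1; rewrite scale1r addrC subrK z horner0.
Qed.

Lemma lp_dense_eq f g h x0 : lp f -> lp g -> lp h -> f x0 != 0 ->
  (forall x, f x != 0 -> g x = h x) -> forall x, g x = h x.
Proof.
move=> lf lg lh f0 fgh x; apply/eqP; rewrite -subr_eq0; apply/eqP.
apply: (lp_dense lf (lp_sub lg lh) f0) => y /fgh ->; exact: subrr.
Qed.

(* f (x + s y) = q(s) forces t^n q(1/t) to be the polynomial f (y + t x) in t, so that q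
   has degree at most n. *)
Lemma lp_homog_line n f : lp f -> (forall s x, s != 0 -> f (s *: x) = s ^+ n * f x) ->
  forall x y, exists q : {poly F},
    [/\ (size q <= n.+1)%N, forall s, f (x + s *: y) = q.[s], q`_0 = f x & q`_n = f y].
Proof.
move=> lf hf x y.
have [q qE] := lf x y; have [r rE] := lf y x; exists q.
have qr t : t != 0 -> t ^+ n * q.[t^-1] = r.[t].
  move=> t0; rewrite -qE -rE -hf // scalerDr scalerA divff // scale1r.
  by rewrite addrC.
pose N := (size q).-1; pose q' := \poly_(i < size q) q`_(N - i).
have q'E t : t != 0 -> q'.[t] = t ^+ N * q.[t^-1].
  move=> t0; rewrite horner_poly (horner_coef q) mulr_sumr.
  rewrite (reindex_inj rev_ord_inj) /=; apply: eq_bigr => i _.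
  have lein : (i <= N)%N by rewrite /N -ltnS (ltn_predK (ltn_ord i)).
  have -> : (size q - i.+1)%N = (N - i)%N by rewrite /N -subn1 -subnDA add1n.
  rewrite subKn // mulrCA; congr (_ * _).
  by rewrite exprVn -{2}(subnK lein) exprD mulfK // expf_eq0 (negPf t0) andbF.
have sq : (size q <= n.+1)%N.
  rewrite leqNgt; apply/negP=> qn.
  have Nn : (n < N)%N by rewrite /N -ltnS (ltn_predK qn).
  have : q' = 'X^(N - n) * r.
    apply: poly_eq_off0 => t t0; rewrite q'E // hornerM hornerXn -qr // mulrA.
    by rewrite -exprD subnK // ltnW.
  move/(congr1 (fun p : {poly F} => p.[0])).
  rewrite hornerM hornerXn expr0n subn_eq0 leqNgt Nn mul0r horner_poly.
  rewrite (bigD1 (Ordinal (ltn_trans (ltn0Sn n) qn))) //= subn0 expr0 mulr1.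
  rewrite big1 ?addr0; last first.
    move=> i /eqP i0; rewrite expr0n; case: eqP => [e|]; rewrite ?mulr0 //.
    by case: i0; apply/val_inj.
  by move/eqP; rewrite -/(lead_coef q) lead_coef_eq0 => /eqP q0; rewrite q0 size_poly0 in qn.
split=> //; first by rewrite -horner_coef0 -qE scale0r addr0.
have -> : f y = r.[0] by rewrite -rE scale0r addr0.
have -> : r = \poly_(i < n.+1) q`_(n - i).
  apply: poly_eq_off0 => t t0; rewrite -qr // (horner_coef_wide _ sq) horner_poly mulr_sumr.
  rewrite (reindex_inj rev_ord_inj) /=; apply: eq_bigr => i _; rewrite subSS mulrCA.
  congr (_ * _); have lein : (i <= n)%N by rewrite -ltnS.
  rewrite exprVn -{1}(subnK lein) exprD mulrAC divff ?mul1r //.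
  by rewrite expf_eq0 (negPf t0) andbF.
by rewrite horner_coef0 coef_poly subn0.
Qed.

Lemma lp_homog1D f : lp f -> (forall s x, s != 0 -> f (s *: x) = s * f x) ->
  forall x y, f (x + y) = f x + f y.
Proof.
move=> lf hf x y; have [q [sq qE q0 q1]] := lp_homog_line (n := 1) lf hf x y.
have -> : f (x + y) = q.[1] by rewrite -qE scale1r.
by rewrite (horner_coef_wide _ sq) !big_ord_recl big_ord0 /= !expr1n !mulr1 addr0 q0 q1.
Qed.

Definition polar f x y := f (x + y) - f x - f y.

Lemma polarC f x y : polar f x y = polar f y x.
Proof. by rewrite /polar (addrC x) addrAC. Qed.

Section Quadratic.
Variable f : V -> F.
Hypotheses (lf : lp f) (hf : forall s x, s != 0 -> f (s *: x) = s ^+ 2 * f x).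

(** Along the line through [x] in direction [y], [f] is a quadratic polynomial with outer
    coefficients [f x] and [f y]; the polar form is its middle coefficient. *)
Lemma polarZr s x y : s != 0 -> polar f x (s *: y) = s * polar f x y.
Proof.
move=> s0; have [q [sq qE q0 q2]] := lp_homog_line lf hf x y.
have -> : polar f x y = q.[1] - f x - f y by rewrite -qE scale1r.
rewrite /polar qE hf // !(horner_coef_wide _ sq) !big_ord_recl !big_ord0 /=.
by rewrite q0 q2 /bump /= !expr1n expr0; ring.
Qed.

Lemma lp_polar x : lp (polar f x).
Proof.
apply: lp_sub => //; apply: lp_sub; last exact: lp_const.
by move=> y z; have [q qE] := lf (x + y) z; exists q => s; rewrite addrA.
Qed.

Lemma polarDr x y z : polar f x (y + z) = polar f x y + polar f x z.
Proof. by apply: lp_homog1D => [|s t s0]; [apply: lp_polar | apply: polarZr]. Qed.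

Lemma polar_diag x : polar f x x = 2%:R * f x.
Proof.
rewrite /polar -mulr2n -scaler_nat hf ?pnatr_eq0 //; ring.
Qed.

End Quadratic.

Lemma lp_homog1_zero f (I : Type) (r : seq I) (G : I -> V) :
  lp f -> (forall s x, s != 0 -> f (s *: x) = s * f x) ->
  (forall i, f (G i) = 0) -> f (\sum_(i <- r) G i) = 0.
Proof.
move=> lf hf f0; have fD := lp_homog1D lf hf.
elim: r => [|i r IH]; last by rewrite big_cons fD f0 IH addr0.
have := fD 0 0; rewrite big_nil addr0 -[f 0 in LHS]addr0.
by move/(addrI _).
Qed.

End Closure.
End PolynomialsAlongLines.

(** * Partial degrees and components with respect to a set of variables *)

Section Evaluation.
Variables (F : numFieldType) (n : nat).
Implicit Types (p : {mpoly F[n]}) (S : pred 'I_n).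

Definition deg_on S (m : 'X_{1..n}) : nat := \sum_(i | S i) m i.

Definition scale_on S (s : F) (x : 'I_n -> F) : 'I_n -> F :=
  fun i => if S i then s * x i else x i.

Definition comp_on S k p : {mpoly F[n]} :=
  \sum_(m <- msupp p | deg_on S m == k) p@_m *: 'X_[m].

Lemma mcoeff_comp_on S k p m :
  (comp_on S k p)@_m = if deg_on S m == k then p@_m else 0.
Proof.
rewrite /comp_on raddf_sum /=.
rewrite (eq_bigr (fun m' => if m' == m then p@_m else 0)); last first.
  by move=> m' _; rewrite mcoeffZ mcoeffX; case: eqP => [->|]; rewrite ?mulr1 ?mulr0.
rewrite -big_mkcondr /= big_mkcond /=.
case mp : (m \in msupp p).
  rewrite (bigD1_seq m) //= eqxx andbT big1 ?addr0 //.
  by move=> m' /negPf ->; rewrite andbF.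
rewrite (memN_msupp_eq0 (negbT mp)) if_same big1_seq // => m' /andP[_ m'p].
by case: ifP.
Qed.

Lemma meval_scale_monomial S s x (m : 'X_{1..n}) :
  \prod_i scale_on S s x i ^+ m i = s ^+ deg_on S m * \prod_i x i ^+ m i.
Proof.
rewrite /deg_on -prodrXr [X in X * _]big_mkcond -big_split /=.
apply: eq_bigr => i _; rewrite /scale_on; case: ifP; rewrite ?mul1r //.
by rewrite exprMn.
Qed.

Lemma meval_scale S s x p k : (forall m, m \in msupp p -> deg_on S m = k) ->
  p.@[scale_on S s x] = s ^+ k * p.@[x].
Proof.
move=> dk; rewrite !mevalE mulr_sumr; apply: eq_big_seq => m /dk mk.
by rewrite meval_scale_monomial mk mulrCA.
Qed.

Lemma comp_on_deg S k p m : m \in msupp (comp_on S k p) -> deg_on S m = k.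
Proof. by rewrite mcoeff_msupp mcoeff_comp_on; case: (deg_on S m =P k) => //; rewrite eqxx. Qed.

Lemma meval_scale_comp S s x p :
  p.@[scale_on S s x]
    = \sum_(k < (\max_(m <- msupp p) deg_on S m).+1) s ^+ k * (comp_on S k p).@[x].
Proof.
set d := (\max_(m <- _) _).
have dle m : m \in msupp p -> (deg_on S m <= d)%N.
  by move=> mp; rewrite /d; apply: (@leq_bigmax_seq _ _ xpredT).
have {1}-> : p = \sum_(k < d.+1) comp_on S k p.
  apply/mpolyP=> m; rewrite raddf_sum /=.
  case mp : (m \in msupp p); last first.
    rewrite (memN_msupp_eq0 (negbT mp)) big1 // => k _.
    by rewrite mcoeff_comp_on (memN_msupp_eq0 (negbT mp)) if_same.
  have lt : (deg_on S m < d.+1)%N by rewrite ltnS dle.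
  rewrite (bigD1 (Ordinal lt)) //= mcoeff_comp_on eqxx big1 ?addr0 // => k.
  by rewrite mcoeff_comp_on -val_eqE /= eq_sym => /negPf ->.
rewrite raddf_sum /=; apply: eq_bigr => k _.
by apply: meval_scale => m; apply: comp_on_deg.
Qed.

(** Scaling the variables in [S] by s multiplies the component of degree k by s^k, so its value is a
    coefficient of a polynomial in s. Identities that hold after every such scaling thus pass from
    [p] to its components. *)
Lemma comp_on_coef S p x (q : {poly F}) :
  (forall s, s != 0 -> p.@[scale_on S s x] = q.[s]) ->
  forall k, (comp_on S k p).@[x] = q`_k.
Proof.
move=> pq k; pose d := (\max_(m <- msupp p) deg_on S m).+1.
have <- : \poly_(i < d) (comp_on S i p).@[x] = q.
  apply: poly_eq_off0 => s s0; rewrite -pq // horner_poly meval_scale_comp.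
  by apply: eq_bigr => i _; rewrite mulrC.
rewrite coef_poly; case: ltnP => // kd.
rewrite (_ : comp_on S k p = 0) ?meval0 //; apply/mpolyP=> m.
rewrite mcoeff_comp_on mcoeff0; case: eqP => // e.
apply/eqP; rewrite -[_ == 0]negbK -mcoeff_msupp; apply: contraL kd => mp.
by rewrite -ltnNge ltnS -e; apply: (@leq_bigmax_seq _ _ xpredT (deg_on S)).
Qed.

Lemma comp_on_vanish S p x :
  (forall s, s != 0 -> p.@[scale_on S s x] = 0) ->
  forall k, (comp_on S k p).@[x] = 0.
Proof.
move=> p0 k; rewrite (@comp_on_coef S p x 0) ?coef0 // => s s0.
by rewrite p0 // horner0.
Qed.

Lemma mpoly_zero p : (forall x, p.@[x] = 0) -> p = 0.
Proof.
move=> p0; apply/mpolyP=> m; rewrite mcoeff0.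
suff [q [q0 qm qe]] : exists q : {mpoly F[n]},
    [/\ forall x, q.@[x] = 0, q@_m = p@_m
      & forall m', m' != m -> q@_m' = 0].
  have : q = p@_m *: 'X_[m].
    apply/mpolyP=> m'; rewrite mcoeffZ mcoeffX eq_sym; case: eqP => [->|/eqP /qe ->].
      by rewrite qm mulr1.
    by rewrite mulr0.
  move/(congr1 (meval (fun=> 1))); rewrite q0 mevalZ mevalX.
  by rewrite big1 ?mulr1 // => i _; rewrite expr1n.
(* Taking components in one variable after the other keeps all values zero and the coefficient at
   [m], and in the end leaves at most the monomial [m]. *)
have [q [q0 qm qe]] : exists q : {mpoly F[n]},
    [/\ forall x, q.@[x] = 0, q@_m = p@_m
      & forall (m' : 'X_{1..n}) i, i \in enum 'I_n -> m' i != m i -> q@_m' = 0].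
  elim: (enum 'I_n) => [|i r [q [q0 qm qe]]]; first by exists p.
  exists (comp_on (pred1 i) (m i) q); split=> [x||m' j].
  - exact: comp_on_vanish.
  - by rewrite mcoeff_comp_on /deg_on big_pred1_eq eqxx.
  rewrite inE mcoeff_comp_on /deg_on big_pred1_eq => /orP[/eqP->/negPf ->//|jr mj].
  by rewrite (qe _ j) // if_same.
exists q; split=> // m' m'm; suff /existsP[i mi] : [exists i, m' i != m i].
  by apply: (qe _ i); rewrite ?mem_enum.
apply: contraNT m'm; rewrite negb_exists => /forallP e; apply/eqP/mnmP=> i.
by have := e i; rewrite negbK => /eqP.
Qed.

Lemma mpoly_eq p q : (forall x, p.@[x] = q.@[x]) -> p = q.
Proof.
move=> e; apply/eqP; rewrite -subr_eq0; apply/eqP/mpoly_zero => x.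
by rewrite mevalB e subrr.
Qed.

Lemma deg_on_scaling S k p :
  (forall s x, s != 0 -> p.@[scale_on S s x] = s ^+ k * p.@[x]) ->
  forall m, m \in msupp p -> deg_on S m = k.
Proof.
move=> ps m; rewrite mcoeff_msupp => pm; apply/eqP; apply: contraNT pm => mk.
have -> : p@_m = (comp_on S (deg_on S m) p)@_m by rewrite mcoeff_comp_on eqxx.
suff -> : comp_on S (deg_on S m) p = 0 by rewrite mcoeff0.
apply: mpoly_zero => x; rewrite (@comp_on_coef S p x (p.@[x] *: 'X^k)).
  by rewrite coefZ coefXn (negPf mk) mulr0.
by move=> s s0; rewrite ps // hornerZ hornerXn mulrC.
Qed.

End Evaluation.

#[local] Arguments mxtens_unindex : simpl never.
#[local] Arguments mxtens_index : simpl never.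

(** * Forms on spaces of tensors *)

Section LinearSubstitution.
Variables (F : numFieldType) (n : nat).
Implicit Types (p : {mpoly F[n]}) (h : 'M[F]_n).

(** [mpoly_act h] is [lsub (invmx h)]. Without the inverse, singular substitutions are available,
    such as the one in [rank_ideal_degenerate]. *)
Definition lsub h p : {mpoly F[n]} :=
  p \mPo [tuple \sum_(j < n) h i j *: 'X_j | i < n].

Lemma meval_lsub h p x :
  (lsub h p).@[x] = p.@[fun i => \sum_(j < n) h i j * x j].
Proof.
rewrite comp_mpoly_meval; apply: meval_eq => i.
rewrite tnth_mktuple raddf_sum /=; apply: eq_bigr => j _.
by rewrite mevalZ mevalXU.
Qed.

Lemma deg_on_predT (m : 'X_{1..n}) : deg_on xpredT m = mdeg m.
Proof. by rewrite mdegE. Qed.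

Lemma homog_meval d p s x : p \is d.-homog ->
  p.@[fun i => s * x i] = s ^+ d * p.@[x].
Proof.
move=> /dhomogP ph; rewrite -(@meval_scale _ _ xpredT) // => m mp.
by rewrite deg_on_predT (ph m mp).
Qed.

Lemma homog_of_scaling d p :
  (forall s x, s != 0 -> p.@[fun i => s * x i] = s ^+ d * p.@[x]) ->
  p \is d.-homog.
Proof.
move=> ps; apply/dhomogP=> m mp /=; rewrite -[LHS]/(mdeg m) -deg_on_predT.
exact: (@deg_on_scaling _ _ xpredT d p).
Qed.

Lemma lsub_homog d h p : p \is d.-homog -> lsub h p \is d.-homog.
Proof.
move=> ph; apply: homog_of_scaling => s x _; rewrite !meval_lsub -homog_meval //.
by apply: meval_eq => i; rewrite mulr_sumr; apply: eq_bigr => j _; rewrite mulrCA.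
Qed.

Lemma comp_on_homog S k d p : p \is d.-homog -> comp_on S k p \is d.-homog.
Proof.
move=> /dhomogP ph; apply/dhomogP=> m; rewrite mcoeff_msupp mcoeff_comp_on.
by case: ifP; [rewrite -mcoeff_msupp => _ /ph | rewrite eqxx].
Qed.

End LinearSubstitution.

Section Tensors.
Variables (F : numFieldType) (a b c : nat).
Local Notation tensor := ('I_a -> 'I_b -> 'I_c -> F).
Implicit Types (p : {mpoly F[a * b * c]}) (x y : tensor).

Definition tidx i j k : 'I_(a * b * c) :=
  mxtens_index (mxtens_index (i, j), k).

Definition flat x (l : 'I_(a * b * c)) : F :=
  x (mxtens_unindex (mxtens_unindex l).1).1
    (mxtens_unindex (mxtens_unindex l).1).2 (mxtens_unindex l).2.

Definition ev p x : F := p.@[flat x].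

Lemma tidxP l : exists i j k, l = tidx i j k.
Proof.
case E : (mxtens_unindex l) => [ij k]; case E' : (mxtens_unindex ij) => [i j].
by exists i, j, k; rewrite /tidx -E' mxtens_unindexK -E mxtens_unindexK.
Qed.

Lemma flatE x i j k : flat x (tidx i j k) = x i j k.
Proof. by rewrite /flat /tidx !mxtens_indexK. Qed.

Lemma ev_ext p x y : (forall i j k, x i j k = y i j k) -> ev p x = ev p y.
Proof. by move=> e; apply: meval_eq => l; apply: e. Qed.

Lemma ev_meval p (z : 'I_(a * b * c) -> F) :
  p.@[z] = ev p (fun i j k => z (tidx i j k)).
Proof.
by apply: meval_eq => l; have [i [j [k ->]]] := tidxP l; rewrite flatE.
Qed.

Lemma ev_zero p : (forall x, ev p x = 0) -> p = 0.
Proof. by move=> p0; apply: mpoly_zero => z; rewrite ev_meval. Qed.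

Lemma ev_eq p q : (forall x, ev p x = ev q x) -> p = q.
Proof. by move=> e; apply: mpoly_eq => z; rewrite !ev_meval. Qed.

Lemma evD p q x : ev (p + q) x = ev p x + ev q x.
Proof. exact: mevalD. Qed.

Lemma evZ s p x : ev (s *: p) x = s * ev p x.
Proof. exact: mevalZ. Qed.

Lemma ev_sum (I : Type) (r : seq I) (P : pred I) (G : I -> {mpoly F[a * b * c]}) x :
  ev (\sum_(i <- r | P i) G i) x = \sum_(i <- r | P i) ev (G i) x.
Proof. exact: raddf_sum. Qed.

Lemma lp_ev (V : lmodType F) p (x : V -> tensor) :
  (forall i j k, linewise_poly (fun v => x v i j k)) ->
  linewise_poly (fun v => ev p (x v)).
Proof. by move=> lx; apply: lp_meval => l; apply: lx. Qed.

Definition tact (gA : 'M[F]_a) (gB : 'M[F]_b) (gC : 'M[F]_c) x : tensor :=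
  fun i j k => \sum_i' \sum_j' \sum_k' gA i i' * gB j j' * gC k k' * x i' j' k'.

Definition actA (g : 'M[F]_a) x : tensor := fun i j k => \sum_i' g i i' * x i' j k.
Definition actB (g : 'M[F]_b) x : tensor := fun i j k => \sum_j' g j j' * x i j' k.
Definition actC (g : 'M[F]_c) x : tensor := fun i j k => \sum_k' g k k' * x i j k'.

Lemma sum_tidx (G : 'I_(a * b * c) -> F) :
  \sum_l G l = \sum_i \sum_j \sum_k G (tidx i j k).
Proof.
rewrite pair_bigA /= pair_bigA /=.
rewrite (reindex (fun t : 'I_a * 'I_b * 'I_c => tidx t.1.1 t.1.2 t.2)) //=.
exists (fun l => (mxtens_unindex (mxtens_unindex l).1, (mxtens_unindex l).2)).
  by move=> [[i j] k] _; cbv beta; rewrite /tidx !mxtens_indexK.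
by move=> l _; cbv beta; have [i [j [k ->]]] := tidxP l; rewrite /tidx !mxtens_indexK.
Qed.

Lemma ev_lsub gA gB gC p x :
  ev (lsub (gA *t gB *t gC) p) x = ev p (tact gA gB gC x).
Proof.
rewrite /ev meval_lsub; apply: meval_eq => l; have [i [j [k ->]]] := tidxP l.
rewrite flatE sum_tidx; apply: eq_bigr => i' _; apply: eq_bigr => j' _.
by apply: eq_bigr => k' _; rewrite flatE /tidx !tensmxE.
Qed.

Lemma sum_delta (n : nat) (i : 'I_n) (G : 'I_n -> F) :
  \sum_j (1%:M : 'M[F]_n) i j * G j = G i.
Proof.
rewrite (bigD1 i) //= mxE eqxx mul1r big1 ?addr0 // => j.
by rewrite mxE eq_sym => /negPf ->; rewrite mul0r.
Qed.

Lemma tactE gA gB gC x i j k :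
  tact gA gB gC x i j k = actA gA (actB gB (actC gC x)) i j k.
Proof.
rewrite /actA /actB /actC; apply: eq_bigr => i' _; rewrite mulr_sumr.
apply: eq_bigr => j' _; rewrite !mulr_sumr.
by apply: eq_bigr => k' _; rewrite !mulrA.
Qed.

Lemma actA1 x i j k : actA 1%:M x i j k = x i j k.
Proof. exact: sum_delta. Qed.
Lemma actB1 x i j k : actB 1%:M x i j k = x i j k.
Proof. exact: sum_delta. Qed.
Lemma actC1 x i j k : actC 1%:M x i j k = x i j k.
Proof. exact: sum_delta. Qed.

Lemma actA_ext g x y : (forall i j k, x i j k = y i j k) ->
  forall i j k, actA g x i j k = actA g y i j k.
Proof. by move=> e i j k; apply: eq_bigr => i' _; rewrite e. Qed.
Lemma actB_ext g x y : (forall i j k, x i j k = y i j k) ->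
  forall i j k, actB g x i j k = actB g y i j k.
Proof. by move=> e i j k; apply: eq_bigr => j' _; rewrite e. Qed.

Lemma tact_A g x i j k : tact g 1%:M 1%:M x i j k = actA g x i j k.
Proof.
by rewrite tactE; apply: actA_ext => ? ? ?; rewrite actB1 actC1.
Qed.
Lemma tact_C g x i j k : tact 1%:M 1%:M g x i j k = actC g x i j k.
Proof. by rewrite tactE actA1 actB1. Qed.

Lemma actA_mul g h x i j k : actA g (actA h x) i j k = actA (g *m h) x i j k.
Proof.
rewrite /actA; under eq_bigr do rewrite mulr_sumr.
rewrite exchange_big /=; apply: eq_bigr => i' _.
by rewrite mxE mulr_suml; apply: eq_bigr => i2 _; rewrite mulrA.
Qed.

Definition rank1s (I : finType) (u : I -> 'I_a -> F) (v : I -> 'I_b -> F)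
    (w : I -> 'I_c -> F) : tensor :=
  fun i j k => \sum_l u l i * v l j * w l k.

Lemma tact_rank1s gA gB gC (I : finType) u v w i j k :
  tact gA gB gC (@rank1s I u v w) i j k
    = rank1s (fun l i => \sum_i' gA i i' * u l i')
             (fun l j => \sum_j' gB j j' * v l j')
             (fun l k => \sum_k' gC k k' * w l k') i j k.
Proof.
rewrite /tact /rank1s; pose G l i' j' k' := (gA i i' * u l i') * (gB j j' * v l j')
   * (gC k k' * w l k').
transitivity (\sum_i' \sum_j' \sum_k' \sum_l G l i' j' k').
  apply: eq_bigr => i' _; apply: eq_bigr => j' _; apply: eq_bigr => k' _.
  by rewrite mulr_sumr; apply: eq_bigr => l _; rewrite /G; ring.
transitivity (\sum_l \sum_i' \sum_j' \sum_k' G l i' j' k').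
  under eq_bigr do (under eq_bigr do rewrite exchange_big; rewrite exchange_big).
  by rewrite exchange_big.
apply: eq_bigr => l _ /=; rewrite -mulrA mulr_suml; apply: eq_bigr => i' _.
rewrite mulr_suml mulr_sumr; apply: eq_bigr => j' _.
by rewrite !mulr_sumr; apply: eq_bigr => k' _; rewrite /G !mulrA.
Qed.

Definition sliceA i0 : pred 'I_(a * b * c) :=
  fun l => (mxtens_unindex (mxtens_unindex l).1).1 == i0.
Definition sliceC k0 : pred 'I_(a * b * c) :=
  fun l => (mxtens_unindex l).2 == k0.

Definition vscale n (i0 : 'I_n) (s : F) i : F := if i == i0 then s else 1.

Definition scaleA i0 s x : tensor := fun i j k => vscale i0 s i * x i j k.
Definition scaleC k0 s x : tensor := fun i j k => vscale k0 s k * x i j k.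

Lemma ev_scaleA i0 s x p : p.@[scale_on (sliceA i0) s (flat x)] = ev p (scaleA i0 s x).
Proof.
apply: meval_eq => l; rewrite /scale_on /sliceA /flat /scaleA /vscale.
by case: ifP; rewrite ?mul1r.
Qed.
Lemma ev_scaleC k0 s x p : p.@[scale_on (sliceC k0) s (flat x)] = ev p (scaleC k0 s x).
Proof.
apply: meval_eq => l; rewrite /scale_on /sliceC /flat /scaleC /vscale.
by case: ifP; rewrite ?mul1r.
Qed.

Lemma scaleC_rank1s k0 s (I : finType) u v w i j k :
  scaleC k0 s (@rank1s I u v w) i j k
    = rank1s u v (fun l k => vscale k0 s k * w l k) i j k.
Proof.
by rewrite /scaleC /rank1s mulr_sumr; apply: eq_bigr => l _; rewrite mulrCA.
Qed.
Lemma scaleA_rank1s k0 s (I : finType) u v w i j k :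
  scaleA k0 s (@rank1s I u v w) i j k
    = rank1s (fun l i => vscale k0 s i * u l i) v w i j k.
Proof.
by rewrite /scaleA /rank1s mulr_sumr; apply: eq_bigr => l _; rewrite !mulrA.
Qed.

(** The summands may be zero or dependent, so this ideal is stable under all substitutions
    [gA *t gB *t gC], singular ones included. [secant_ideal] relates it to the secant variety. *)
Definition rank_ideal r d p : Prop :=
  p \is d.-homog /\ forall u v w, ev p (@rank1s 'I_r u v w) = 0.

Lemma rank_ideal_act r d gA gB gC p :
  rank_ideal r d p -> rank_ideal r d (lsub (gA *t gB *t gC) p).
Proof.
move=> [ph p0]; split=> [|u v w]; first exact: lsub_homog.
by rewrite ev_lsub (ev_ext _ (@tact_rank1s gA gB gC _ u v w)); apply: p0.
Qed.

Lemma rank_ideal_compA r d i0 k p :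
  rank_ideal r d p -> rank_ideal r d (comp_on (sliceA i0) k p).
Proof.
move=> [ph p0]; split=> [|u v w]; first exact: comp_on_homog.
apply: comp_on_vanish => s _; rewrite ev_scaleA.
by rewrite (ev_ext _ (@scaleA_rank1s i0 s _ u v w)); apply: p0.
Qed.
Lemma rank_ideal_compC r d k0 k p :
  rank_ideal r d p -> rank_ideal r d (comp_on (sliceC k0) k p).
Proof.
move=> [ph p0]; split=> [|u v w]; first exact: comp_on_homog.
apply: comp_on_vanish => s _; rewrite ev_scaleC.
by rewrite (ev_ext _ (@scaleC_rank1s k0 s _ u v w)); apply: p0.
Qed.

End Tensors.

Section SwapFactors.
Variables (F : numFieldType) (a c : nat).
Local Notation tensor := ('I_a -> 'I_a -> 'I_c -> F).

(** Exchanges the first two tensor factors, which have equal dimension here, so that facts about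
    A-slices carry over to B-slices. *)
Definition swap_mx : 'M[F]_(a * a * c) := \matrix_(l, l')
  \prod_(m <- [:: ((mxtens_unindex (mxtens_unindex l).1).1
                      == (mxtens_unindex (mxtens_unindex l').1).2);
                  ((mxtens_unindex (mxtens_unindex l).1).2
                      == (mxtens_unindex (mxtens_unindex l').1).1);
                  ((mxtens_unindex l).2 == (mxtens_unindex l').2)]) (m : bool)%:R.

Lemma ev_swap (p : {mpoly F[a * a * c]}) (x : tensor) :
  ev (lsub swap_mx p) x = ev p (fun i j k => x j i k).
Proof.
rewrite /ev meval_lsub; apply: meval_eq => l; have [i [j [k ->]]] := tidxP l.
rewrite flatE (bigD1 (tidx j i k)) //= flatE mxE !big_cons big_nil.
rewrite /tidx !mxtens_indexK /= !eqxx !mul1r big1 ?addr0 //.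
move=> l'; have [i' [j' [k' ->]]] := tidxP l'.
rewrite mxE !big_cons big_nil /tidx !mxtens_indexK /=.
case: (i =P j') => [->|_]; last by rewrite !mul0r.
case: (j =P i') => [->|_]; last by rewrite !(mul0r, mulr0).
case: (k =P k') => [->|_]; last by rewrite !(mul0r, mulr0).
by rewrite eqxx.
Qed.

Lemma rank_ideal_swap r d (p : {mpoly F[a * a * c]}) :
  rank_ideal r d p -> rank_ideal r d (lsub swap_mx p).
Proof.
move=> [ph p0]; split=> [|u v w]; first exact: lsub_homog.
rewrite ev_swap -[RHS](p0 v u w); apply: ev_ext => i j k.
by apply: eq_bigr => l _; rewrite (mulrC (u l j)).
Qed.

End SwapFactors.

(** * The ideal of the secant variety *)

Section SecantIdeal.
Variables (F : numFieldType) (a b c : nat).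
Implicit Type p : {mpoly F[a.+1 * b.+1 * c.+1]}.

Lemma segre_coord (u : 'rV[F]_a.+1) (v : 'rV[F]_b.+1) (w : 'rV[F]_c.+1) i j k :
  (u *t v *t w : 'rV_(a.+1 * b.+1 * c.+1)) 0 (tidx i j k) = u 0 i * v 0 j * w 0 k.
Proof.
rewrite /tidx mxE mxtens_indexK /= mxE mxtens_indexK /=.
by congr (u _ _ * v _ _ * w _ _); apply/val_inj; rewrite /= ?modn1.
Qed.

Lemma lp_entry (V : lmodType F) m n (i : 'I_m) (j : 'I_n) (A : V -> 'M[F]_(m, n)) :
  linear A -> linewise_poly (fun x => A x i j).
Proof.
move=> lA; apply: lp_lin => x y s.
by rewrite addrC lA !mxE addrC.
Qed.

(** Passing to the closure keeps the ideal, since the closure is defined by the vanishing of forms.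
    A form in this ideal vanishes on sums of independent decomposable tensors, hence on all sums by
    density; independence is generic because the number of summands, [c.+1], is the dimension of the
    third factor. *)
Lemma secant_ideal d p :
  homog_ideal d (secant c.+1 (@segre F a.+1 b.+1 c.+1)) p <-> rank_ideal c.+1 d p.
Proof.
split=> [[ph p0]|[ph p0]]; split=> //; last first.
  move=> x [_ xX]; apply: (xX d); split=> // {xX}x [y [yX yfree x0 xy]].
  have /fin_all_exists[u /fin_all_exists[v /fin_all_exists[w uvw]]] := yX.
  (* The coefficients of [x] in the spanning points are absorbed into the A-factors. *)
  rewrite ev_meval -[RHS](p0 (fun l i => coord y l x * u l 0 i)
    (fun l j => v l 0 j) (fun l k => w l 0 k)).
  apply: ev_ext => i j k; rewrite {1}(coord_span xy) summxE.
  apply: eq_bigr => l _; rewrite mxE -tnth_nth.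
  by have [_ _ _ ->] := uvw l; rewrite segre_coord !mulrA.
move=> u v w.
pose V := ('M[F]_(c.+1, a.+1) * 'M[F]_(c.+1, b.+1) * 'M[F]_c.+1)%type.
pose g (z : V) := ev p (rank1s (fun l i => z.1.1 l i) (fun l j => z.1.2 l j)
                               (fun l k => z.2 l k)).
(* Where [f] is nonzero, the C-factors form a basis and all A- and B-factors have nonzero first
   coordinate; this makes the decomposable tensors independent. *)
pose f (z : V) := \det z.2 * \prod_l z.1.1 l 0 * \prod_l z.1.2 l 0.
suff g0 z : g z = 0.
  rewrite -[RHS](g0 (\matrix_(l, i) u l i, \matrix_(l, j) v l j, \matrix_(l, k) w l k)).
  by apply: ev_ext => i j k; apply: eq_bigr => l _; rewrite !mxE.
have l1 l i : linewise_poly (fun z : V => z.1.1 l i) by apply: lp_entry.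
have l2 l i : linewise_poly (fun z : V => z.1.2 l i) by apply: lp_entry.
have l3 l i : linewise_poly (fun z : V => z.2 l i) by apply: lp_entry.
apply: (@lp_dense F V f g (const_mx 1, const_mx 1, 1%:M)).
- by apply: lp_mul; [apply: lp_mul; [apply: lp_det|apply: lp_prod]|apply: lp_prod].
- apply: lp_ev => i j k; apply: lp_sum => l; apply: lp_mul => //.
  exact: lp_mul.
- rewrite /f /= det1 !big1 ?mulr1 ?oner_eq0 // => l _; exact: mxE.
move=> {z} [[A B] W]; rewrite /f /= !mulf_eq0 !negb_or => /andP[/andP[W0 A0 B0]].
have {}A0 l : A l 0 != 0 by have /prodf_neq0 := A0; apply.
have {}B0 l : B l 0 != 0 by have /prodf_neq0 := B0; apply.
have {}W0 : W \in unitmx by rewrite unitmxE unitfE.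
pose y : c.+1.-tuple 'rV[F]_(a.+1 * b.+1 * c.+1) :=
  [tuple (row l A *t row l B *t row l W : 'rV_(a.+1 * b.+1 * c.+1)) | l < c.+1].
have yE (l : 'I_c.+1) i j k : y`_l 0 (tidx i j k) = A l i * B l j * W l k.
  by rewrite -tnth_nth tnth_mktuple segre_coord !mxE.
have yfree : free y.
  apply/freeP=> s s0 l.
  (* The coordinates (0, 0, k) of the linear relation already suffice. *)
  have : (\row_m (s m * A m 0 * B m 0)) *m W = 0.
    apply/rowP=> k; rewrite mxE [RHS]mxE.
    have /rowP/(_ (tidx 0 0 k)) := s0; rewrite summxE [RHS]mxE => {2}<-.
    by apply: eq_bigr => m _; rewrite mxE [in RHS]mxE yE !mulrA.
  move/(congr1 (mulmx^~ (invmx W))); rewrite mulmxK // mul0mx.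
  move/rowP/(_ l); rewrite !mxE => /eqP.
  by rewrite !mulf_eq0 (negPf (A0 l)) (negPf (B0 l)) !orbF => /eqP.
pose x := \sum_(l < c.+1) y`_l.
have xg : x != 0.
  apply/eqP=> x0; have /freeP/(_ (fun=> 1)) := yfree.
  rewrite (eq_bigr (fun l : 'I_c.+1 => y`_l)) => [|l _]; last by rewrite scale1r.
  by move=> /(_ x0 0)/eqP; rewrite oner_eq0.
have -> : g (A, B, W) = p.@[x 0].
  rewrite ev_meval; apply: ev_ext => i j k; rewrite summxE.
  by apply: eq_bigr => l _; rewrite yE.
apply: p0; split=> // s q [_]; apply; exists y; split=> //.
  move=> l; rewrite tnth_mktuple; exists (row l A), (row l B), (row l W).
  split=> //; apply/eqP.
  - by move/rowP/(_ 0); rewrite !mxE => e; have := A0 l; rewrite e eqxx.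
  - by move/rowP/(_ 0); rewrite !mxE => e; have := B0 l; rewrite e eqxx.
  move=> Wl; have : \row_m (m == l)%:R *m W = 0.
    rewrite -[RHS]Wl rowE; congr (_ *m _); apply/rowP=> m.
    by rewrite !mxE eqxx.
  move/(congr1 (mulmx^~ (invmx W))); rewrite mulmxK // mul0mx => /rowP/(_ l).
  by rewrite !mxE eqxx => /eqP; rewrite oner_eq0.
by apply: rpred_sum => l _; apply/memv_span/mem_nth; rewrite size_tuple.
Qed.

End SecantIdeal.

(** * Semi-invariance of forms vanishing in rank 4 *)

Section SmallMatrices.
Variable R : comNzRingType.

Lemma det2 (A : 'M[R]_2) : \det A = A 0 0 * A 1 1 - A 0 1 * A 1 0.
Proof.
rewrite (expand_det_row _ 0) !big_ord_recl big_ord0 /cofactor !det_mx11 !mxE /=.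
rewrite (_ : lift 0 0 = 1 :> 'I_2); last exact/val_inj.
rewrite (_ : lift 1 0 = 0 :> 'I_2); last exact/val_inj.
by rewrite /= expr0 expr1 !mul1r mulN1r mulrN addr0.
Qed.

Lemma det3 (A : 'M[R]_3) (i0 := 0 : 'I_3) (i1 := 1 : 'I_3) (i2 := 2%:R : 'I_3) :
  \det A = A i0 i0 * (A i1 i1 * A i2 i2 - A i1 i2 * A i2 i1)
         - A i0 i1 * (A i1 i0 * A i2 i2 - A i1 i2 * A i2 i0)
         + A i0 i2 * (A i1 i0 * A i2 i1 - A i1 i1 * A i2 i0).
Proof.
rewrite (expand_det_row _ 0) !big_ord_recl big_ord0 /cofactor !det2 !mxE.
have e1 : lift 0 0 = i1 by apply/val_inj.
have e2 : lift 0 1 = i2 by apply/val_inj.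
have e3 : lift i1 0 = i0 by apply/val_inj.
have e4 : lift i1 1 = i2 by apply/val_inj.
have e5 : lift i2 0 = i0 by apply/val_inj.
have e6 : lift i2 1 = i1 by apply/val_inj.
rewrite (_ : lift 0 (lift 0 0) = i2) ?e1 ?e2; last exact/val_inj.
rewrite e3 e4 e5 e6 /= /bump /= !exprS expr0; ring.
Qed.

End SmallMatrices.

Section PolynomialEntries.
Variables (F : numFieldType) (V : lmodType F).
Implicit Types q r : V -> {poly F}.

Definition linewise_coefs q := forall i, linewise_poly (fun x => (q x)`_i).

Lemma lc_mul q r : linewise_coefs q -> linewise_coefs r ->
  linewise_coefs (fun x => q x * r x).
Proof.
move=> lq lr i; apply: (@lp_ext _ _ (fun x => \sum_(j < i.+1) (q x)`_j * (r x)`_(i - j))).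
  by move=> x; rewrite coefM.
by apply: lp_sum => j; apply: lp_mul.
Qed.

Lemma lc_const (c : {poly F}) : linewise_coefs (fun=> c).
Proof. by move=> i; apply: lp_const. Qed.

Lemma lc_prod (I : Type) (s : seq I) (P : pred I) (G : I -> V -> {poly F}) :
  (forall i, linewise_coefs (G i)) -> linewise_coefs (fun x => \prod_(i <- s | P i) G i x).
Proof.
move=> lG; elim: s => [|i s IH] n.
  by apply: lp_ext (@lp_const F V (1 : {poly F})`_n) => x; rewrite big_nil.
case Pi : (P i).
  apply: (@lp_ext _ _ (fun x => (G i x * \prod_(i <- s | P i) G i x)`_n)).
    by move=> x; rewrite big_cons Pi.
  exact: lc_mul.
by apply: lp_ext (IH n) => x; rewrite big_cons Pi.
Qed.

Lemma lc_det n (A : V -> 'M[{poly F}]_n) :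
  (forall i j, linewise_coefs (fun x => A x i j)) -> linewise_coefs (fun x => \det (A x)).
Proof.
move=> lA k; apply: (@lp_ext _ _ (fun x => \sum_(s : 'S_n)
    ((-1) ^+ s * \prod_i A x i (s i))`_k)).
  by move=> x; rewrite -coef_sum.
apply: lp_sum => s; apply: (@lc_mul (fun=> (-1) ^+ s)); first exact: lc_const.
exact: lc_prod.
Qed.

End PolynomialEntries.

(** * Kronecker normal form of a generic pencil of 3 x 4 matrices *)

Section Pencils.
Variable F : numFieldType.
Implicit Types (Z : 'M[F]_(3, 4)) (N : 'M[F]_3) (K : 'M[F]_4).

Definition pencil_poly Z1 Z2 : 'M[{poly F}]_(3, 4) :=
  \matrix_(i, j) ((Z2 i j)%:P - (Z1 i j)%:P * 'X).

(* The signed maximal minors of Z2 - t Z1 form a kernel vector of degree 3 in t. *)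
Definition pencil_ker Z1 Z2 (j : 'I_4) : {poly F} :=
  (-1) ^+ j * \det (col' j (pencil_poly Z1 Z2)).

(** Laplace expansion of the 4 x 4 determinant in which row [i] of the pencil occurs twice. *)
Lemma pencil_kerP Z1 Z2 i : \sum_j pencil_poly Z1 Z2 i j * pencil_ker Z1 Z2 j = 0.
Proof.
pose A : 'M[{poly F}]_4 := \matrix_(r, j) pencil_poly Z1 Z2 (odflt i (unlift 0 r)) j.
have -> : \sum_j pencil_poly Z1 Z2 i j * pencil_ker Z1 Z2 j = \det A.
  rewrite (expand_det_row _ 0); apply: eq_bigr => j _.
  rewrite [A _ _]mxE unlift_none /=; congr (_ * _); rewrite /cofactor add0n.
  congr (_ * \det _); apply/matrixP=> r j'; rewrite !mxE.
  by rewrite liftK.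
apply: (determinant_alternate (neq_lift 0 i)) => j; rewrite !mxE.
by rewrite liftK unlift_none.
Qed.

Lemma size_pencil_ker Z1 Z2 j : (size (pencil_ker Z1 Z2 j) <= 4)%N.
Proof.
have sz i j' : (size (pencil_poly Z1 Z2 i j') <= 2)%N.
  rewrite mxE (leq_trans (size_polyD _ _)) // geq_max size_polyN.
  rewrite (leq_trans (size_polyC_leq1 _)) //=.
  rewrite (leq_trans (size_polyMleq _ _)) // size_polyX addn2 /=.
  by rewrite ltnS size_polyC_leq1.
have szs n (q : {poly F}) : size ((-1) ^+ n * q) = size q.
  by rewrite -signr_odd; case: (odd n); rewrite ?mulN1r ?size_polyN ?mul1r.
rewrite szs (leq_trans (size_sum _ _ _)) //; apply/bigmax_leqP => s _; rewrite szs.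
rewrite (leq_trans (size_poly_prod_leq _ _)) // leq_subLR card_ord.
rewrite (leq_trans _ (_ : 7 <= _)%N) // ltnS.
apply: (@leq_trans (\sum_(i < 3) 2)%N); last by rewrite sum_nat_const card_ord.
by apply: leq_sum => i _; rewrite mxE; apply: sz.
Qed.

(** Let k_i be the coefficient of t^i in the kernel vector k(t). The columns of [pencil_K] are the
    k_i, those of [pencil_N] are Z1 k_0, Z1 k_1, Z1 k_2. Comparing coefficients in (Z2 - t Z1) k(t)
    = 0 gives Z2 k_0 = 0, Z2 k_i = Z1 k_(i-1) and Z1 k_3 = 0, which are the matrix identities
    [pencil_std1] and [pencil_std2]. *)
Definition pencil_K Z1 Z2 : 'M[F]_4 := \matrix_(j, i) (pencil_ker Z1 Z2 j)`_i.
Definition pencil_N Z1 Z2 : 'M[F]_3 :=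
  \matrix_(r, i) \sum_j Z1 r j * (pencil_ker Z1 Z2 j)`_i.

(** [std1] = (I 0) and [std2] = (0 I) form the Kronecker block L_3, with kernel vector (1, t, t^2,
    t^3). *)
Definition std1 : 'M[F]_(3, 4) := \matrix_(i, j) (i == j :> nat)%:R.
Definition std2 : 'M[F]_(3, 4) := \matrix_(i, j) (i.+1 == j :> nat)%:R.

Lemma pencil_ker_coef Z1 Z2 r n :
  \sum_j Z2 r j * (pencil_ker Z1 Z2 j)`_n
    = if n is m.+1 then \sum_j Z1 r j * (pencil_ker Z1 Z2 j)`_m else 0.
Proof.
have := congr1 (fun q : {poly F} => q`_n) (pencil_kerP Z1 Z2 r).
rewrite coef0 coef_sum => e; apply/eqP; rewrite -subr_eq0; apply/eqP; rewrite -[RHS]e.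
case: n {e} => [|n].
  rewrite /= subr0; apply: eq_bigr => j _.
  by rewrite mxE mulrBl coefB !coefCM -mulrA coefCM coefXM /= mulr0 subr0.
rewrite -sumrB; apply: eq_bigr => j _.
by rewrite mxE mulrBl coefB !coefCM -mulrA coefCM coefXM.
Qed.

Lemma mul_std1 N (r : 'I_3) (j : 'I_4) :
  (N *m std1) r j = if insub (j : nat) is Some i then N r i else 0.
Proof.
rewrite mxE; case: insubP => [i _ ij|/negPf nj].
  rewrite (bigD1 i) //= mxE ij eqxx mulr1 big1 ?addr0 // => i' i'i.
  by rewrite mxE -ij val_eqE (negPf i'i) mulr0.
rewrite big1 // => i _; rewrite mxE; case: eqP => [e|]; last by rewrite mulr0.
by rewrite -e ltn_ord in nj.
Qed.

Lemma mul_std2 N (r : 'I_3) (j : 'I_4) :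
  (N *m std2) r j = if unlift 0 j is Some i then N r i else 0.
Proof.
rewrite mxE; case: unliftP => [i|] ->.
  rewrite (bigD1 i) //= mxE eqxx mulr1 big1 ?addr0 // => i' i'i.
  by rewrite mxE eqSS val_eqE (negPf i'i) mulr0.
by rewrite big1 // => i _; rewrite mxE mulr0.
Qed.

Lemma pencil_std1 Z1 Z2 : Z1 *m pencil_K Z1 Z2 = pencil_N Z1 Z2 *m std1.
Proof.
apply/matrixP=> r j; rewrite mul_std1 mxE.
have -> : \sum_i Z1 r i * pencil_K Z1 Z2 i j = \sum_i Z1 r i * (pencil_ker Z1 Z2 i)`_j.
  by apply: eq_bigr => i _; rewrite mxE.
case: insubP => [i _ <-|nj]; first by rewrite mxE.
have -> : (j : nat) = 3 by have := ltn_ord j; move: nj; case: (j : nat) => [|[|[|[]]]].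
have /esym -> := pencil_ker_coef Z1 Z2 r 4; rewrite big1 // => i _.
by rewrite nth_default ?mulr0 // size_pencil_ker.
Qed.

Lemma pencil_std2 Z1 Z2 : Z2 *m pencil_K Z1 Z2 = pencil_N Z1 Z2 *m std2.
Proof.
apply/matrixP=> r j; rewrite mul_std2 mxE.
have -> : \sum_i Z2 r i * pencil_K Z1 Z2 i j = \sum_i Z2 r i * (pencil_ker Z1 Z2 i)`_j.
  by apply: eq_bigr => i _; rewrite mxE.
rewrite pencil_ker_coef; case: unliftP => [i|] -> //=.
by rewrite mxE.
Qed.

Lemma pencil_ker_std j : pencil_ker std1 std2 j = 'X^j.
Proof.
rewrite /pencil_ker det3 !mxE.
case: j => [[|[|[|[|//]]]] ?] /=; rewrite /bump /= ?exprS ?expr0 ?polyC0 ?polyC1; ring.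
Qed.

Lemma pencil_K_std : pencil_K std1 std2 = 1%:M.
Proof. by apply/matrixP=> i j; rewrite !mxE pencil_ker_std coefXn eq_sym. Qed.

Lemma pencil_N_std : pencil_N std1 std2 = 1%:M.
Proof.
apply/matrixP=> r j; rewrite mxE (bigD1 (widen_ord (leqnSn 3) r)) //= !mxE eqxx mul1r.
rewrite pencil_ker_std coefXn /= big1 ?addr0 1?eq_sym // => i ir.
rewrite mxE; case: eqP => [e|]; rewrite ?mul0r //; case/eqP: ir; exact/val_inj.
Qed.

(** The normal form is reached as soon as [pencil_N] and [pencil_K] are invertible. This open
    condition is satisfied somewhere: for the standard pencil both are identity matrices. *)
Lemma pencil_dense (g : 'M[F]_(3, 4) * 'M[F]_(3, 4) -> F) : linewise_poly g ->
  (forall N K, N \in unitmx -> K \in unitmx -> g (N *m std1 *m K, N *m std2 *m K) = 0) ->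
  forall z, g z = 0.
Proof.
move=> lg g0.
have lk j : linewise_coefs (fun z : 'M[F]_(3, 4) * 'M[F]_(3, 4) => pencil_ker z.1 z.2 j).
  apply: (@lc_mul _ _ (fun=> (-1) ^+ j)); first exact: lc_const.
  apply: lc_det => r i n; apply: (@lp_ext _ _ (fun z : 'M[F]_(3, 4) * 'M[F]_(3, 4) =>
     z.2 r (lift j i) * (1 : {poly F})`_n - z.1 r (lift j i) * ('X : {poly F})`_n)).
    by move=> z; rewrite !mxE coefB coefCM -[(z.2 _ _)%:P]mulr1 coefCM.
  apply: lp_sub; apply: lp_mul; try exact: lp_const.
    by apply: lp_lin => x y s; rewrite !mxE.
  by apply: lp_lin => x y s; rewrite !mxE.
apply: (@lp_dense _ _ (fun z => \det (pencil_N z.1 z.2) * \det (pencil_K z.1 z.2))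
          g (std1, std2)) => //.
- apply: lp_mul; apply: lp_det => i j.
    apply: (@lp_ext _ _ (fun z : 'M[F]_(3, 4) * 'M[F]_(3, 4) =>
       \sum_l z.1 i l * (pencil_ker z.1 z.2 l)`_j)) => [z|]; first by rewrite mxE.
    apply: lp_sum => l; apply: lp_mul; last exact: lk.
    by apply: lp_lin => x y s; rewrite !mxE.
  apply: (@lp_ext _ _ (fun z : 'M[F]_(3, 4) * 'M[F]_(3, 4) =>
     (pencil_ker z.1 z.2 i)`_j)) => [z|]; first by rewrite mxE.
  exact: lk.
- by rewrite pencil_N_std pencil_K_std !det1 mulr1 oner_eq0.
move=> [Z1 Z2] /=; rewrite mulf_eq0 negb_or -!unitfE -!unitmxE => /andP[uN uK].
rewrite -(g0 (pencil_N Z1 Z2) (invmx (pencil_K Z1 Z2))) ?unitmx_inv //.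
by rewrite -pencil_std1 -pencil_std2 !mulmxK.
Qed.

End Pencils.

(** * Forms of degree at most 1 in one A-slice *)

Section SliceDegree.
Variable F : numFieldType.
Local Notation tensor := ('I_3 -> 'I_3 -> 'I_4 -> F).
Implicit Types (p : {mpoly F[3 * 3 * 4]}) (Z : 'M[F]_(3, 4)).

(** Row [m] of the adjugate consists of cofactors of column [m], the only column that contains node
    [m]. This allows that node to vary while the dual vector stays fixed. *)
Lemma adj_Vandermonde_row (s s' : 'rV[F]_4) m j :
  (forall l, l != m -> s 0 l = s' 0 l) ->
  (\adj (Vandermonde 4 s)) m j = (\adj (Vandermonde 4 s')) m j.
Proof.
move=> ss'; rewrite !mxE /cofactor; congr (_ * \det _); apply/matrixP=> r l.
by rewrite !mxE ss' // eq_sym neq_lift.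
Qed.

Lemma Vandermonde_unit n (s : 'rV[F]_n) :
  (forall l m, l != m -> s 0 l != s 0 m) -> Vandermonde n s \in unitmx.
Proof.
move=> sd; rewrite unitmxE unitfE det_Vandermonde.
apply/prodf_neq0 => l _; apply/prodf_neq0 => m lm.
by rewrite subr_eq0 sd // neq_ltn lm orbT.
Qed.

Variables i0 i1 i2 : 'I_3.
Hypotheses (i10 : i1 != i0) (i20 : i2 != i0) (i12 : i1 != i2).

Definition of_rows Z1 Z2 Z3 : tensor := fun i j k =>
  if i == i0 then Z3 j k else if i == i1 then Z1 j k else Z2 j k.

Lemma of_rowsE (x : tensor) i j k :
  of_rows (\matrix_(j, k) x i1 j k) (\matrix_(j, k) x i2 j k) (\matrix_(j, k) x i0 j k)
    i j k = x i j k.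
Proof.
rewrite /of_rows; case: eqP => [->|/eqP a]; first by rewrite mxE.
case: eqP => [->|/eqP b]; rewrite mxE //; congr (x _ j k); apply/val_inj.
move: i0 i1 i2 i i10 i20 i12 a b => [[|[|[|//]]] ?] [[|[|[|//]]] ?] [[|[|[|//]]] ?] [[|[|[|//]]] ?];
  by rewrite -!val_eqE.
Qed.

Variables (k : nat) (p : {mpoly F[3 * 3 * 4]}).
Hypotheses (k1 : (k <= 1)%N) (pI : rank_ideal 4 6 p).
Hypothesis pk : forall s x, ev p (scaleA i0 s x) = s ^+ k * ev p x.

Lemma of_rows_scale Z1 Z2 Z3 s :
  ev p (of_rows Z1 Z2 (s *: Z3)) = s ^+ k * ev p (of_rows Z1 Z2 Z3).
Proof.
rewrite -pk; apply: ev_ext => i j l; rewrite /of_rows /scaleA /vscale.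
by case: eqP => _; rewrite ?mxE ?mul1r.
Qed.

(* (std1, std2) is the sum of (1, t_l) (x) (1, t_l, t_l^2) (x) w_l, where the w_l form the
   basis dual to the four points (1, t_l, t_l^2, t_l^3) of the twisted cubic. *)
Lemma ev_std_rank1 (t : 'rV[F]_4) m s : (forall l l', l != l' -> t 0 l != t 0 l') ->
  ev p (of_rows (std1 F) (std2 F)
    (s *: \matrix_(j < 3, l < 4) (t 0 m ^+ j * (\adj (Vandermonde 4 t)) m l))) = 0.
Proof.
move=> td; have uV := Vandermonde_unit td; set A := Vandermonde 4 t in uV *.
have WE l j : (\adj A) l j = \det A * invmx A l j.
  rewrite /invmx uV [in RHS]mxE mulrA divff ?mul1r //.
  by rewrite -unitfE -unitmxE.
(* The slice [i0] comes from summand [m] alone; the factor [\det A] turns the dual vector into a row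
   of the adjugate. *)
rewrite -[RHS](pI.2 (fun l i => if i == i0 then (if l == m then s * \det A else 0) else
    if i == i1 then 1 else t 0 l) (fun l j => t 0 l ^+ j) (fun l n => invmx A l n)).
have AW (e : 'I_4) n : \sum_l t 0 l ^+ e * invmx A l n = (e == n)%:R.
  have := mulmxV uV => /matrixP/(_ e n); rewrite !mxE => <-.
  by apply: eq_bigr => l _; rewrite [A _ _]mxE.
apply: ev_ext => i j n; rewrite /of_rows /rank1s; case: eqP => _.
  rewrite 2!mxE -/A WE (bigD1 m) //= eqxx big1 ?addr0; first by ring.
  by move=> l /negPf ->; rewrite !mul0r.
case: eqP => _; rewrite mxE.
  rewrite -(AW (widen_ord (leqnSn 3) j)) /=.
  by apply: eq_bigr => l _; rewrite mul1r.
rewrite -(AW (lift 0 j)) /=.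
by apply: eq_bigr => l _; rewrite exprS.
Qed.

(** In degree 0 the slice [Z] may be replaced by zero. In degree 1 the value is linear in [Z], and
    it vanishes on (1, t, t^2) (x) w for every t distinct from three fixed nodes, where w is a row
    of the adjugate. Since w does not depend on t, this is a polynomial in t with zero coefficients;
    they are the values at the tensors e_j (x) w, which span. *)
Lemma ev_std Z : ev p (of_rows (std1 F) (std2 F) Z) = 0.
Proof.
pose s : 'rV[F]_4 := \row_l (l : nat)%:R.
have sd l l' : l != l' -> s 0 l != s 0 l' by rewrite !mxE eqr_nat.
case: k k1 pk of_rows_scale => [|[|//]] _ _ sc.
  by have := sc (std1 F) (std2 F) Z 0; rewrite mul1r scale0r => <-;
     have := ev_std_rank1 ord0 0 sd; rewrite scale0r.
pose f Z := ev p (of_rows (std1 F) (std2 F) Z).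
have lf : linewise_poly f.
  apply: lp_ev => i j l; rewrite /of_rows; case: eqP => _; last exact: lp_const.
  by apply: lp_lin => x y c; rewrite !mxE.
have fh c Y : c != 0 -> f (c *: Y) = c * f Y by rewrite /f sc expr1.
have fD := lp_homog1D lf fh.
have fs (I : Type) (r : seq I) (G : I -> 'M[F]_(3, 4)) :
    f (\sum_(i <- r) G i) = \sum_(i <- r) f (G i).
  elim: r => [|i r IH]; last by rewrite !big_cons fD IH.
  by rewrite !big_nil -[0 in LHS](scale0r (0 : 'M[F]_(3, 4))) /f sc mul0r.
have uV := Vandermonde_unit sd; set A := Vandermonde 4 s in uV.
pose G j m : 'M[F]_(3, 4) := \matrix_(j' < 3, l < 4) ((j' == j)%:R * (\adj A) m l).
have G0 j m : f (G j m) = 0.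
  pose q := \sum_(j < 3) (f (G j m))%:P * 'X^j.
  have qE t : q.[t] = \sum_(j < 3) f (t ^+ j *: G j m).
    rewrite horner_sum; apply: eq_bigr => j' _.
    by rewrite hornerM hornerC hornerXn mulrC /f sc expr1.
  suff q0 : q = 0.
    have : q`_j = 0 by rewrite q0 coef0.
    rewrite coef_sum (bigD1 j) //= coefCM coefXn eqxx mulr1 big1 ?addr0 // => j' jj.
    by rewrite coefCM coefXn eq_sym val_eqE (negPf jj) mulr0.
  (* [r] vanishes at the other nodes, where t may not be used as a fourth node. *)
  pose r := \prod_(l | l != m) ('X - (s 0 l)%:P).
  have /eqP : q * r = 0.
    apply: poly_zero_off0 => t _; rewrite hornerM.
    have [/existsP[l /andP[lm /eqP tl]]|/existsPn nt] :=
        boolP [exists l, (l != m) && (s 0 l == t)].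
      by rewrite horner_prod (bigD1 l) //= -tl hornerXsubC subrr mul0r mulr0.
    rewrite qE -fs; pose s' : 'rV[F]_4 := \row_l (if l == m then t else s 0 l).
    have s'd l l' : l != l' -> s' 0 l != s' 0 l'.
      move=> ll'; rewrite ![s' _ _]mxE.
      case: (l =P m) => [e|/eqP lm]; case: (l' =P m) => [e'|/eqP l'm].
      - by rewrite e e' eqxx in ll'.
      - by have := nt l'; rewrite l'm /= eq_sym.
      - by have := nt l; rewrite lm.
      - exact: sd.
    rewrite [f _](_ : _ = 0) ?mul0r //.
    rewrite -[RHS](ev_std_rank1 m 1 s'd) /f; congr (ev p (of_rows _ _ _)).
    apply/matrixP=> j' l; rewrite summxE scale1r (bigD1 j') //= !mxE eqxx big1.
      rewrite addr0 eqxx mul1r; congr (_ * _).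
      have := @adj_Vandermonde_row s s' m l; rewrite !mxE => -> // l' /negPf l'm.
      by rewrite !mxE l'm.
    by move=> j2 /negPf j2j; rewrite !mxE eq_sym j2j mul0r mulr0.
  rewrite mulf_eq0 => /orP[/eqP //|]; rewrite /r prodf_seq_eq0 => /hasP[l _].
  by rewrite polyXsubC_eq0 andbF.
rewrite -/(f Z).
(* Expansion of Z = Z A adj(A) / det A in the rows of the adjugate. *)
have -> : Z = \sum_j \sum_m ((Z *m A) j m / \det A) *: G j m.
  have dA : \det A != 0 by rewrite -unitfE -unitmxE.
  have {1}-> : Z = (\det A)^-1 *: (Z *m A *m \adj A).
    by rewrite -mulmxA mul_mx_adj mul_mx_scalar scalerA mulVf // scale1r.
  apply/matrixP=> j l; rewrite mxE [in LHS]mxE mulr_sumr summxE (bigD1 j) //= [X in _ = _ + X]big1.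
    rewrite addr0 summxE; apply: eq_bigr => m _.
    by rewrite [RHS]mxE [G _ _ _ _]mxE eqxx mul1r; ring.
  move=> j' /negPf jj; rewrite summxE big1 // => m _.
  by rewrite mxE [G _ _ _ _]mxE eq_sym jj mul0r mulr0.
by rewrite fs big1 // => j _; rewrite fs big1 // => m _; rewrite /f sc -/(f _) G0 mulr0.
Qed.

End SliceDegree.

Section RowDegrees.
Variable F : numFieldType.
Local Notation tensor := ('I_3 -> 'I_3 -> 'I_4 -> F).
Implicit Types (p : {mpoly F[3 * 3 * 4]}) (x : tensor).

Lemma tact_scaleA (gB : 'M[F]_3) (gC : 'M[F]_4) i0 s x i j k :
  tact 1%:M gB gC (scaleA i0 s x) i j k = scaleA i0 s (tact 1%:M gB gC x) i j k.
Proof.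
rewrite /scaleA !tactE !actA1 /actB mulr_sumr; apply: eq_bigr => j' _.
rewrite mulrCA; congr (_ * _); rewrite /actC mulr_sumr; apply: eq_bigr => k' _.
exact: mulrCA.
Qed.

Lemma low_row_degree i0 k p : (k <= 1)%N -> rank_ideal 4 6 p ->
  (forall s x, ev p (scaleA i0 s x) = s ^+ k * ev p x) -> p = 0.
Proof.
move=> k1 pI pk; apply: ev_zero => x.
have [i1 [i2 [i10 i20 i12]]] : exists i1 i2, [/\ i1 != i0, i2 != i0 & i1 != i2].
  by case: i0 {pk} => [[|[|[|//]]] ?]; [exists 1, 2%:R | exists 0, 2%:R | exists 0, 1].
rewrite -(ev_ext p (of_rowsE i10 i20 i12 x)).
set Z3 := (X in of_rows _ _ _ _ X); set Z1 := (X in of_rows _ _ X).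
set Z2 := (X in of_rows _ _ _ X).
apply: (@pencil_dense F (fun z => ev p (of_rows i0 i1 z.1 z.2 Z3)) _ _ (Z1, Z2)) => /=.
  apply: lp_ev => i j l; rewrite /of_rows; case: eqP => _; first exact: lp_const.
  by case: eqP => _; apply: lp_lin => y z s; rewrite !mxE.
move=> N K uN uK; pose q := lsub (1%:M *t N *t K^T) p.
have qI : rank_ideal 4 6 q by apply: rank_ideal_act.
have qk s y : ev q (scaleA i0 s y) = s ^+ k * ev q y.
  rewrite !ev_lsub -pk; apply: ev_ext => i j l; exact: tact_scaleA.
have := ev_std i1 k1 qI qk (invmx N *m Z3 *m invmx K).
rewrite ev_lsub => <-; apply: ev_ext => i j l.
have mulE (Z : 'M[F]_(3, 4)) :
    (N *m Z *m K) j l = \sum_j' N j j' * (\sum_l' K^T l l' * Z j' l').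
  rewrite mxE; under eq_bigr do rewrite mxE mulr_suml.
  rewrite exchange_big; apply: eq_bigr => j' _; rewrite mulr_sumr.
  by apply: eq_bigr => l' _; rewrite mxE; ring.
rewrite tactE actA1 /actB /actC /of_rows; case: (i == i0).
  by rewrite -mulE !mulmxA mulmxV // mul1mx mulmxKV.
by case: (i == i1); rewrite -mulE.
Qed.

Lemma row_degree_ge2 i0 p m : rank_ideal 4 6 p -> m \in msupp p ->
  (2 <= deg_on (sliceA (b:=3) (c:=4) i0) m)%N.
Proof.
move=> pI mp; rewrite ltnNge; apply/negP=> d1.
have /(@low_row_degree i0) : (deg_on (sliceA (b:=3) (c:=4) i0) m <= 1)%N := d1.
set S := sliceA i0; move=> /(_ _ (rank_ideal_compA i0 (deg_on S m) pI)) z.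
have : (comp_on S (deg_on S m) p)@_m = p@_m by rewrite mcoeff_comp_on eqxx.
rewrite z => [|s x]; first by move/eqP; rewrite mcoeff0 eq_sym mcoeff_eq0 mp.
by rewrite -ev_scaleA (@meval_scale _ _ _ _ _ _ (deg_on S m)) // => m'; apply: comp_on_deg.
Qed.

Lemma sum_deg_sliceA (m : 'X_{1..(3 * 3 * 4)}) :
  (\sum_(i0 < 3) deg_on (sliceA (b:=3) (c:=4) i0) m = mdeg m)%N.
Proof.
rewrite mdegE (eq_bigr (fun i0 : 'I_3 => \sum_l if sliceA i0 l then m l else 0))%N;
  last by move=> i _; rewrite /deg_on big_mkcond.
rewrite exchange_big; apply: eq_bigr => l _; rewrite -big_mkcond /sliceA /=.
by rewrite (eq_bigl _ _ (fun i => eq_sym _ i)) big_pred1_eq.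
Qed.

Lemma row_degree i0 p m : rank_ideal 4 6 p -> m \in msupp p ->
  deg_on (sliceA (b:=3) (c:=4) i0) m = 2.
Proof.
move=> pI mp; have ge i := row_degree_ge2 i pI mp.
have := sum_deg_sliceA m; have /dhomogP/(_ m mp) /= := pI.1 => ->.
rewrite !big_ord_recl big_ord0; set i1 := lift _ _; set i2 := lift _ _.
have := ge ord0; have := ge i1; have := ge i2.
suff : i0 \in [:: ord0; i1; i2] by rewrite !inE => /or3P[]/eqP ->; lia.
by case: i0 => [[|[|[|//]]] ?].
Qed.

Lemma ev_scaleA_sqr i0 s x p : rank_ideal 4 6 p ->
  ev p (scaleA i0 s x) = s ^+ 2 * ev p x.
Proof.
by move=> pI; rewrite -ev_scaleA (@meval_scale _ _ _ _ _ _ 2) // => m; apply: row_degree.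
Qed.

End RowDegrees.

Lemma ord3P (i : 'I_3) : [\/ i = 0, i = 1 | i = 2%:R].
Proof.
by case: i => [[|[|[|//]]] ?]; [apply: Or31|apply: Or32|apply: Or33]; apply/val_inj.
Qed.

(** * Semi-invariance under GL(A) and GL(B) *)

Section RowSemiInvariance.
Variable F : numFieldType.
Local Notation tensor := ('I_3 -> 'I_3 -> 'I_4 -> F).
Implicit Types (p : {mpoly F[3 * 3 * 4]}) (x : tensor).

Definition transvection (i j : 'I_3) (s : F) : 'M[F]_3 := 1%:M + s *: delta_mx i j.

Lemma det_transvection i j s : i != j -> \det (transvection i j s) = 1.
Proof.
by rewrite det3 !mxE; move: i j => [[|[|[|//]]] ?] [[|[|[|//]]] ?] //= _; ring.
Qed.

Lemma actA_transvection i j s x i' j' k :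
  actA (transvection i j s) x i' j' k = x i' j' k + (i' == i)%:R * s * x j j' k.
Proof.
rewrite /actA (eq_bigr (fun l => (1%:M : 'M[F]_3) i' l * x l j' k
    + (i' == i)%:R * s * ((l == j)%:R * x l j' k))).
  rewrite big_split sum_delta -mulr_sumr; congr (_ + _ * _).
  by rewrite (bigD1 j) //= eqxx mul1r big1 ?addr0 // => l /negPf ->; rewrite mul0r.
by move=> l _; rewrite !mxE; case: (i' == i); case: (l == j) => /=; ring.
Qed.

Lemma ev_lsubA p g x : ev (lsub (g *t 1%:M *t 1%:M) p) x = ev p (actA g x).
Proof. by rewrite ev_lsub; apply: ev_ext => *; rewrite tact_A. Qed.

(** Let f(s) be the value after the transvection with parameter s. Conjugating by the scaling of
    slice [j] by t changes the parameter s into s t, and the scaling multiplies both sides by t^2,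
    so f(s t) = f(s). A polynomial that is constant off 0 is constant, and f(0) is the value at
    [x]. *)
Lemma ev_transvection i j s p x : i != j -> rank_ideal 4 6 p ->
  ev p (actA (transvection i j s) x) = ev p x.
Proof.
move=> ij pI; pose f s := ev p (actA (transvection i j s) x).
have fst s' t : t != 0 -> f (s' * t) = f s'.
  move=> t0; have := ev_scaleA_sqr j t x (rank_ideal_act (transvection i j s') 1%:M 1%:M pI).
  rewrite !ev_lsubA -/(f s') => e.
  apply: (mulfI (expf_neq0 2 t0)); rewrite -{}e /f -(ev_scaleA_sqr j t _ pI).
  apply: ev_ext => i' j' k; rewrite actA_transvection /scaleA actA_transvection /vscale.
  rewrite eqxx; case: (i' =P i) => [->|_]; rewrite ?(negPf ij) /= ?mulr0n ?mul0r ?addr0 //.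
  by rewrite !mulr1n; ring.
have [q qE] : exists q : {poly F}, forall s, f s = q.[s].
  have lf : linewise_poly (f : F^o -> F).
    apply: lp_ev => i' j' k; apply: (@lp_ext F F^o
      (fun s : F^o => x i' j' k + (i' == i)%:R * s * x j j' k)).
      by move=> s'; rewrite actA_transvection.
    by apply: lp_add; [apply: lp_const | apply: lp_lin => u v c; rewrite -[c *: v]/(c * v); ring].
  have [q qE] := lf 0 1; exists q => s'; rewrite -qE; congr f.
  by rewrite add0r -[s' *: 1]/(s' * 1) mulr1.
have qc : q = q.[1]%:P by apply: poly_eq_off0 => t t0; rewrite hornerC -!qE -(fst 1 t) // mul1r.
have -> : ev p (actA (transvection i j s) x) = f 0 by rewrite -[LHS]/(f s) !qE qc !hornerC.
rewrite /f.
apply: ev_ext => i' j' k; rewrite actA_transvection; ring.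
Qed.

Definition semi_invariantA p (g : 'M[F]_3) :=
  forall x, ev p (actA g x) = \det g ^+ 2 * ev p x.

Lemma semi_invariantA_mul p g h :
  semi_invariantA p g -> semi_invariantA p h -> semi_invariantA p (g *m h).
Proof.
move=> ig ih x; rewrite det_mulmx exprMn -mulrA -ih -ig.
by apply: ev_ext => *; rewrite actA_mul.
Qed.

Lemma semi_invariantA_transvection p i j s : i != j -> rank_ideal 4 6 p ->
  semi_invariantA p (transvection i j s).
Proof.
by move=> ij pI x; rewrite ev_transvection // det_transvection // expr1n mul1r.
Qed.

Lemma semi_invariantA_diag p (d : 'rV[F]_3) : rank_ideal 4 6 p ->
  semi_invariantA p (diag_mx d).
Proof.
move=> pI x; rewrite det_diag.
pose y s := foldr (fun i => scaleA i (d 0 i)) x s.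
have yE s : ev p (y s) = (\prod_(i <- s) d 0 i) ^+ 2 * ev p x.
  elim: s => [|i s IH]; first by rewrite big_nil expr1n mul1r.
  by rewrite /= ev_scaleA_sqr // IH big_cons exprMn mulrA.
rewrite -big_enum -yE; apply: ev_ext => i j k; rewrite /actA.
rewrite (bigD1 i) //= big1 ?addr0 => [|i' i'i]; last first.
  by rewrite mxE eq_sym (negPf i'i) mulr0n mul0r.
have e0 : enum 'I_0 = [::] by apply: size0nil; rewrite size_enum_ord.
rewrite mxE eqxx mulr1n enum_ordSl /= enum_ordSl /= enum_ordSl /= e0 /=.
rewrite /scaleA /vscale.
case: i => [[|[|[|//]]] h];  rewrite -!val_eqE /= ?mul1r.
by congr (d _ _ * x _ _ _); exact/val_inj.
by congr (d _ _ * x _ _ _); exact/val_inj.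
by congr (d _ _ * x _ _ _); exact/val_inj.
Qed.

(** Gaussian elimination without row exchanges; the hypotheses say that the first two leading minors
    do not vanish. The third pivot may be zero, in accordance with [semi_invariantA_diag], which
    covers every diagonal matrix. *)
Lemma ldu (g : 'M[F]_3) : g 0 0 != 0 -> g 0 0 * g 1 1 - g 0 1 * g 1 0 != 0 ->
  exists a b c e f h (d : 'rV[F]_3),
    g = transvection 1 0 a *m transvection 2%:R 0 b *m transvection 2%:R 1 c
        *m diag_mx d
        *m (transvection 1 2%:R h *m transvection 0 2%:R f *m transvection 0 1 e).
Proof.
move=> g00 g11; pose D := g 0 0 * g 1 1 - g 0 1 * g 1 0.
exists (g 1 0 / g 0 0), (g 2%:R 0 / g 0 0),
  ((g 2%:R 1 * g 0 0 - g 2%:R 0 * g 0 1) / D), (g 0 1 / g 0 0), (g 0 2%:R / g 0 0),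
  ((g 1 2%:R * g 0 0 - g 1 0 * g 0 2%:R) / D).
exists (\row_i match (i : nat) with 0 => g 0 0 | 1 => D / g 0 0
  | _ => g 2%:R 2%:R - g 2%:R 0 * g 0 2%:R / g 0 0
     - (g 2%:R 1 * g 0 0 - g 2%:R 0 * g 0 1) * (g 1 2%:R * g 0 0 - g 1 0 * g 0 2%:R) / D / g 0 0 end).
have dd (i j k l : 'I_3) : j != k -> (delta_mx i j : 'M[F]_3) *m delta_mx k l = 0.
  by move=> jk; rewrite mul_delta_mx_0.
set a := g 1 0 / _; set b := g 2%:R 0 / _; set c := _ / D; set e := g 0 1 / _.
set f := g 0 2%:R / _; set h := (g 1 2%:R * g 0 0 - g 1 0 * g 0 2%:R) / D.
(* The transvections are ordered so that every product of two of their elementary matrices vanishes;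
   hence the triangular factors have no mixed terms. *)
have -> : transvection 1 0 a *m transvection 2%:R 0 b *m transvection 2%:R 1 c
   = 1%:M + a *: delta_mx 1 0 + b *: delta_mx 2%:R 0 + c *: delta_mx 2%:R 1.
  rewrite /transvection !(mulmxDl, mulmxDr, mul1mx, mulmx1) -!scalemxAl -!scalemxAr.
  rewrite !dd // !(scaler0, addr0, mul0mx).
  by congr (_ + _); rewrite addrAC.
have -> : transvection 1 2%:R h *m transvection 0 2%:R f *m transvection 0 1 e
   = 1%:M + h *: delta_mx 1 2%:R + f *: delta_mx 0 2%:R + e *: delta_mx 0 1.
  rewrite /transvection !(mulmxDl, mulmxDr, mul1mx, mulmx1) -!scalemxAl -!scalemxAr.
  rewrite !dd // !(scaler0, addr0, mul0mx).
  by congr (_ + _); rewrite addrAC.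
rewrite -/D in g11; rewrite mul_mx_diag.
apply/matrixP=> i j; rewrite !mxE !big_ord_recl big_ord0 !mxE /=.
rewrite /D in g11 *.
by case: (ord3P i) => ->; case: (ord3P j) => -> /=; rewrite /a /b /c /e /f /h /D; field;
  rewrite ?g00 ?g11.
Qed.

Lemma ev_actA g p x : rank_ideal 4 6 p -> ev p (actA g x) = \det g ^+ 2 * ev p x.
Proof.
move=> pI.
apply: (@lp_dense_eq _ 'M[F]_3 (fun h => h 0 0 * (h 0 0 * h 1 1 - h 0 1 * h 1 0))
  (fun h => ev p (actA h x)) (fun h => \det h ^+ 2 * ev p x) 1%:M).
- by apply: lp_mul; [|apply: lp_sub; apply: lp_mul]; apply: lp_lin => *; rewrite !mxE.
- apply: lp_ev => i j k; apply: lp_sum => l; apply: lp_mul; last exact: lp_const.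
  by apply: lp_lin => *; rewrite !mxE.
- apply: lp_mul; last exact: lp_const; apply: lp_exp; apply: lp_det => i j.
  by apply: lp_lin => *; rewrite !mxE.
- by rewrite !mxE /= !mul1r mulr0 subr0 oner_eq0.
move=> {}g; rewrite mulf_eq0 negb_or => /andP[g0 g1].
have [a [b [c [e [f [h [d ->]]]]]]] := ldu g0 g1.
do 2! [apply: semi_invariantA_mul]; rewrite -?[_ *m _ *m _ *m _]mulmxA;
  by repeat (apply: semi_invariantA_mul);
     first [exact: semi_invariantA_diag | exact: semi_invariantA_transvection].
Qed.

Lemma ev_actB g p x : rank_ideal 4 6 p -> ev p (actB g x) = \det g ^+ 2 * ev p x.
Proof.
move=> pI; have sI := rank_ideal_swap pI.
have := ev_actA g (fun i j k => x j i k) sI; rewrite !ev_swap => <-.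
exact: ev_ext.
Qed.

End RowSemiInvariance.

(** * Degenerate tensors *)

Section DiagonalPencils.
Variable F : numClosedFieldType.

Lemma trig_diagonalizable n (T : 'M[F]_n.+1) : is_trig_mx T ->
  injective (fun i => T i i) ->
  exists P d, P \in unitmx /\ T = invmx P *m diag_mx d *m P.
Proof.
move=> Tt Ti; have : diagonalizable T.
  apply/diagonalizableP; exists [seq T i i | i <- enum 'I_n.+1].
    by rewrite map_inj_uniq ?enum_uniq.
  rewrite big_map big_enum -char_poly_trig //; exact: mxminpoly_dvd_char.
move=> [P uP /diagonalizable_forPex[d /(simmxLR uP)]]; exists P, d; split=> //.
by rewrite -conjVmx.
Qed.

Lemma schur_trig n (A : 'M[F]_n.+1) :
  exists P T, [/\ P \in unitmx, is_trig_mx T & A = invmx P *m T *m P].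
Proof.
have [P uP] := @Schur F n.+1 A isT; have {}uP := unitarymx_unit uP.
move=> tP; exists P, (P *m A *m invmx P); split=> //.
  by rewrite -mxred.conjumx //; exact: tP.
by rewrite !mulmxA mulVmx // mul1mx mulmxKV.
Qed.

(** Two successive density arguments. For invertible X1 the matrix X1^-1 X2 is triangular in some
    basis, and a triangular matrix with distinct diagonal entries is diagonalizable. Inside the
    triangular matrices this last condition is an explicit polynomial in the diagonal entries, and
    no discriminant is involved. *)
Lemma diag_pencil_dense (g : 'M[F]_3 * 'M[F]_3 -> F) : linewise_poly g ->
  (forall P Q d, P \in unitmx -> Q \in unitmx -> g (P *m Q, P *m diag_mx d *m Q) = 0) ->
  forall z, g z = 0.
Proof.
move=> lg g0; apply: (@lp_dense F _ (fun z => \det z.1) g (1%:M, 0)) => //.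
- by apply: lp_det => i j; apply: lp_lin => *; rewrite !mxE.
- by rewrite det1 oner_eq0.
move=> [X1 X2] /=; rewrite -unitfE -unitmxE => uX.
have [P [T [uP Tt XE]]] := schur_trig (invmx X1 *m X2).
(* [lo] is a linear projection onto the lower triangular matrices, so that [lp_dense] can be used on
   the space of all 3 x 3 matrices. *)
pose lo (B : 'M[F]_3) : 'M[F]_3 := \matrix_(i, j) if (j <= i)%N then B i j else 0.
have -> : X2 = X1 *m (invmx P *m lo T *m P).
  have -> : lo T = T.
    apply/matrixP=> i j; rewrite mxE; case: leqP => // ij.
    by have /is_trig_mxP -> := Tt.
  by rewrite -XE mulKVmx.
apply: (@lp_dense F 'M[F]_3 (fun B => (B 0 0 - B 1 1) * (B 0 0 - B 2%:R 2%:R)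
   * (B 1 1 - B 2%:R 2%:R)) (fun B => g (X1, X1 *m (invmx P *m lo B *m P)))
   (diag_mx (\row_i (i : nat)%:R))).
- by apply: lp_mul; [apply: lp_mul|]; apply: lp_sub; apply: lp_lin => *; rewrite !mxE.
- move=> x y.
  have [q qE] := lg (X1, X1 *m (invmx P *m lo x *m P)) (0, X1 *m (invmx P *m lo y *m P)).
  exists q => s; rewrite -qE; congr g; apply: injective_projections => /=.
    by rewrite scaler0 addr0.
  rewrite scalemxAr -mulmxDr scalemxAl -mulmxDl scalemxAr -mulmxDr.
  congr (_ *m (_ *m _ *m _)); apply/matrixP=> i j; rewrite !mxE.
  by case: ifP => //; rewrite mulr0 addr0.
- rewrite !mxE !eqxx !mulr1n /=.
  rewrite -[((1 %% 3 + 1 %% 3) %% 3)%N]/2%N [X in X != 0](_ : _ = - 2%:R); last by ring.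
  by rewrite oppr_eq0 pnatr_eq0.
move=> B; rewrite !mulf_eq0 !negb_or !subr_eq0 => /andP[/andP[b01 b02] b12].
have lT : is_trig_mx (lo B).
  by apply/is_trig_mxP => i j ij; rewrite mxE leqNgt ij.
have lI : injective (fun i => lo B i i).
  have bd i : lo B i i = B i i by rewrite mxE leqnn.
  move=> i j; rewrite !bd; case: (ord3P i) => ->; case: (ord3P j) => -> // /eqP;
    by rewrite ?(negPf b01) ?(negPf b02) ?(negPf b12) // eq_sym
               ?(negPf b01) ?(negPf b02) ?(negPf b12).
have [Q [d [uQ ->]]] := trig_diagonalizable lT lI.
rewrite -(g0 (X1 *m invmx P *m invmx Q) (Q *m P) d) ?unitmx_mul ?unitmx_inv ?uX ?uP ?uQ //.
congr (g (_, _)); rewrite !mulmxA //.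
by rewrite mulmxKV // mulmxKV.
Qed.

End DiagonalPencils.

(** * Torus-invariant bilinear forms on 3 x 3 matrices *)

Section TorusInvariantForms.
Variable F : numFieldType.
Implicit Types (Y Z : 'M[F]_3).

Definition torus (r : 'I_3) (s : F) : 'M[F]_3 := diag_mx (\row_i vscale r s i).

Lemma torus_conj_delta r s i j : s != 0 ->
  torus r s *m delta_mx i j *m torus r s^-1
    = (vscale r s i / vscale r s j) *: delta_mx i j.
Proof.
move=> s0; rewrite mul_diag_mx mul_mx_diag; apply/matrixP=> i' j'; rewrite !mxE.
case: (i' =P i) => [->|_]; case: (j' =P j) => [->|_] /=; rewrite ?mulr0 ?mul0r //.
by rewrite !mulr1 /vscale; case: (j == r); rewrite ?invr1.
Qed.

Lemma torus_unit r s : s != 0 -> torus r s *m torus r s^-1 = 1%:M.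
Proof.
move=> s0; rewrite mulmx_diag; apply/matrixP=> i j; rewrite !mxE /vscale.
by case: (i == r); rewrite ?mulr1 ?mulfV.
Qed.

Lemma torus_weights (i j k l : 'I_3) :
  (forall r, ((i == r) + (k == r) = (j == r) + (l == r))%N) ->
  (i = j /\ k = l) \/ (i = l /\ k = j).
Proof.
move=> e; have := e i; rewrite eqxx.
case: (j =P i) => [ji|_].
  subst j.
  by have := e k; rewrite eqxx => /eqP; rewrite eqn_add2l; case: (l =P k) => [->|//]; left.
case: (l =P i) => [li|//]; subst l.
by have := e k; rewrite eqxx addnC => /eqP; rewrite eqn_add2r; case: (j =P k) => [->|//]; right.
Qed.

Variable h : 'M[F]_3 -> 'M[F]_3 -> F.
Hypotheses (hDl : forall Y Y' Z, h (Y + Y') Z = h Y Z + h Y' Z)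
  (hDr : forall Y Z Z', h Y (Z + Z') = h Y Z + h Y Z')
  (hZl : forall s Y Z, s != 0 -> h (s *: Y) Z = s * h Y Z)
  (hZr : forall s Y Z, s != 0 -> h Y (s *: Z) = s * h Y Z)
  (ht : forall r Y Z, h (torus r 2%:R *m Y *m torus r 2%:R^-1)
                        (torus r 2%:R *m Z *m torus r 2%:R^-1) = h Y Z)
  (h_diag : forall i j, h (delta_mx i i) (delta_mx j j) = 0)
  (h_anti : forall i j, i != j -> h (delta_mx i j) (delta_mx j i) = 0).

(** The pair (E_ij, E_kl) has weight e_i - e_j + e_k - e_l under torus conjugation, and an invariant
    form can be nonzero only in weight 0, that is, on (E_ii, E_kk) or (E_ij, E_ji). The hypotheses
    [h_diag] and [h_anti] deal with these. *)
Lemma torus_form_delta i j k l : h (delta_mx i j) (delta_mx k l) = 0.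
Proof.
have two0 : 2%:R != 0 :> F by rewrite pnatr_eq0.
apply: contraTeq isT => h0.
suff : forall r, ((i == r) + (k == r) = (j == r) + (l == r))%N.
  move=> /torus_weights[[ij kl]|[il kj]]; subst; first by move: h0; rewrite h_diag eqxx.
  have [e|lj] := eqVneq l j; first by subst; move: h0; rewrite h_diag eqxx.
  by move: h0; rewrite h_anti // eqxx.
(* The scalar 2 has infinite order in characteristic 0, so it alone separates the weights. *)
move=> r; apply/eqP; rewrite -(eqn_exp2l _ _ (isT : 1 < 2)%N) -(eqr_nat F).
have vE (m : 'I_3) : vscale r 2%:R m = (2 ^ (m == r))%:R :> F.
  by rewrite /vscale; case: (m == r).
have v0 (m : 'I_3) : vscale r 2%:R m != 0 :> F by rewrite vE pnatr_eq0 -lt0n expn_gt0.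
have := ht r (delta_mx i j) (delta_mx k l).
rewrite !torus_conj_delta // hZl ?hZr ?mulf_neq0 ?invr_eq0 // mulrA => e.
have {}e : vscale r 2%:R i / vscale r 2%:R j * (vscale r 2%:R k / vscale r 2%:R l) = 1 :> F.
  by apply: (mulIf h0); rewrite e mul1r.
rewrite !expnD !natrM -!vE; apply/eqP.
transitivity ((vscale r 2%:R i / vscale r 2%:R j * (vscale r 2%:R k / vscale r 2%:R l))
  * (vscale r 2%:R j * vscale r 2%:R l) : F); last by rewrite e mul1r.
by field; rewrite !v0.
Qed.

Lemma torus_form_zero Y Z : h Y Z = 0.
Proof.
have h0l Z' : h 0 Z' = 0 by have := hDl 0 0 Z'; rewrite addr0 -[h 0 Z' in LHS]addr0 => /addrI.
have h0r Y' : h Y' 0 = 0 by have := hDr Y' 0 0; rewrite addr0 -[h Y' 0 in LHS]addr0 => /addrI.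
have sl (I : Type) (r : seq I) G Z' :
    (forall i, h (G i) Z' = 0) -> h (\sum_(i <- r) G i) Z' = 0.
  by move=> G0; elim: r => [|i r IH]; rewrite ?big_nil // big_cons hDl IH G0 addr0.
have sr (I : Type) (r : seq I) G Y' :
    (forall i, h Y' (G i) = 0) -> h Y' (\sum_(i <- r) G i) = 0.
  by move=> G0; elim: r => [|i r IH]; rewrite ?big_nil // big_cons hDr IH G0 addr0.
have zl s Y' Z' : h Y' Z' = 0 -> h (s *: Y') Z' = 0.
  by have [->|s0] := eqVneq s 0; [rewrite scale0r h0l | rewrite hZl // => ->; rewrite mulr0].
have zr s Y' Z' : h Y' Z' = 0 -> h Y' (s *: Z') = 0.
  by have [->|s0] := eqVneq s 0; [rewrite scale0r h0r | rewrite hZr // => ->; rewrite mulr0].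
rewrite (matrix_sum_delta Y) (matrix_sum_delta Z).
apply: (sl) => i; apply: (sl) => j; apply: zl.
by apply: (sr) => k; apply: (sr) => l; apply/zr/torus_form_delta.
Qed.

End TorusInvariantForms.

Section FourSlices.
Variable F : numFieldType.
Local Notation tensor := ('I_3 -> 'I_3 -> 'I_4 -> F).
Implicit Types (p : {mpoly F[3 * 3 * 4]}) (x : tensor) (A B Y Z : 'M[F]_3).

Definition of_slices (a b c : 'I_4) A B Y Z : tensor := fun i j k =>
  (if k == a then A else if k == b then B else if k == c then Y else Z) i j.

Definition semi_invariant p :=
  forall g h x, g \in unitmx -> h \in unitmx ->
    ev p (actA g (actB h x)) = \det g ^+ 2 * \det h ^+ 2 * ev p x.

Lemma ev_slices_mul p a b c P Q A B Y Z : semi_invariant p ->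
  P \in unitmx -> Q \in unitmx ->
  ev p (of_slices a b c (P *m A *m Q) (P *m B *m Q) (P *m Y *m Q) (P *m Z *m Q))
    = \det P ^+ 2 * \det Q ^+ 2 * ev p (of_slices a b c A B Y Z).
Proof.
move=> ps uP uQ; rewrite -(det_tr Q) -ps ?unitmx_tr //.
apply: ev_ext => i j k; rewrite /actA /actB /of_slices.
have mulE (X : 'M[F]_3) : (P *m X *m Q) i j = \sum_i' P i i' * (\sum_j' Q^T j j' * X i' j').
  rewrite mxE; under eq_bigr do rewrite mxE mulr_suml.
  rewrite exchange_big; apply: eq_bigr => i' _; rewrite mulr_sumr.
  by apply: eq_bigr => j' _; rewrite mxE; ring.
by case: (k == a); [|case: (k == b); [|case: (k == c)]].
Qed.

Lemma lp_of_slices (V : lmodType F) p a b c (A B Y Z : V -> 'M[F]_3) :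
  (forall i j, linewise_poly (fun v => A v i j)) ->
  (forall i j, linewise_poly (fun v => B v i j)) ->
  (forall i j, linewise_poly (fun v => Y v i j)) ->
  (forall i j, linewise_poly (fun v => Z v i j)) ->
  linewise_poly (fun v => ev p (of_slices a b c (A v) (B v) (Y v) (Z v))).
Proof.
move=> lA lB lY lZ; apply: lp_ev => i j k; rewrite /of_slices.
by case: (k == a); [|case: (k == b); [|case: (k == c)]].
Qed.

Lemma of_slicesE (a b c d : 'I_4) x i j k : uniq [:: a; b; c; d] ->
  of_slices a b c (\matrix_(i, j) x i j a) (\matrix_(i, j) x i j b)
    (\matrix_(i, j) x i j c) (\matrix_(i, j) x i j d) i j k = x i j k.
Proof.
move=> u; have : k \in [:: a; b; c; d].
  have [|_ ->] := uniq_min_size u (s2 := enum 'I_4) (fun y _ => mem_enum _ y).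
    by rewrite size_enum_ord.
  by rewrite mem_enum.
rewrite /of_slices !inE; do 3! [case: eqP => [-> _|_ /=]; first by rewrite mxE].
by move/eqP->; rewrite mxE.
Qed.

End FourSlices.

Section DegenerateTensors.
Variable F : numClosedFieldType.
Local Notation tensor := ('I_3 -> 'I_3 -> 'I_4 -> F).
Implicit Types (p : {mpoly F[3 * 3 * 4]}) (x : tensor) (A B Y Z : 'M[F]_3).

Lemma rank_ideal_semi_invariant p : rank_ideal 4 6 p -> semi_invariant p.
Proof. by move=> pI g h x _ _; rewrite ev_actA // ev_actB // mulrA. Qed.

Lemma diag_delta (i : 'I_3) : diag_mx (delta_mx 0 i) = delta_mx i i :> 'M[F]_3.
Proof.
apply/matrixP=> i' j'; rewrite !mxE eqxx /=; case: (i' =P j') => [->|n].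
  by rewrite andbb.
rewrite mulr0n; case: (i' =P i) => [e|//]; case: (j' =P i) => [e'|//].
by case: n; rewrite e e'.
Qed.

(** * Forms that do not involve one of the C-slices *)

Section NoSlice.
Variables (a b c d : 'I_4) (k : nat) (p : {mpoly F[3 * 3 * 4]}).
Hypotheses (abcd : uniq [:: a; b; c; d]) (k2 : (k <= 2)%N) (pI : rank_ideal 4 6 p).
Hypothesis pc : forall s x, ev p (scaleC c s x) = s ^+ k * ev p x.
Hypothesis pd : forall s x, ev p (scaleC d s x) = ev p x.

(** The diagonal matrices contribute three summands e_l (x) e_l (x) w_l, and [u *m v] in slice [c]
    contributes a fourth one. *)
Lemma ev_diag_rank1 (d1 d2 e : 'rV[F]_3) (u : 'cV[F]_3) (v : 'rV[F]_3) :
  ev p (of_slices a b c (diag_mx d1) (diag_mx d2) (diag_mx e + u *m v) 0) = 0.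
Proof.
rewrite -[RHS](pI.2
  (fun l i => if unlift ord_max l is Some l' then (i == l')%:R else u i 0)
  (fun l j => if unlift ord_max l is Some l' then (j == l')%:R else v 0 j)
  (fun l n => if unlift ord_max l is Some l' then
      (if n == a then d1 0 l' else if n == b then d2 0 l' else if n == c then e 0 l' else 0)
    else (n == c)%:R)).
have dE (f : 'rV[F]_3) i j : diag_mx f i j = \sum_l (i == l)%:R * (j == l)%:R * f 0 l.
  rewrite mxE (bigD1 i) //= eqxx mul1r big1 ?addr0 => [|l /negPf li].
    by rewrite (eq_sym j); case: eqP; rewrite ?mul1r ?mul0r.
  by rewrite eq_sym li !mul0r.
have [ab ac bc] : [/\ a != b, a != c & b != c].
  by split; apply/eqP=> f; move: abcd; rewrite f /= !inE eqxx ?orbT ?andbF.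
apply: ev_ext => i j n; rewrite /rank1s big_ord_recr /= unlift_none.
rewrite (eq_bigr (fun l : 'I_3 => (i == l)%:R * (j == l)%:R * (if n == a then d1 0 l
    else if n == b then d2 0 l else if n == c then e 0 l else 0))); last first.
  move=> l _; rewrite (_ : widen_ord _ l = lift ord_max l) ?liftK //.
  by apply/val_inj; rewrite /= /bump leqNgt ltn_ord.
rewrite /of_slices; case: (n =P a) => [->|_]; first by rewrite dE (negPf ac) mulr0 addr0.
case: (n =P b) => [->|_]; first by rewrite dE (negPf bc) mulr0 addr0.
case: (n =P c) => [_|_]; first by rewrite mxE dE mulr1 mxE big_ord1.
by rewrite mxE mulr0 addr0 big1 // => l _; rewrite mulr0.
Qed.

Lemma slice_scale A B Y s :
  ev p (of_slices a b c A B (s *: Y) 0) = s ^+ k * ev p (of_slices a b c A B Y 0).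
Proof.
have [ca cb] : c != a /\ c != b.
  by split; apply/eqP=> e; move: abcd; rewrite e /= !inE eqxx ?orbT ?andbF.
rewrite -pc; apply: ev_ext => i j n; rewrite /of_slices /scaleC /vscale.
case: (n =P a) => [->|_]; first by rewrite eq_sym (negPf ca) mul1r.
case: (n =P b) => [->|_]; first by rewrite eq_sym (negPf cb) mul1r.
by case: (n =P c) => _; rewrite ?mxE ?mul1r.
Qed.

(** As a function of [Y] the value vanishes on every diagonal matrix plus a matrix of rank one. In
    degree at most 1 this suffices, as the E_ij have rank one. In degree 2 the polar form is
    invariant under torus conjugation, because the other slices are diagonal; it vanishes at (E_ii,
    E_jj), and at (E_ij, E_ji) because E_ij + E_ji is again diagonal plus rank one. *)
Lemma ev_diag_zero (e : 'rV[F]_3) Y : ev p (of_slices a b c 1%:M (diag_mx e) Y 0) = 0.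
Proof.
pose f Y := ev p (of_slices a b c 1%:M (diag_mx e) Y 0).
have lf : linewise_poly f.
  by apply: lp_of_slices => i j; try exact: lp_const; apply: lp_lin => *; rewrite !mxE.
have fk s X : f (s *: X) = s ^+ k * f X by apply: slice_scale.
have fr (g : 'rV[F]_3) (u : 'cV[F]_3) (v : 'rV[F]_3) : f (diag_mx g + u *m v) = 0.
  by rewrite /f -diag_const_mx; apply: ev_diag_rank1.
have fd g : f (diag_mx g) = 0.
  by have := fr g 0 0; rewrite mul0mx addr0.
have fdelta i j : f (delta_mx i j) = 0.
  have := fr 0 (delta_mx i 0) (delta_mx 0 j).
  rewrite mul_delta_mx (_ : diag_mx 0 = 0) ?add0r //.
  by apply/matrixP=> i' j'; rewrite !mxE mul0rn.
have f0 : f 0 = 0 by rewrite -(scale0r (delta_mx 0 0)) fk fdelta mulr0.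
have [k0|k1|k1] := ltngtP k 1; rewrite -/(f Y).
- have {}k0 : k = 0 by case: (k) k0.
  by have := fk 0 Y; rewrite scale0r f0 k0 expr0 mul1r => <-.
- have {k1}ke : k = 2 by apply/eqP; rewrite eqn_leq k2 k1.
  have hf s X : s != 0 -> f (s *: X) = s ^+ 2 * f X by rewrite fk ke.
  suff /eqP : polar f Y Y = 0 by rewrite polar_diag // mulf_eq0 pnatr_eq0 => /eqP.
  have pD := polarDr lf hf; have pZ := polarZr lf hf.
  apply: (@torus_form_zero F (polar f)) => //.
  - by move=> X X' Z; rewrite polarC pD !(polarC _ Z).
  - by move=> s X Z s0; rewrite polarC pZ // (polarC _ Z).
  - have two0 : 2%:R != 0 :> F by rewrite pnatr_eq0.
    have ft r X : f (torus r 2%:R *m X *m torus r 2%:R^-1) = f X.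
      have tt := torus_unit r two0; have [u1 u2] := mulmx1_unit tt.
      have := ev_slices_mul a b c 1%:M (diag_mx e) X 0 (rank_ideal_semi_invariant pI) u1 u2.
      rewrite mulmx1 tt mulmx0 mul0mx -exprMn -det_mulmx tt det1 expr1n mul1r => eX.
      rewrite /f -eX {eX}.
      have cT : torus r 2%:R *m diag_mx e = diag_mx e *m torus r 2%:R by apply: diag_mxC.
      by rewrite cT -(mulmxA (diag_mx e)) tt mulmx1.
    by move=> r X Z; rewrite /polar !ft -(ft r (X + Z)) mulmxDr mulmxDl.
  - by move=> i j; rewrite /polar !fdelta !subr0 -!diag_delta -raddfD fd.
  - move=> i j ij; rewrite /polar !fdelta !subr0.
    (* E_ij + E_ji = (e_i + e_j)(e_i + e_j)^T - E_ii - E_jj. *)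
    rewrite -[RHS](fr (- (delta_mx 0 i + delta_mx 0 j)) (delta_mx i 0 + delta_mx j 0)
       (delta_mx 0 i + delta_mx 0 j)); congr f.
    rewrite raddfN raddfD /= !diag_delta mulmxDl !mulmxDr !mul_delta_mx.
    by apply/matrixP=> i' j'; rewrite !mxE; ring.
rewrite (matrix_sum_delta Y).
apply: lp_homog1_zero => //; first by move=> s X _; rewrite fk k1.
move=> i; apply: lp_homog1_zero => //; first by move=> s X _; rewrite fk k1.
by move=> j; rewrite fk fdelta mulr0.
Qed.

Lemma of_slices_no_last A B Y Z :
  ev p (of_slices a b c A B Y Z) = ev p (of_slices a b c A B Y 0).
Proof.
have [da db dc] : [/\ a != d, b != d & c != d].
  by split; apply/eqP=> f; move: abcd; rewrite f /= !inE eqxx ?orbT ?andbF.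
rewrite -(pd 0) -[RHS](pd 0); apply: ev_ext => i j n; rewrite /scaleC /vscale /of_slices.
case: (n =P d) => [->|nd]; first by rewrite !mul0r.
congr (_ * _); case: (n =P a) => // na; case: (n =P b) => // nb; case: (n =P c) => // nc.
have : n \in [:: a; b; c; d].
  have [|_ ->] := uniq_min_size abcd (s2 := enum 'I_4) (fun y _ => mem_enum _ y).
    by rewrite size_enum_ord.
  by rewrite mem_enum.
by rewrite !inE => /or4P[]/eqP.
Qed.

Lemma low_slice_degree : p = 0.
Proof.
apply: ev_zero => x; rewrite -(ev_ext p (fun i j k => of_slicesE x i j k abcd)).
rewrite of_slices_no_last; set X1 := (X in of_slices _ _ _ X); set X2 := (X in of_slices _ _ _ _ X).
set Y := (X in of_slices _ _ _ _ _ X).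
apply: (@diag_pencil_dense F (fun z => ev p (of_slices a b c z.1 z.2 Y 0)) _ _ (X1, X2)).
  by apply: lp_of_slices => i j; try exact: lp_const; apply: lp_lin => *; rewrite !mxE.
move=> P Q e uP uQ /=.
have := ev_slices_mul a b c 1%:M (diag_mx e) (invmx P *m Y *m invmx Q) 0
  (rank_ideal_semi_invariant pI) uP uQ.
by rewrite ev_diag_zero !mulr0 mulmx1 !mulmxA mulmxV // mul1mx mulmxKV // mulmx0 mul0mx.
Qed.

End NoSlice.

Lemma sum_deg_sliceC (m : 'X_{1..(3 * 3 * 4)}) :
  (\sum_(k0 < 4) deg_on (sliceC (a:=3) (b:=3) k0) m = mdeg m)%N.
Proof.
rewrite mdegE (eq_bigr (fun k0 : 'I_4 => \sum_l if sliceC k0 l then m l else 0))%N;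
  last by move=> i _; rewrite /deg_on big_mkcond.
rewrite exchange_big; apply: eq_bigr => l _; rewrite -big_mkcond /sliceC /=.
by rewrite (eq_bigl _ _ (fun i => eq_sym _ i)) big_pred1_eq.
Qed.

Lemma other_slots (d : 'I_4) : exists a b c, uniq [:: a; b; c; d].
Proof.
by case: d => [[|[|[|[|//]]]] ?]; [exists 1, 2%:R, 3%:R | exists 0, 2%:R, 3%:R
  | exists 0, 1, 3%:R | exists 0, 1, 2%:R].
Qed.

Lemma uniq_slots_sum (G : 'I_4 -> nat) a b c d : uniq [:: a; b; c; d] ->
  (\sum_k G k = G a + G b + G c + G d)%N.
Proof.
move=> u; transitivity (\sum_(k <- [:: a; b; c; d]) G k)%N.
  rewrite [RHS]big_uniq //; apply: eq_bigl => k; symmetry.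
  have [|_ ->] := uniq_min_size u (s2 := enum 'I_4) (fun y _ => mem_enum _ y).
    by rewrite size_enum_ord.
  by rewrite mem_enum.
by rewrite !big_cons big_nil; lia.
Qed.

(** Without slice [d], the degrees of a monomial in the other three slices add up to 6, so they
    cannot all exceed 2; but [low_slice_degree] excludes a degree of at most 2. *)
Lemma rank_ideal_no_slice d p : rank_ideal 4 6 p ->
  (forall s x, ev p (scaleC d s x) = ev p x) -> p = 0.
Proof.
move=> pI pd; apply/eqP; apply: contraTT isT => p0.
have [m mp] : exists m, m \in msupp p.
  have : msupp p != [::] by rewrite msupp_eq0.
  by case: (msupp p) => [|m s] // _; exists m; rewrite mem_head.
have dd m' : m' \in msupp p -> deg_on (sliceC (a:=3) (b:=3) d) m' = 0%N.
  apply: (deg_on_scaling (p := p) (k := 0)) => // s x s0; rewrite expr0 mul1r.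
  rewrite [RHS]ev_meval -(pd s) -ev_scaleC; apply: meval_eq => l.
  by rewrite /scale_on; case: ifP => _; have [i [j [k ->]]] := tidxP l; rewrite flatE.
have [a [b [c u]]] := other_slots d.
have := sum_deg_sliceC m; have /dhomogP/(_ m mp) /= := pI.1 => ->.
rewrite (uniq_slots_sum _ u) (dd m mp) addn0.
suff low a' b' c' : uniq [:: a'; b'; c'; d] ->
    (2 < deg_on (sliceC (a:=3) (b:=3) c') m)%N.
  have ca : uniq [:: b; c; a; d].
    by move: u; rewrite /= !inE !negb_or (eq_sym c a) (eq_sym b a) => /and4P[/and3P[-> -> ->]]
      /andP[-> ->] -> _.
  have cb : uniq [:: a; c; b; d].
    by move: u; rewrite /= !inE !negb_or (eq_sym c b) => /and4P[/and3P[-> -> ->]]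
      /andP[-> ->] -> _.
  by have := low _ _ _ u; have := low _ _ _ ca; have := low _ _ _ cb; lia.
move=> u'; rewrite ltnNge; apply/negP=> le2.
set S := sliceC c' in le2; set k := deg_on S m in le2.
have : (comp_on S k p)@_m = p@_m by rewrite mcoeff_comp_on eqxx.
suff -> : comp_on S k p = 0 by move/eqP; rewrite mcoeff0 eq_sym mcoeff_eq0 mp.
apply: (low_slice_degree u' le2).
- exact: rank_ideal_compC.
- by move=> s x; rewrite -ev_scaleC (@meval_scale _ _ _ _ _ _ k) // => m'; apply: comp_on_deg.
move=> s x; rewrite -ev_scaleC (@meval_scale _ _ _ _ _ _ 0) ?mul1r // => m'.
rewrite mcoeff_msupp mcoeff_comp_on; case: ifP; last by rewrite eqxx.
by rewrite -mcoeff_msupp => _ /dd.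
Qed.

(** The relation expresses slice [k0] of [x] by the others. Substituting this expression by means of
    [g] gives a form that agrees with [p] at [x] and does not involve slice [k0], hence is zero. Its
    component of degree 0 in that slice is taken so that this independence holds by construction. *)
Lemma rank_ideal_degenerate p x (w : 'I_4 -> F) k0 : rank_ideal 4 6 p -> w k0 != 0 ->
  (forall i j, \sum_k w k * x i j k = 0) -> ev p x = 0.
Proof.
move=> pI wk xw.
pose g : 'M[F]_4 := \matrix_(k, k') if k == k0 then - w k' / w k0 * (k' != k0)%:R
                                     else (k == k')%:R.
pose q := comp_on (sliceC k0) 0 (lsub (1%:M *t 1%:M *t g) p).
have q0 : q = 0.
  apply: (@rank_ideal_no_slice k0); first by apply/rank_ideal_compC/rank_ideal_act.
  move=> s y; rewrite -ev_scaleC (@meval_scale _ _ _ _ _ _ 0) ?mul1r // => m.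
  exact: comp_on_deg.
have : ev q x = 0 by rewrite q0 /ev meval0.
rewrite /q /ev (@comp_on_coef _ _ _ _ _ (ev p x)%:P) ?coefC // => s s0.
rewrite hornerC ev_scaleC ev_lsub; apply: ev_ext => i j k.
rewrite tact_C /actC /scaleC; case: (k =P k0) => [->|/eqP kk].
  have := xw i j; rewrite (bigD1 k0) //= => /eqP; rewrite addr_eq0 => /eqP e.
  apply: (mulfI wk); rewrite e (bigD1 k0) //= !mxE !eqxx mulr0 mul0r add0r mulr_sumr -sumrN.
  apply: eq_bigr => k' kk'; rewrite !mxE eqxx kk' /vscale (negPf kk') mul1r mulr1.
  by field.
rewrite (bigD1 k) //= mxE (negPf kk) eqxx /vscale (negPf kk) !mul1r big1 ?addr0 // => k' kk'.
by rewrite mxE (negPf kk) eq_sym (negPf kk') mul0r.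
Qed.

End DegenerateTensors.

(** * Admissible forms *)

Section Admissible.
Variable F : numClosedFieldType.
Local Notation tensor := ('I_3 -> 'I_3 -> 'I_4 -> F).
Implicit Types (p : {mpoly F[3 * 3 * 4]}) (x : tensor) (A B Y Z : 'M[F]_3).

(** The tensors concerned are those that are not concise in C: they lie in A (x) B (x) C' for a
    hyperplane C' of C. *)
Definition concise p := forall x (w : 'I_4 -> F) k0, w k0 != 0 ->
  (forall i j, \sum_k w k * x i j k = 0) -> ev p x = 0.

Definition admissible p := [/\ p \is 6.-homog, semi_invariant p & concise p].

Lemma rank_ideal_admissible p : rank_ideal 4 6 p -> admissible p.
Proof.
move=> pI; split; [exact: pI.1 | exact: rank_ideal_semi_invariant |].
by move=> x w k0; apply: rank_ideal_degenerate.
Qed.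

(** * Admissible forms of degree 1 in two C-slices *)

Section FixedDegrees.
Variables (a b c d : 'I_4) (m n : nat) (p : {mpoly F[3 * 3 * 4]}).
Hypotheses (abcd : uniq [:: a; b; c; d]) (pad : admissible p).
Hypothesis pa : forall s x, ev p (scaleC a s x) = s ^+ m * ev p x.
Hypothesis pb : forall s x, ev p (scaleC b s x) = s ^+ n * ev p x.
Hypothesis pc : forall s x, ev p (scaleC c s x) = s * ev p x.
Hypothesis pd : forall s x, ev p (scaleC d s x) = s * ev p x.

Local Notation ev4 A B Y Z := (ev p (of_slices a b c A B Y Z)).

Lemma slotE : ((a == b) = false) * ((b == a) = false) * ((a == c) = false)
  * ((c == a) = false) * ((a == d) = false) * ((d == a) = false) * ((b == c) = false)
  * ((c == b) = false) * ((b == d) = false) * ((d == b) = false) * ((c == d) = false)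
  * ((d == c) = false).
Proof. by do !split; apply/eqP=> f; move: abcd; rewrite f /= !inE eqxx ?orbT ?andbF. Qed.

Lemma slotP k : [\/ k = a, k = b, k = c | k = d].
Proof.
have : k \in [:: a; b; c; d].
  have [|_ ->] := uniq_min_size abcd (s2 := enum 'I_4) (fun y _ => mem_enum _ y).
    by rewrite size_enum_ord.
  by rewrite mem_enum.
by rewrite !inE => /or4P[]/eqP->; [apply: Or41|apply: Or42|apply: Or43|apply: Or44].
Qed.

Lemma ev4_scale_a s A B Y Z : ev4 (s *: A) B Y Z = s ^+ m * ev4 A B Y Z.
Proof.
rewrite -pa; apply: ev_ext => i j k; rewrite /of_slices /scaleC /vscale.
by case: (slotP k) => ->; rewrite !(slotE, eqxx, mul1r) ?mxE.
Qed.

Lemma ev4_scale_b s A B Y Z : ev4 A (s *: B) Y Z = s ^+ n * ev4 A B Y Z.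
Proof.
rewrite -pb; apply: ev_ext => i j k; rewrite /of_slices /scaleC /vscale.
by case: (slotP k) => ->; rewrite !(slotE, eqxx, mul1r) ?mxE.
Qed.

Lemma ev4_scale_c s A B Y Z : ev4 A B (s *: Y) Z = s * ev4 A B Y Z.
Proof.
rewrite -pc; apply: ev_ext => i j k; rewrite /of_slices /scaleC /vscale.
by case: (slotP k) => ->; rewrite !(slotE, eqxx, mul1r) ?mxE.
Qed.

Lemma ev4_scale_d s A B Y Z : ev4 A B Y (s *: Z) = s * ev4 A B Y Z.
Proof.
rewrite -pd; apply: ev_ext => i j k; rewrite /of_slices /scaleC /vscale.
by case: (slotP k) => ->; rewrite !(slotE, eqxx, mul1r) ?mxE.
Qed.

Lemma ev4_Dc A B Y Y' Z : ev4 A B (Y + Y') Z = ev4 A B Y Z + ev4 A B Y' Z.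
Proof.
apply: (@lp_homog1D F _ (fun Y => ev4 A B Y Z)) => [|s X _]; last exact: ev4_scale_c.
by apply: lp_of_slices => i j; try exact: lp_const; apply: lp_lin => *; rewrite !mxE.
Qed.

Lemma ev4_Dd A B Y Z Z' : ev4 A B Y (Z + Z') = ev4 A B Y Z + ev4 A B Y Z'.
Proof.
apply: (@lp_homog1D F _ (fun Z => ev4 A B Y Z)) => [|s X _]; last exact: ev4_scale_d.
by apply: lp_of_slices => i j; try exact: lp_const; apply: lp_lin => *; rewrite !mxE.
Qed.

Lemma ev4_dependent A B Y Z (w : 'I_4 -> F) k0 : w k0 != 0 ->
  w a *: A + w b *: B + w c *: Y + w d *: Z = 0 -> ev4 A B Y Z = 0.
Proof.
move=> w0 e; have [_ _ pcon] := pad; apply: (pcon _ w k0) => // i j.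
have /matrixP/(_ i j) := e; rewrite !mxE => eij; rewrite -[RHS]eij.
transitivity (\sum_(k <- [:: a; b; c; d]) w k * of_slices a b c A B Y Z i j k); last first.
  by rewrite !big_cons big_nil /of_slices !(slotE, eqxx) addr0 !addrA.
rewrite [RHS]big_uniq //; apply: eq_bigl => k; symmetry.
by rewrite !inE; case: (slotP k) => ->; rewrite eqxx ?orbT.
Qed.

Lemma ev4_alt A B Y : ev4 A B Y Y = 0.
Proof.
apply: (@ev4_dependent _ _ _ _ (fun k => (k == c)%:R - (k == d)%:R) c).
  by rewrite !(slotE, eqxx) subr0 oner_eq0.
by rewrite !(slotE, eqxx) /= !(mulr0n, mulr1n, subr0, sub0r, scale0r, add0r) scale1r scaleN1r subrr.
Qed.

Lemma ev4_anti A B Y Z : ev4 A B Y Z = - ev4 A B Z Y.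
Proof.
have := ev4_alt A B (Y + Z); rewrite ev4_Dc !ev4_Dd !ev4_alt add0r addr0.
by move/eqP; rewrite addr_eq0 => /eqP.
Qed.

(* Four diagonal matrices of size 3 are linearly dependent. *)
Lemma ev4_diag (d1 d2 e f : 'rV[F]_3) :
  ev4 (diag_mx d1) (diag_mx d2) (diag_mx e) (diag_mx f) = 0.
Proof.
pose M : 'M[F]_(4, 3) := \matrix_(k, i)
  (if k == a then d1 else if k == b then d2 else if k == c then e else f) 0 i.
have : kermx M != 0.
  rewrite kermx_eq0 /row_free; apply/negP=> /eqP r4.
  by have := rank_leq_col M; rewrite r4.
case/rowV0Pn=> v /sub_kermxP vM /rV0Pn[k0 vk0].
apply: (@ev4_dependent _ _ _ _ (fun k => v 0 k) k0) => //.
rewrite -!linearZ -!linearD /=; apply/matrixP=> i j; rewrite !mxE.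
have /rowP/(_ i) := vM; rewrite !mxE => vMi; rewrite [X in X *+ _](_ : _ = 0) ?mul0rn //.
rewrite -[RHS]vMi.
transitivity (\sum_(k <- [:: a; b; c; d]) v 0 k * M k i).
  by rewrite !big_cons big_nil !mxE !(slotE, eqxx) addr0 !addrA.
rewrite [LHS]big_uniq //; apply: eq_bigl => k.
by rewrite !inE; case: (slotP k) => ->; rewrite eqxx ?orbT.
Qed.

(** A pair of diagonal matrices is stored by diagonal position: [al], [be] and [ga] hold the first,
    second and third entries of both matrices, and [l] selects the matrix. In this form the value
    becomes alternating in [al] and [be]. *)
Definition diag2 (al be ga : 'rV[F]_2) (l : 'I_2) : 'M[F]_3 :=
  diag_mx (\row_i match (i : nat) with 0 => al 0 l | 1 => be 0 l | _ => ga 0 l end).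

(** With the first two slices diagonal, torus weights and [ev4_diag] leave only the values at (E_ij,
    E_ji); conjugation by permutation matrices reduces them to (E_01, E_10). *)
Definition slice_coef al be ga : F :=
  ev4 (diag2 al be ga 0) (diag2 al be ga 1) (delta_mx 0 1) (delta_mx 1 0).

Lemma ev4_perm (s : 'S_3) A B Y Z :
  ev4 (\matrix_(i, j) A (s i) (s j)) (\matrix_(i, j) B (s i) (s j))
      (\matrix_(i, j) Y (s i) (s j)) (\matrix_(i, j) Z (s i) (s j)) = ev4 A B Y Z.
Proof.
have mE (X : 'M[F]_3) : \matrix_(i, j) X (s i) (s j) = perm_mx s *m X *m (perm_mx s)^T.
  rewrite -row_permE tr_perm_mx -col_permE; apply/matrixP=> i j.
  by rewrite !mxE.
have [_ ps _] := pad.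
rewrite !mE ev_slices_mul ?unitmx_tr ?unitmx_perm // det_tr det_perm !sqrr_sign.
by rewrite !mul1r.
Qed.

(** Conjugation by the transposition of 0 and 1 preserves values. It exchanges [al] with [be] and
    E_01 with E_10, and the form is antisymmetric in its last two slices. *)
Lemma slice_coef_swap al be ga : slice_coef be al ga = - slice_coef al be ga.
Proof.
rewrite /slice_coef -ev4_anti -(ev4_perm (tperm 0 1)).
have t2 : tperm 0 1 2%:R = 2%:R :> 'I_3 by rewrite tpermD.
congr (ev p (of_slices a b c _ _ _ _)); apply/matrixP=> i j; rewrite !mxE ?(inj_eq perm_inj);
 by case: (ord3P i) => ->; case: (ord3P j) => ->; rewrite ?tpermL ?tpermR ?t2.
Qed.

(** Multiplying rows by diag(s, 1, 1) multiplies the value by s^2. It scales [al] by s, but also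
    E_01, and linearity in slice [c] takes one factor s away. *)
Lemma slice_coefZ s al be ga : s != 0 ->
  slice_coef (s *: al) be ga = s * slice_coef al be ga.
Proof.
move=> s0; have [_ ps _] := pad.
have [u _] := mulmx1_unit (torus_unit 0 s0).
have := ev_slices_mul a b c (diag2 al be ga 0) (diag2 al be ga 1) (delta_mx 0 1)
  (delta_mx 1 0) ps u (unitmx1 _ _).
rewrite !mulmx1 det1 expr1n mulr1 det_diag !big_ord_recl big_ord0 !mxE /= !mulr1.
have tE (v : 'rV[F]_3) : torus 0 s *m diag_mx v = diag_mx (\row_i (vscale 0 s i * v 0 i)).
  by rewrite mulmx_diag; congr diag_mx; apply/rowP=> i; rewrite !mxE.
have dE i j : torus 0 s *m delta_mx i j = vscale 0 s i *: delta_mx i j.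
  rewrite mul_diag_mx; apply/matrixP=> i' j'; rewrite !mxE.
  by case: (i' =P i) => [->|_]; rewrite ?mulr0.
rewrite !tE !dE /vscale /= scale1r ev4_scale_c => e.
apply: (mulfI s0); rewrite mulrA -expr2 -e /slice_coef; congr (s * ev4 _ _ _ _);
  congr diag_mx; apply/rowP=> i; rewrite !mxE;
  by case: (ord3P i) => -> /=; rewrite ?mul1r.
Qed.

Lemma lp_diag2 (V : lmodType F) (al be ga : V -> 'rV[F]_2) l i j :
  linewise_poly (fun v => al v 0 l) -> linewise_poly (fun v => be v 0 l) ->
  linewise_poly (fun v => ga v 0 l) ->
  linewise_poly (fun v => diag2 (al v) (be v) (ga v) l i j).
Proof.
move=> la lb lg; apply: (@lp_ext _ _ (fun v => (i == j)%:R *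
  match (i : nat) with 0 => al v 0 l | 1 => be v 0 l | _ => ga v 0 l end)).
  by move=> v; rewrite !mxE mulr_natl.
by apply: lp_scale; case: (i : nat) => [|[|]].
Qed.

Lemma lp_slice_coef1 be ga : linewise_poly (fun al => slice_coef al be ga).
Proof.
apply: lp_of_slices => i j; try exact: lp_const;
  by apply: lp_diag2; try exact: lp_const; apply: lp_lin => *; rewrite !mxE.
Qed.

Lemma lp_slice_coef3 al be : linewise_poly (slice_coef al be).
Proof.
apply: lp_of_slices => i j; try exact: lp_const;
  by apply: lp_diag2; try exact: lp_const; apply: lp_lin => *; rewrite !mxE.
Qed.

Lemma slice_coefD al al' be ga :
  slice_coef (al + al') be ga = slice_coef al be ga + slice_coef al' be ga.
Proof.
apply: (lp_homog1D (lp_slice_coef1 be ga)) => s x; exact: slice_coefZ.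
Qed.

Lemma slice_coefZ' s al be ga : slice_coef (s *: al) be ga = s * slice_coef al be ga.
Proof.
have [->|] := eqVneq s 0; last exact: slice_coefZ.
rewrite scale0r mul0r; have := slice_coefD 0 0 be ga.
by rewrite addr0 -[X in X = _]addr0 => /addrI.
Qed.

Lemma slice_coef_alt al ga : slice_coef al al ga = 0.
Proof.
have /eqP := slice_coef_swap al al ga; rewrite -addr_eq0 -mulr2n mulrn_eq0 /=.
by move/eqP.
Qed.

Local Notation e0 := (delta_mx 0 0 : 'rV[F]_2).
Local Notation e1 := (delta_mx 0 1 : 'rV[F]_2).

Lemma slice_coef_basis al be ga : slice_coef al be ga
  = (al 0 0 * be 0 1 - al 0 1 * be 0 0) * slice_coef e0 e1 ga.
Proof.
have E (v : 'rV[F]_2) : v = v 0 0 *: e0 + v 0 1 *: e1.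
  rewrite {1}(row_sum_delta v) !big_ord_recl big_ord0 addr0.
  by rewrite (_ : lift ord0 ord0 = 1) //; apply/val_inj.
have cl (v w : 'rV[F]_2) :
    slice_coef v w ga = v 0 0 * slice_coef e0 w ga + v 0 1 * slice_coef e1 w ga.
  by rewrite {1}(E v) slice_coefD !slice_coefZ'.
rewrite cl ![slice_coef _ be ga]slice_coef_swap !(cl be) !slice_coef_alt.
by rewrite (slice_coef_swap e0 e1); ring.
Qed.

Hypothesis p0 : ev4 (diag2 e0 e1 (const_mx 1) 0) (diag2 e0 e1 (const_mx 1) 1)
                    (delta_mx 0 1) (delta_mx 1 0) = 0.

(** Scaling slice [a] by s and slice [b] by t turns (e0, e1, (1, 1)) into (s e0, t e1, (s, t)), so
    the value in [p0] determines the one at every ga = (s, t) with nonzero coordinates; density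
    gives the others. *)
Lemma slice_coef_zero al be ga : slice_coef al be ga = 0.
Proof.
rewrite slice_coef_basis.
suff -> : slice_coef e0 e1 ga = 0 by rewrite mulr0.
apply: (@lp_dense F 'rV[F]_2 (fun ga => ga 0 0 * ga 0 1) (slice_coef e0 e1) (const_mx 1)).
- by apply: lp_mul; apply: lp_lin => *; rewrite !mxE.
- exact: lp_slice_coef3.
- by rewrite !mxE mulr1 oner_eq0.
move=> {}ga ga0; pose s := ga 0 0; pose t := ga 0 1.
have [s0 t0] : s != 0 /\ t != 0 by move: ga0; rewrite mulf_eq0 negb_or => /andP.
have : slice_coef (s *: e0) (t *: e1) ga = s ^+ m * (t ^+ n * slice_coef e0 e1 (const_mx 1)).
  rewrite /slice_coef -ev4_scale_b -ev4_scale_a; congr (ev p (of_slices a b c _ _ _ _));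
    rewrite -linearZ /=; congr diag_mx; apply/rowP=> i; rewrite !mxE;
    by case: (ord3P i) => -> /=; rewrite ?mxE /= ?mulr1 ?mulr0.
rewrite /slice_coef p0 !mulr0 -/(slice_coef _ _ _) slice_coef_basis !mxE /=.
rewrite !(mulr1, mulr0, subr0) => /eqP; rewrite !mulf_eq0 (negPf s0) (negPf t0) /=.
by move/eqP.
Qed.

Lemma ev4_offdiag (d1 d2 : 'rV[F]_3) i j : i != j ->
  ev4 (diag_mx d1) (diag_mx d2) (delta_mx i j) (delta_mx j i) = 0.
Proof.
move=> ij; pose t := tperm 0 i; pose u := tperm (t 1) j; pose s : 'S_3 := (t * u)%g.
have t0 : t 0 = i by rewrite tpermL.
have t1 : t 1 != i by rewrite -t0 (inj_eq perm_inj).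
have ji : j != i by rewrite eq_sym.
have s0 : s 0 = i by rewrite permM t0 tpermD.
have s1 : s 1 = j by rewrite permM tpermL.
rewrite -(ev4_perm s).
pose v l := \row_(k < 2) (if (k : nat) == 0%N then d1 0 (s l) else d2 0 (s l)) : 'rV[F]_2.
rewrite -[RHS](slice_coef_zero (v 0) (v 1) (v 2%:R)) /slice_coef.
congr (ev p (of_slices a b c _ _ _ _)); apply/matrixP=> k l; rewrite !mxE ?(inj_eq perm_inj) //.
- by case: (ord3P k) => ->; rewrite ?mxE.
- by case: (ord3P k) => ->; rewrite ?mxE.
- by rewrite -s0 -s1 !(inj_eq perm_inj).
- by rewrite -s0 -s1 !(inj_eq perm_inj).
Qed.

Lemma ev4_diag_pencil (d1 d2 : 'rV[F]_3) Y Z : ev4 (diag_mx d1) (diag_mx d2) Y Z = 0.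
Proof.
apply: (@torus_form_zero F (fun Y Z => ev4 (diag_mx d1) (diag_mx d2) Y Z)).
- by move=> *; apply: ev4_Dc.
- by move=> *; apply: ev4_Dd.
- by move=> *; apply: ev4_scale_c.
- by move=> *; apply: ev4_scale_d.
- move=> r {}Y {}Z; have two0 : 2%:R != 0 :> F by rewrite pnatr_eq0.
  have tt := torus_unit r two0; have [u1 u2] := mulmx1_unit tt.
  have [_ ps _] := pad.
  have := ev_slices_mul a b c (diag_mx d1) (diag_mx d2) Y Z ps u1 u2.
  have cT (v : 'rV[F]_3) : torus r 2%:R *m diag_mx v *m torus r 2%:R^-1 = diag_mx v.
    have -> : torus r 2%:R *m diag_mx v = diag_mx v *m torus r 2%:R by apply: diag_mxC.
    by rewrite -mulmxA tt mulmx1.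
  by rewrite -exprMn -det_mulmx tt det1 expr1n mul1r !cT.
- by move=> i j; rewrite -!diag_delta ev4_diag.
- exact: ev4_offdiag.
Qed.

(** Applied to a combination of two forms, this shows that a form with these slice degrees is
    determined by its value at the tensor with slices diag(1, 0, 1), diag(0, 1, 1), E_01, E_10. *)
Lemma admissible_slice_zero : p = 0.
Proof.
apply: ev_zero => x; rewrite -(ev_ext p (fun i j k => of_slicesE x i j k abcd)).
set X1 := (X in of_slices _ _ _ X); set X2 := (X in of_slices _ _ _ _ X).
set Y := (X in of_slices _ _ _ _ _ X); set Z := (X in of_slices _ _ _ _ _ _ X).
apply: (@diag_pencil_dense F (fun z => ev p (of_slices a b c z.1 z.2 Y Z)) _ _ (X1, X2)).
  by apply: lp_of_slices => i j; try exact: lp_const; apply: lp_lin => *; rewrite !mxE.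
move=> P Q e uP uQ /=; have [_ ps _] := pad.
have := ev_slices_mul a b c 1%:M (diag_mx e) (invmx P *m Y *m invmx Q)
  (invmx P *m Z *m invmx Q) ps uP uQ.
rewrite -diag_const_mx ev4_diag_pencil diag_const_mx !mulr0 mulmx1.
by rewrite !mulmxA mulmxV // !mul1mx !mulmxKV.
Qed.

End FixedDegrees.
End Admissible.

(** * Weight decomposition of admissible forms *)

Section WeightSpaces.
Variable F : numClosedFieldType.
Local Notation tensor := ('I_3 -> 'I_3 -> 'I_4 -> F).
Implicit Types (p q : {mpoly F[3 * 3 * 4]}) (x : tensor) (k l r : 'I_4).

Lemma comp_on_proportional n (S : pred 'I_n) (p : {mpoly F[n]}) y z c :
  (forall s, s != 0 -> p.@[scale_on S s y] = c * p.@[scale_on S s z]) ->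
  forall i, (comp_on S i p).@[y] = c * (comp_on S i p).@[z].
Proof.
move=> e k; pose d := (\max_(m <- msupp p) deg_on S m).+1.
pose q := \poly_(i < d) (comp_on S i p).@[z].
have qE s : p.@[scale_on S s z] = q.[s].
  by rewrite meval_scale_comp horner_poly; apply: eq_bigr => i _; rewrite mulrC.
rewrite (@comp_on_coef _ _ S p z q) // (@comp_on_coef _ _ S p y (c *: q)) ?coefZ //.
by move=> s s0; rewrite e // qE hornerZ.
Qed.

Lemma admissible_comp r n p : admissible p -> admissible (comp_on (sliceC r) n p).
Proof.
move=> [ph ps pc]; split; first exact: comp_on_homog.
  move=> g h x ug uh; rewrite /ev; apply: comp_on_proportional => s _.
  rewrite !ev_scaleC -ps //; apply: ev_ext => i j k.
  rewrite /scaleC /actA /actB mulr_sumr; apply: eq_bigr => i' _; rewrite mulrCA.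
  by congr (_ * _); rewrite mulr_sumr; apply: eq_bigr => j' _; rewrite mulrCA.
move=> x w k0 wk xw; apply: comp_on_vanish => s s0; rewrite ev_scaleC.
apply: (pc _ (fun k => w k / vscale r s k) k0) => [|i j].
  by rewrite mulf_neq0 // invr_eq0 /vscale; case: ifP; rewrite ?oner_eq0.
rewrite -[RHS](xw i j); apply: eq_bigr => k _; rewrite /scaleC mulrA mulfVK //.
by rewrite /vscale; case: ifP; rewrite ?oner_eq0.
Qed.

Lemma admissible_lin c p q : admissible p -> admissible q -> admissible (c *: p + q).
Proof.
move=> [ph ps pc] [qh qs qc]; split; first by rewrite rpredD // rpredZ.
  by move=> g h x ug uh; rewrite !evD !evZ ps // qs //; ring.
by move=> x w k0 wk xw; rewrite evD evZ (pc _ _ _ wk xw) (qc _ _ _ wk xw) mulr0 addr0.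
Qed.

Lemma admissible0 : admissible (0 : {mpoly F[3 * 3 * 4]}).
Proof.
split; first exact: rpred0.
  by move=> g h x _ _; rewrite /ev !meval0 mulr0.
by move=> x w k0 _ _; rewrite /ev meval0.
Qed.

(* The weights of S_(3,1,1,1) C^4 are the sums of (1,1,1,1) and two unit vectors. *)
Definition hook_weight k l r : nat := ((r == k) + (r == l)).+1.

Definition has_weight k l p :=
  forall r s x, ev p (scaleC r s x) = s ^+ hook_weight k l r * ev p x.

Lemma hook_weight_slots k l : exists a b c d, [/\ uniq [:: a; b; c; d],
  hook_weight k l c = 1%N & hook_weight k l d = 1%N].
Proof.
pose T (t : 'I_4 * 'I_4 * 'I_4 * 'I_4) := [&& uniq [:: t.1.1.1; t.1.1.2; t.1.2; t.2],
  hook_weight k l t.1.2 == 1%N & hook_weight k l t.2 == 1%N].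
suff [[[[a b] c] d] /and3P[u /eqP hc /eqP hd]] : exists t, T t by exists a, b, c, d.
move: @T; case: k => [[|[|[|[|//]]]] ?]; case: l => [[|[|[|[|//]]]] ?] T;
  first [by exists (0, 1, 2%:R, 3%:R) | by exists (0, 2%:R, 1, 3%:R) | by exists (0, 3%:R, 1, 2%:R)
   | by exists (1, 2%:R, 0, 3%:R) | by exists (1, 3%:R, 0, 2%:R) | by exists (2%:R, 3%:R, 0, 1)].
Qed.

Lemma weight_space_dim1 k l p q : admissible p -> admissible q ->
  has_weight k l p -> has_weight k l q -> q != 0 -> exists c, p = c *: q.
Proof.
move=> pad qad pw qw q0; have [a [b [c [d [u hc hd]]]]] := hook_weight_slots k l.
pose e0 : 'rV[F]_2 := delta_mx 0 0; pose e1 : 'rV[F]_2 := delta_mx 0 1.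
pose x0 := of_slices a b c (diag2 e0 e1 (const_mx 1) 0) (diag2 e0 e1 (const_mx 1) 1)
                    (delta_mx 0 1) (delta_mx 1 0).
have zero q' : admissible q' -> has_weight k l q' -> ev q' x0 = 0 -> q' = 0.
  move=> rad rw r0; apply: (admissible_slice_zero u rad (rw a) (rw b)) => //.
    by move=> s x; rewrite rw hc.
  by move=> s x; rewrite rw hd.
have qx : ev q x0 != 0 by apply: contraNneq q0 => /(zero q qad qw) ->.
exists (ev p x0 / ev q x0); apply/eqP; rewrite -subr_eq0 addrC -scaleNr; apply/eqP.
apply: zero; first exact: admissible_lin.
  by move=> r s x; rewrite !evD !evZ pw qw; ring.
by rewrite evD evZ mulNr mulfVK // addNr.
Qed.

(** The component of degree 0 in slice [r] keeps its values when slice [r] is set to zero, and there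
    conciseness makes them vanish. *)
Lemma admissible_deg_gt0 p m r : admissible p -> m \in msupp p ->
  (0 < deg_on (sliceC (a:=3) (b:=3) r) m)%N.
Proof.
move=> pad mp; rewrite lt0n; apply/negP=> /eqP d0; set S := sliceC r in d0.
have [_ _ qc] := admissible_comp r 0 pad.
have : (comp_on S 0 p)@_m = p@_m by rewrite mcoeff_comp_on d0 eqxx.
suff -> : comp_on S 0 p = 0 by move/eqP; rewrite mcoeff0 eq_sym mcoeff_eq0 mp.
apply: ev_zero => x.
have <- : ev (comp_on S 0 p) (scaleC r 0 x) = ev (comp_on S 0 p) x.
  by rewrite -ev_scaleC (@meval_scale _ _ _ _ _ _ 0) ?mul1r // => m'; apply: comp_on_deg.
apply: (qc _ (fun k => (k == r)%:R) r); first by rewrite eqxx oner_eq0.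
move=> i j; rewrite big1 // => k _; rewrite /scaleC /vscale.
by case: eqP; rewrite !(mul0r, mulr0).
Qed.

Lemma hook_weightP (G : 'I_4 -> nat) : (forall r, 0 < G r)%N -> (\sum_r G r = 6)%N ->
  exists k l, forall r, G r = hook_weight k l r.
Proof.
move=> G0; rewrite !big_ord_recl big_ord0 => G6.
set r0 := ord0 in G6; set r1 := lift _ _ in G6; set r2 := lift _ _ in G6; set r3 := lift _ _ in G6.
have rP r : [\/ r = r0, r = r1, r = r2 | r = r3].
  by case: r => [[|[|[|[|//]]]] ?]; [apply: Or41 | apply: Or42 | apply: Or43 | apply: Or44];
     apply/val_inj.
suff [k [l [e0 e1 e2 e3]]] : exists k l, [/\ G r0 = hook_weight k l r0,
    G r1 = hook_weight k l r1, G r2 = hook_weight k l r2 & G r3 = hook_weight k l r3].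
  by exists k, l => r; case: (rP r) => ->.
have [g0 g1 g2 g3] := And4 (G0 r0) (G0 r1) (G0 r2) (G0 r3).
move: (G r0) (G r1) (G r2) (G r3) g0 g1 g2 g3 G6 => [//|[|[|[|n0]]]] [//|[|[|[|n1]]]]
  [//|[|[|[|n2]]]] [//|[|[|[|n3]]]] _ _ _ _ e; try (exfalso; lia);
 first [by exists r0, r0 | by exists r0, r1 | by exists r0, r2 | by exists r0, r3
  | by exists r1, r1 | by exists r1, r2 | by exists r1, r3 | by exists r2, r2
  | by exists r2, r3 | by exists r3, r3].
Qed.

Lemma admissible_weight p m : admissible p -> m \in msupp p ->
  exists k l, forall r, deg_on (sliceC (a:=3) (b:=3) r) m = hook_weight k l r.
Proof.
move=> pad mp; apply: hook_weightP => [r|]; first exact: (admissible_deg_gt0 r pad mp).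
by rewrite sum_deg_sliceC; have [/dhomogP/(_ m mp)] := pad.
Qed.

(** Induction on the number of monomials: the component of [p] of the weight of one monomial is
    admissible, and subtracting it removes this monomial and creates none. *)
Lemma admissible_ind (P : {mpoly F[3 * 3 * 4]} -> Prop) :
  P 0 -> (forall p q, P p -> P q -> P (p + q)) ->
  (forall k l p, admissible p -> has_weight k l p -> P p) ->
  forall p, admissible p -> P p.
Proof.
move=> P0 PD Pw p; have [n] := ubnP (size (msupp p)); elim: n p => // n IH p.
rewrite ltnS => sp pad.
case E : (msupp p) => [|m ms].
  by have /eqP -> : p == 0; rewrite -?msupp_eq0 ?E.
have mp : m \in msupp p by rewrite E mem_head.
have [k [l kl]] := admissible_weight pad mp.
pose c r q : {mpoly F[3 * 3 * 4]} := comp_on (sliceC r) (hook_weight k l r) q.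
pose q := foldr c p (enum 'I_4).
have qad : admissible q by rewrite /q; elim: (enum _) => //= r s; apply: admissible_comp.
have qE m' : q@_m' = if all (fun r => deg_on (sliceC (a:=3) (b:=3) r) m' == hook_weight k l r)
                          (enum 'I_4) then p@_m' else 0.
  by rewrite /q; elim: (enum _) => //= r s e; rewrite mcoeff_comp_on e; case: eqP.
have qw : has_weight k l q.
  move=> r s x; rewrite -ev_scaleC (@meval_scale _ _ _ _ _ _ (hook_weight k l r)) // => m'.
  rewrite mcoeff_msupp qE; case: ifP; last by rewrite eqxx.
  by move/allP/(_ r); rewrite mem_enum => /(_ isT)/eqP.
rewrite -(subrK q p) addrC; apply: PD; first exact: Pw qad qw.
have pqad : admissible (p - q).
  by rewrite addrC -scaleN1r; apply: admissible_lin.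
apply: IH pqad; rewrite (leq_trans _ sp) //.
apply: (@uniq_leq_size _ (m :: msupp (p - q))).
  rewrite /= msupp_uniq andbT mcoeff_msupp negbK mcoeffB qE.
  by rewrite (introT allP) ?subrr // => r _; rewrite kl.
move=> m'; rewrite inE => /orP[/eqP->//|]; rewrite !mcoeff_msupp mcoeffB qE.
by case: ifP; rewrite ?subrr ?eqxx // subr0.
Qed.

End WeightSpaces.

(** * Schur modules *)

Section Alternating.
Variables (F : numFieldType) (n : nat).
Implicit Types (i : 'I_n -> 'I_n) (s : 'S_n).

(** The Levi-Civita symbol. As a determinant it is also defined, and zero, for indices with
    repetitions. *)
Definition eps i : F := \det (\matrix_(r, c) (i r == c)%:R).

Lemma eq_eps i j : i =1 j -> eps i = eps j.
Proof. by move=> e; congr (\det _); apply/matrixP=> r c; rewrite !mxE e. Qed.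

Lemma eps_perm i s : eps (fun m => i (s m)) = (-1) ^+ s * eps i.
Proof.
rewrite /eps -det_perm -det_mulmx -row_permE; congr (\det _).
by apply/matrixP=> r c; rewrite !mxE.
Qed.

Lemma eps_id : eps id = 1.
Proof. by rewrite /eps -[RHS](@det1 F n); congr (\det _); apply/matrixP=> r c; rewrite !mxE. Qed.

Lemma eps_noninj i a b : a != b -> i a = i b -> eps i = 0.
Proof. by move=> ab e; apply: (determinant_alternate ab) => c; rewrite !mxE e. Qed.

Lemma eps_swap i a b : a != b -> eps (fun m => i (tperm a b m)) = - eps i.
Proof. by move=> ab; rewrite eps_perm odd_tperm ab mulN1r. Qed.

(** A permutation is a product of transpositions, each of which changes the sign; a repeated index
    gives [f i = - f i]. *)
Lemma alternating_eps (V : lmodType F) (f : {ffun 'I_n -> 'I_n} -> V) :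
  (forall a b (i : {ffun 'I_n -> 'I_n}), a != b ->
     f [ffun m => i (tperm a b m)] = - f i) ->
  forall i : {ffun 'I_n -> 'I_n}, f i = eps i *: f [ffun m => m].
Proof.
move=> fa i; case: (boolP (injectiveb i)) => [/injectiveP ii|/injectivePn[a [b ab e]]].
  have -> : i = [ffun m => perm ii m] by apply/ffunP=> m; rewrite ffunE permE.
  move: (perm ii) => s; have -> : eps [ffun m => s m] = (-1) ^+ s.
    rewrite (@eq_eps _ (fun m => id (s m))) ?(eps_perm id) ?eps_id ?mulr1 //.
    by move=> m; rewrite ffunE.
  case: (prod_tpermP s) => ts -> {s}.
  elim: ts => [|[a b] ts IH] /=.
    rewrite big_nil odd_perm1 scale1r => _; congr f; apply/ffunP=> m.
    by rewrite !ffunE perm1.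
  case/andP=> ab /IH e; rewrite big_cons odd_mul_tperm ab signr_addb mulN1r scaleNr.
  rewrite -e -(fa a b _ ab).
  by congr f; apply/ffunP=> m; rewrite !ffunE permM.
rewrite (eps_noninj ab e) scale0r; have := fa a b i ab.
have -> : [ffun m => i (tperm a b m)] = i.
  by apply/ffunP=> m; rewrite ffunE; case: tpermP => // ->.
move/eqP; rewrite -addr_eq0 -mulr2n -scaler_nat scaler_eq0 pnatr_eq0 /=.
by move/eqP.
Qed.

Lemma eps_mul_row (A : 'M[F]_n) (i : 'I_n -> 'I_n) :
  \det (\matrix_(r, c) A (i r) c) = eps i * \det A.
Proof.
rewrite -det_mulmx; congr (\det _); apply/matrixP=> r c; rewrite !mxE (bigD1 (i r)) //=.
rewrite mxE eqxx mul1r big1 ?addr0 // => c' ne.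
by rewrite mxE eq_sym (negPf ne) mul0r.
Qed.

Variables (N : nat) (e : 'I_n -> 'I_N).
Hypothesis e_inj : injective e.

Definition graft (i : 'I_n -> 'I_n) (j : {ffun 'I_N -> 'I_n}) : {ffun 'I_N -> 'I_n} :=
  [ffun m => if [pick r | e r == m] is Some r then i r else j m].

Lemma graft_in i j r : graft i j (e r) = i r.
Proof.
rewrite ffunE; case: pickP => [r' /eqP/e_inj -> //|/(_ r)].
by rewrite eqxx.
Qed.

Lemma graft_out i j m : (forall r, e r != m) -> graft i j m = j m.
Proof.
by move=> me; rewrite ffunE; case: pickP => [r /eqP rm|//]; have := me r; rewrite rm eqxx.
Qed.

Lemma alternating_positions (V : lmodType F) (t : {ffun 'I_N -> 'I_n} -> V) :
  (forall a b (i : {ffun 'I_N -> 'I_n}), a != b ->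
     t [ffun m => i (tperm (e a) (e b) m)] = - t i) ->
  forall i : {ffun 'I_N -> 'I_n}, t i = eps (fun r => i (e r)) *: t (graft id i).
Proof.
move=> ta i; pose f (k : {ffun 'I_n -> 'I_n}) := t (graft k i).
have fa a b (k : {ffun 'I_n -> 'I_n}) : a != b -> f [ffun m => k (tperm a b m)] = - f k.
  move=> ab; rewrite /f -(ta a b) //; congr t; apply/ffunP=> m; rewrite [RHS]ffunE.
  case: (pickP (fun r => e r == m)) => [r /eqP <-|me].
    by rewrite -inj_tperm // !graft_in ffunE.
  have mP r : e r != m by rewrite me.
  by rewrite graft_out // tpermD // graft_out.
have -> : t i = f [ffun r => i (e r)].
  congr t; apply/ffunP=> m; case: (pickP (fun r => e r == m)) => [r /eqP <-|me].
    by rewrite graft_in ffunE.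
  by rewrite graft_out // => r; rewrite me.
rewrite (alternating_eps fa) /f; congr (_ *: t _).
  by apply: eq_eps => r; rewrite ffunE.
by apply/ffunP=> m; rewrite !ffunE; case: pickP => // r _; rewrite ffunE.
Qed.

End Alternating.

Section YoungSymmetrizers.
Variables (F : numFieldType) (n : nat) (pi : seq nat).
Local Notation d := (sumn pi).
Local Notation V := (tpow F n d).
Implicit Types (t u : V) (q s : 'S_d).

Lemma place_permM q s t : place_perm q (place_perm s t) = place_perm (s * q)%g t.
Proof.
apply/ffunP=> i; rewrite !ffunE; congr (t _); apply/ffunP=> m.
by rewrite !ffunE permM.
Qed.

Lemma col_groupM q s : q \in col_group pi -> ((s * q)%g \in col_group pi) = (s \in col_group pi).
Proof.
rewrite !inE => /forallP cq; apply/forallP/forallP => c m.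
  by rewrite -(eqP (c m)) permM (eqP (cq _)).
by rewrite permM (eqP (cq _)).
Qed.

Lemma row_groupM q s : q \in row_group pi -> ((s * q)%g \in row_group pi) = (s \in row_group pi).
Proof.
rewrite !inE => /forallP cq; apply/forallP/forallP => c m.
  by rewrite -(eqP (c m)) permM (eqP (cq _)).
by rewrite permM (eqP (cq _)).
Qed.

Lemma young_symmetrizer_col q t : q \in col_group pi ->
  place_perm q (young_symmetrizer t) = (-1) ^+ q *: young_symmetrizer t.
Proof.
move=> qc; rewrite /young_symmetrizer linear_sum scaler_sumr.
rewrite [RHS](reindex_inj (mulIg q)) /=.
apply: eq_big => [s|s _]; first by rewrite col_groupM.
rewrite linearZ /= place_permM odd_permM signr_addb scalerA mulrA.
by rewrite mulrAC -signr_addb addbb mul1r.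
Qed.

(** Columns are antisymmetrized last, so symmetry under [q] survives when [q] commutes with the
    column group. In the hook this applies to the exchange of cells 1 and 2. *)
Lemma young_symmetrizer_row q t : q \in row_group pi ->
  (forall s, s \in col_group pi -> commute s q) ->
  place_perm q (young_symmetrizer t) = young_symmetrizer t.
Proof.
move=> qr qc; rewrite /young_symmetrizer linear_sum; apply: eq_bigr => s /qc sq.
rewrite linearZ /= place_permM sq -place_permM; congr (_ *: place_perm _ _).
rewrite linear_sum [RHS](reindex_inj (mulIg q)) /=.
by apply: eq_big => [u|u _]; rewrite ?row_groupM ?place_permM.
Qed.

Definition tdelta (b : {ffun 'I_d -> 'I_n}) : V := [ffun i => (i == b)%:R].

(** Only the trivial column permutation contributes, so there are no signs and the coefficient is a
    count, which makes nonvanishing visible. *)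
Lemma young_symmetrizer_delta (b i : {ffun 'I_d -> 'I_n}) :
  (forall q s, q \in col_group pi -> s \in row_group pi ->
    [ffun m => i (q (s m))] = b -> q = 1%g) ->
  young_symmetrizer (tdelta b) i
    = (\sum_(s in row_group pi) ([ffun m => i (s m)] == b))%:R.
Proof.
move=> q1; rewrite /young_symmetrizer sum_ffunE (bigD1 1%g) /=; last first.
  by rewrite inE; apply/forallP=> m; rewrite perm1.
rewrite [X in _ + X]big1 => [|q /andP[qc q_n1]]; last first.
  rewrite !ffunE sum_ffunE big1 ?scaler0 // => s sr; rewrite !ffunE.
  case: eqP => // e; case/eqP: q_n1; apply: (q1 q s qc sr).
  by rewrite -e; apply/ffunP=> m; rewrite !ffunE.
rewrite addr0 !ffunE odd_perm1 scale1r sum_ffunE natr_sum; apply: eq_bigr => s _.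
rewrite !ffunE; congr ((_ == _)%:R); apply/ffunP=> m; by rewrite !ffunE perm1.
Qed.

Lemma schurP t : reflect (exists u, t = young_symmetrizer u) (t \in schur F n pi).
Proof.
apply: (iffP memv_imgP) => [[u _ ->]|[u ->]]; exists u; rewrite ?lfunE ?memvf //.
Qed.

Lemma schur_col_alt q t : t \in schur F n pi -> q \in col_group pi ->
  forall i : {ffun 'I_d -> 'I_n}, t [ffun m => i (q m)] = (-1) ^+ q *: (t i : F^o).
Proof.
move=> /schurP[u ->] /(young_symmetrizer_col u)/ffunP e i.
by have := e i; rewrite !ffunE.
Qed.

End YoungSymmetrizers.

Section SymmetricMatrices.
Variables (F : numFieldType) (n : nat).

Definition sym_unit k l : 'M[F]_n := delta_mx k l + delta_mx l k.

Lemma sym_unit_tr k l : (sym_unit k l)^T = sym_unit k l.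
Proof. by rewrite linearD /= !trmx_delta addrC. Qed.

Lemma sym_decomp (g : 'M[F]_n) : g^T = g -> g = \sum_k \sum_l (g k l / 2%:R) *: sym_unit k l.
Proof.
move=> gs; under eq_bigr do under eq_bigr do rewrite scalerDr.
under eq_bigr do rewrite big_split.
rewrite big_split /= [X in _ + X]exchange_big /= -big_split /=.
rewrite {1}(matrix_sum_delta g); apply: eq_bigr => l _; rewrite -big_split /=.
apply: eq_bigr => l' _; rewrite -scalerDl; congr (_ *: _).
have -> : g l' l = g l l' by rewrite -{1}gs mxE.
by field.
Qed.

End SymmetricMatrices.

Section SchurModules.
Variable F : numFieldType.

Local Notation square := [:: 2; 2; 2].
Local Notation hook := [:: 3; 1; 1; 1].
Local Notation o6 k := (@Ordinal 6 k isT).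

(* The two columns of the diagram of (2,2,2), and the first column of the diagram of (3,1,1,1),
   whose first row is 0, 1, 2. *)
Definition evens (r : 'I_3) : 'I_6 := nth (o6 0) [:: o6 0; o6 2; o6 4] r.
Definition odds (r : 'I_3) : 'I_6 := nth (o6 0) [:: o6 1; o6 3; o6 5] r.
Definition arm (r : 'I_4) : 'I_6 := nth (o6 0) [:: o6 0; o6 3; o6 4; o6 5] r.

Lemma evens_inj : injective evens.
Proof. by move=> [[|[|[|//]]] ?] [[|[|[|//]]] ?] // _; apply/val_inj. Qed.
Lemma odds_inj : injective odds.
Proof. by move=> [[|[|[|//]]] ?] [[|[|[|//]]] ?] // _; apply/val_inj. Qed.
Lemma arm_inj : injective arm.
Proof. by move=> [[|[|[|[|//]]]] ?] [[|[|[|[|//]]]] ?] // _; apply/val_inj. Qed.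

Lemma even_odd (m : 'I_6) : (exists r, m = evens r) \/ (exists r, m = odds r).
Proof.
case: m => [[|[|[|[|[|[|//]]]]]] ?];
  [left; exists 0 | right; exists 0 | left; exists 1 | right; exists 1 |
   left; exists 2%:R | right; exists 2%:R]; exact/val_inj.
Qed.

Lemma even_neq_odd r r' : evens r != odds r'.
Proof. by move: r r' => [[|[|[|//]]] ?] [[|[|[|//]]] ?]. Qed.

(** Alternating in both columns of the diagram; it spans S_(2,2,2) F^3, which is the line det^2. *)
Definition square_tensor : tpow F 3 6 :=
  [ffun i : {ffun 'I_6 -> 'I_3} => eps F (fun r => i (evens r)) * eps F (fun r => i (odds r))].

(** For symmetric [g], an element of S_(3,1,1,1) F^4 = det (x) S^2 F^4: the first column of the
    diagram carries det, the other two cells of the first row carry [g]. *)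
Definition hook_tensor (g : 'M[F]_4) : tpow F 4 6 :=
  [ffun k : {ffun 'I_6 -> 'I_4} => eps F (fun r => k (arm r)) * g (k (o6 1)) (k (o6 2))].

Lemma tperm_col_group pi (a b : 'I_(sumn pi)) :
  reshape_offset pi a = reshape_offset pi b -> tperm a b \in col_group pi :> bool.
Proof.
by move=> e; rewrite inE; apply/forallP=> m; case: tpermP => [->|->|//]; rewrite e.
Qed.

Lemma schur_tperm n pi (t : tpow F n (sumn pi)) (a b : 'I_(sumn pi)) :
  t \in schur F n pi -> a != b -> reshape_offset pi a = reshape_offset pi b ->
  forall i : {ffun 'I_(sumn pi) -> 'I_n}, (t [ffun m => i (tperm a b m)] : F^o) = - t i.
Proof.
move=> tS ab e i; rewrite (schur_col_alt tS (tperm_col_group e)).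
by rewrite odd_tperm ab scaleN1r.
Qed.

Lemma schur_squareP (t : tpow F 3 (sumn square)) :
  t \in schur F 3 square -> exists c : F, t = c *: square_tensor.
Proof.
move=> tS.
have te := @alternating_positions F 3 6 evens evens_inj F^o t _.
have to := @alternating_positions F 3 6 odds odds_inj F^o t _.
have {}te (i : {ffun 'I_6 -> 'I_3}) :
    t i = eps F (fun r => i (evens r)) *: (t (graft evens id i) : F^o).
  apply: te => a b j ab; apply: schur_tperm => //.
    by rewrite (inj_eq evens_inj).
  by move: a b {ab} => [[|[|[|//]]] ?] [[|[|[|//]]] ?].
have {}to (i : {ffun 'I_6 -> 'I_3}) :
    t i = eps F (fun r => i (odds r)) *: (t (graft odds id i) : F^o).
  apply: to => a b j ab; apply: schur_tperm => //.
    by rewrite (inj_eq odds_inj).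
  by move: a b {ab} => [[|[|[|//]]] ?] [[|[|[|//]]] ?].
pose b0 := graft odds id (graft evens id [ffun=> 0]) : {ffun 'I_6 -> 'I_3}.
exists (t b0); apply/ffunP=> i.
have -> : t i = eps F (fun r => i (evens r)) * (eps F (fun r => graft evens id i (odds r))
    * t (graft odds id (graft evens id i))) by rewrite {1}te {1}to.
have -> : graft odds id (graft evens id i) = b0.
  apply/ffunP=> m; have [[r ->]|[r ->]] := even_odd m.
    rewrite !(@graft_out _ _ odds) => [|r'|r']; rewrite 1?eq_sym ?even_neq_odd //.
    by rewrite !graft_in //; apply: evens_inj.
  by rewrite !graft_in //; apply: odds_inj.
rewrite (@eq_eps _ _ (fun r => graft evens id i (odds r)) (fun r => i (odds r))).
  by rewrite !ffunE /GRing.scale /= mulrA mulrC.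
by move=> r; rewrite graft_out // => r'; apply: even_neq_odd.
Qed.

(** By [schur_squareP] any nonzero element of the module is enough. The symmetrizer of the basis
    tensor indexed by the row numbers of the cells is nonzero, since a column permutation that
    preserves row numbers is trivial. *)
Lemma square_tensor_schur : square_tensor \in schur F 3 square.
Proof.
pose b : {ffun 'I_6 -> 'I_3} := [ffun m : 'I_6 => inord (m : nat)./2].
have bE (m : 'I_6) : b m = reshape_index square m :> nat.
  rewrite ffunE inordK; first by case: m => [[|[|[|[|[|[|//]]]]]] ?].
  by case: m => [[|[|[|[|[|[|//]]]]]] ?].
have q1 (q s : 'S_(sumn square)) : q \in col_group square -> s \in row_group square ->
    [ffun m => b (q (s m))] = b -> q = 1%g.
  move=> qc sr /ffunP e; apply/permP=> m; rewrite perm1.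
  move: qc sr; rewrite !inE => /forallP/(_ m)/eqP qm /forallP/(_ (s^-1%g m))/eqP.
  rewrite permKV => sm; have := e (s^-1%g m); rewrite ffunE permKV => /(congr1 val) /=.
  rewrite !bE -sm => qi; apply/val_inj.
  by rewrite /= -(reshape_indexK square (q m)) -[RHS](reshape_indexK square m) qi qm.
have := young_symmetrizer_delta F q1.
set u := young_symmetrizer _ => ub.
have uS : u \in schur F 3 square by apply/schurP; exists (@tdelta F 3 square b).
have [c uE] : exists c : F, u = c *: square_tensor by apply: schur_squareP.
have c0 : c != 0.
  apply: contraTneq isT => c0; have : (u b : F) != 0.
    rewrite ub pnatr_eq0 -lt0n (bigD1 1%g) /=.
      by rewrite (_ : [ffun m => _] = b) ?eqxx //; apply/ffunP=> m; rewrite ffunE perm1.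
    by rewrite inE; apply/forallP=> m; rewrite perm1.
  by rewrite uE c0 scale0r ffunE eqxx.
have -> : square_tensor = c^-1 *: u by rewrite uE scalerA mulVf // scale1r.
exact: (memvZ _ uS).
Qed.

Definition hbase (k1 k2 : 'I_4) : {ffun 'I_6 -> 'I_4} :=
  graft arm id [ffun m => if m == o6 1 then k1 else k2].

Lemma hbase_arm k1 k2 r : hbase k1 k2 (arm r) = r.
Proof. by rewrite /hbase graft_in //; apply: arm_inj. Qed.
Lemma hbase1 k1 k2 : hbase k1 k2 (o6 1) = k1.
Proof. by rewrite /hbase graft_out ?ffunE ?eqxx // => -[[|[|[|[|//]]]] ?]. Qed.
Lemma hbase2 k1 k2 : hbase k1 k2 (o6 2) = k2.
Proof. by rewrite /hbase graft_out ?ffunE // => -[[|[|[|[|//]]]] ?]. Qed.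

Lemma hook_positions (m : 'I_6) : [\/ m = o6 1, m = o6 2 | exists r, m = arm r].
Proof.
case: m => [[|[|[|[|[|[|//]]]]]] h]; [apply: Or33; exists 0 | apply: Or31 | apply: Or32
 | apply: Or33; exists 1 | apply: Or33; exists 2%:R | apply: Or33; exists 3%:R]; exact/val_inj.
Qed.

Lemma hbaseE (i : {ffun 'I_6 -> 'I_4}) : graft arm id i = hbase (i (o6 1)) (i (o6 2)).
Proof.
apply/ffunP=> m; have [->|->|[r ->]] := hook_positions m.
- by rewrite hbase1 graft_out // => -[[|[|[|[|//]]]] ?].
- by rewrite hbase2 graft_out // => -[[|[|[|[|//]]]] ?].
by rewrite hbase_arm graft_in //; apply: arm_inj.
Qed.

Lemma hook_tensor_hbase g k1 k2 : hook_tensor g (hbase k1 k2) = g k1 k2.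
Proof.
rewrite ffunE hbase1 hbase2 (@eq_eps _ _ _ id) ?eps_id ?mul1r // => r.
exact: hbase_arm.
Qed.

Lemma hook_col_fix (q : 'S_(sumn hook)) (m : 'I_6) : q \in col_group hook ->
  m = o6 1 \/ m = o6 2 -> q m = m.
Proof.
rewrite inE => /forallP/(_ m)/eqP + [] e; rewrite e.
  by case: (q (o6 1)) => [[|[|[|[|[|[|//]]]]]] ?] // _; apply/val_inj.
by case: (q (o6 2)) => [[|[|[|[|[|[|//]]]]]] ?] // _; apply/val_inj.
Qed.

Lemma schur_hookP (t : tpow F 4 (sumn hook)) :
  t \in schur F 4 hook -> exists2 g : 'M[F]_4, g^T = g & t = hook_tensor g.
Proof.
move=> tS.
have ta (i : {ffun 'I_6 -> 'I_4}) :
    t i = eps F (fun r => i (arm r)) *: (t (graft arm id i) : F^o).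
  apply: (@alternating_positions F 4 6 arm arm_inj F^o t) => a b j ab; apply: schur_tperm => //.
    by rewrite (inj_eq arm_inj).
  by move: a b {ab} => [[|[|[|[|//]]]] ?] [[|[|[|[|//]]]] ?].
exists (\matrix_(k1, k2) t (hbase k1 k2)); last first.
  by apply/ffunP=> i; rewrite ta hbaseE ffunE mxE.
have [u tE] := schurP _ tS.
have sr : tperm (o6 1) (o6 2) \in row_group hook.
  rewrite inE; apply/forallP=> m; apply/eqP.
  by case: tpermP => [->|->|].
have sc s : s \in col_group hook -> commute s (tperm (o6 1) (o6 2)).
  move=> sC; have s1 := hook_col_fix sC (or_introl (erefl (o6 1))).
  have s2 := hook_col_fix sC (or_intror (erefl (o6 2))).
  by apply: commute_sym; apply/commgP/conjg_fixP; rewrite tpermJ s1 s2.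
have tt : @place_perm F 4 hook (tperm (o6 1) (o6 2)) t = t.
  by rewrite tE; apply: young_symmetrizer_row.
apply/matrixP=> k1 k2; rewrite !mxE -{2}tt ffunE; congr (t _); apply/ffunP=> m.
rewrite [RHS]ffunE; case: (tpermP (o6 1) (o6 2) m) => [->|->|m1 m2]; rewrite ?hbase1 ?hbase2 //.
rewrite !ffunE; case: pickP => // am.
case: m am m1 m2 => [[|[|[|[|[|[|//]]]]]] h] am m1 m2.
- by have := am 0.
- by case: m1; apply/val_inj.
- by case: m2; apply/val_inj.
- by have := am 1.
- by have := am 2%:R.
- by have := am 3%:R.
Qed.

Lemma hook_tensor_lin (c : F) g g' :
  hook_tensor (c *: g + g') = c *: hook_tensor g + hook_tensor g'.
Proof.
by apply/ffunP=> k; rewrite !ffunE !mxE /GRing.scale /=; ring.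
Qed.

(** The column group fixes cells 1 and 2, and the row group fixes the first column below the corner.
    Hence the equation forces [q] to fix all cells below the corner, and then the corner itself. *)
Lemma hook_delta_rigid l l' k1 k2 (q s : 'S_(sumn hook)) :
  q \in col_group hook -> s \in row_group hook ->
  [ffun m => hbase k1 k2 (q (s m))] = hbase l l' -> q = 1%g.
Proof.
move=> qc sr /ffunP e.
have qarm r : exists r', q (arm r) = arm r'.
  have [m1|m1|//] := hook_positions (q (arm r)).
    have /(congr1 (q^-1)%g) := m1; rewrite permK -{1}(hook_col_fix qc (or_introl (erefl _))) permK.
    by case: r {m1} => [[|[|[|[|//]]]] ?].
  have /(congr1 (q^-1)%g) := m1; rewrite permK -{1}(hook_col_fix qc (or_intror (erefl _))) permK.
  by case: r {m1} => [[|[|[|[|//]]]] ?].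
have q1 (r : 'I_4) : r != 0 -> q (arm r) = arm r.
  move=> r0; have sm : s (arm r) = arm r.
    move: sr; rewrite inE => /forallP/(_ (arm r))/eqP.
    case: r r0 => [[|[|[|[|//]]]] ?] // _;
      by case: (s _) => [[|[|[|[|[|[|//]]]]]] ?] // _; apply/val_inj.
  have := e (arm r); rewrite ffunE sm hbase_arm; have [r' ->] := qarm r.
  by rewrite hbase_arm => ->.
have q0 : q (arm 0) = arm 0.
  have [r qr] := qarm 0; have [r0|/q1] := eqVneq r 0; first by rewrite qr r0.
  by rewrite -qr => /perm_inj; rewrite qr.
apply/permP=> m; rewrite perm1; have [->|->|[r ->]] := hook_positions m.
- by apply: hook_col_fix => //; left.
- by apply: hook_col_fix => //; right.
by have [->|/q1] := eqVneq r 0.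
Qed.

(** [s] permutes the three cells of the first row, so the multisets {0, k1, k2} and {0, l, l'}
    agree. *)
Lemma hook_delta_support l l' k1 k2 (s : 'S_(sumn hook)) : s \in row_group hook ->
  [ffun m => hbase k1 k2 (s m)] = hbase l l' ->
  (k1 = l /\ k2 = l') \/ (k1 = l' /\ k2 = l).
Proof.
move=> sr /ffunP e.
have h0 k k' : hbase k k' (o6 0) = 0 by rewrite -[o6 0]/(arm 0) hbase_arm.
have e0 := e (o6 0); have e1 := e (o6 1); have e2 := e (o6 2).
rewrite ffunE h0 in e0; rewrite ffunE hbase1 in e1; rewrite ffunE hbase2 in e2.
have row m : m \in [:: o6 0; o6 1; o6 2] -> s m \in [:: o6 0; o6 1; o6 2].
  move: sr; rewrite inE => /forallP/(_ m)/eqP + mi.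
  have -> : reshape_index hook m = 0%N by move: mi; rewrite !inE => /or3P[]/eqP->.
  by case: (s m) => [[|[|[|[|[|[|//]]]]]] ?].
have i01 : s (o6 0) != s (o6 1) by rewrite (inj_eq perm_inj).
have i02 : s (o6 0) != s (o6 2) by rewrite (inj_eq perm_inj).
have i12 : s (o6 1) != s (o6 2) by rewrite (inj_eq perm_inj).
move: (row (o6 0)) (row (o6 1)) (row (o6 2)); rewrite !inE !eqxx ?orbT.
move=> /(_ isT)/or3P[]/eqP s0 /(_ isT)/or3P[]/eqP s1 /(_ isT)/or3P[]/eqP s2;
  rewrite s0 ?s1 ?s2 in i01 i02 i12 e0 e1 e2; rewrite ?eqxx // in i01 i02 i12;
  rewrite ?h0 ?hbase1 ?hbase2 in e0 e1 e2; subst; by [left | right].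
Qed.

(** The symmetrizer of the basis tensor at [hbase l l'] is [hook_tensor h], where [h] is supported
    at (l, l') and (l', l) and is not zero there. The factor 2 for l = l' is the diagonal entry of
    [sym_unit]. *)
Lemma hook_tensor_pair_schur l l' :
  hook_tensor (sym_unit F l l') \in schur F 4 hook.
Proof.
pose b : {ffun 'I_(sumn hook) -> 'I_4} := hbase l l'.
pose u := young_symmetrizer (@tdelta F 4 hook b).
have uS : u \in schur F 4 hook by apply/schurP; exists (@tdelta F 4 hook b).
have [h hs uE] := schur_hookP uS.
have hE k1 k2 : h k1 k2
    = (\sum_(s in row_group hook) ([ffun m => hbase k1 k2 (s m)] == hbase l l'))%:R.
  rewrite -hook_tensor_hbase -uE; apply: young_symmetrizer_delta => q s.
  exact: hook_delta_rigid.
have h0 : h l l' != 0.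
  rewrite hE pnatr_eq0 -lt0n (bigD1 1%g) /=.
    by rewrite (_ : [ffun m => _] = hbase l l') ?eqxx //; apply/ffunP=> m; rewrite ffunE perm1.
  by rewrite inE; apply/forallP=> m; rewrite perm1.
suff -> : sym_unit F l l' = ((l == l').+1%:R / h l l') *: h.
  by rewrite -[_ *: h]addr0 hook_tensor_lin -uE (_ : hook_tensor 0 = 0) ?addr0 ?memvZ //;
     apply/ffunP=> k; rewrite !ffunE mxE mulr0.
have hl : h l' l = h l l' by rewrite -{1}hs mxE.
apply/matrixP=> k1 k2; rewrite !mxE.
have [/andP[/eqP-> /eqP->]|n1] := boolP ((k1 == l) && (k2 == l')).
  by rewrite divfK // (eq_sym l'); case: (l == l'); rewrite -?natrD ?addr0.
have [/andP[/eqP e1 /eqP e2]|n2] := boolP ((k1 == l') && (k2 == l)).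
  rewrite e1 e2 hl divfK //; move: n1; rewrite e1 e2 (eq_sym l'); case: (l == l') => //= _.
  by rewrite add0r.
rewrite [h k1 k2]hE big1 ?mulr0n ?mulr0 ?addr0 // => s sr; case: eqP => // /(hook_delta_support sr).
by case=> -[e1 e2]; rewrite ?e1 ?e2 ?eqxx in n1 n2.
Qed.

Lemma hook_tensor_schur g : g^T = g -> hook_tensor g \in schur F 4 hook.
Proof.
move=> gs; rewrite (sym_decomp gs).
have hs (I : Type) (r : seq I) (G : I -> 'M[F]_4) :
    (forall i, hook_tensor (G i) \in schur F 4 hook) ->
    hook_tensor (\sum_(i <- r) G i) \in schur F 4 hook.
  move=> GS; elim: r => [|i r IH].
    rewrite big_nil (_ : hook_tensor 0 = 0) ?mem0v //.
    by apply/ffunP=> k; rewrite !ffunE mxE mulr0.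
  by rewrite big_cons -[G i]scale1r hook_tensor_lin scale1r memvD.
apply: (hs) => l; apply: (hs) => l'; rewrite -[_ *: _]addr0 hook_tensor_lin.
rewrite (_ : hook_tensor 0 = 0) ?addr0 ?memvZ ?hook_tensor_pair_schur //.
by apply/ffunP=> k; rewrite !ffunE mxE mulr0.
Qed.

End SchurModules.

(** * Covariant families of forms *)

Section CovariantFamilies.
Variable F : numClosedFieldType.
Variable Phi : 'M[F]_4 -> {mpoly F[3 * 3 * 4]}.
Implicit Types (g h : 'M[F]_4) (k l r : 'I_4) (x : 'I_3 -> 'I_3 -> 'I_4 -> F).

Hypothesis Phi_lin : forall (s : F) g g', Phi (s *: g + g') = s *: Phi g + Phi g'.
Hypothesis Phi_homog : forall g, g^T = g -> Phi g \is 6.-homog.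
(** The covariance of det^2 (x) det^2 (x) det (x) S^2 F^4. The section is applied both to an
    arbitrary embedding of the Schur module and to [contraction]. *)
Hypothesis Phi_cov : forall gA gB h g x, g^T = g ->
  gA \in unitmx -> gB \in unitmx -> h \in unitmx ->
  ev (Phi g) (tact gA gB h x)
    = \det gA ^+ 2 * \det gB ^+ 2 * \det h * ev (Phi (h^T *m g *m h)) x.

Lemma congr_sym g h : g^T = g -> (h^T *m g *m h)^T = h^T *m g *m h.
Proof. by move=> gs; rewrite !trmx_mul gs trmxK mulmxA. Qed.

Lemma Phi0 : Phi 0 = 0.
Proof.
have := Phi_lin 1 0 0; rewrite !scale1r addr0 => /eqP.
by rewrite -subr_eq subrr eq_sym => /eqP.
Qed.

Lemma PhiD g g' : Phi (g + g') = Phi g + Phi g'.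
Proof. by rewrite -[g]scale1r Phi_lin !scale1r. Qed.

Lemma PhiZ s g : Phi (s *: g) = s *: Phi g.
Proof. by rewrite -[s *: g]addr0 Phi_lin Phi0 addr0. Qed.

Lemma Phi_sum (I : Type) (rs : seq I) (G : I -> 'M[F]_4) :
  Phi (\sum_(i <- rs) G i) = \sum_(i <- rs) Phi (G i).
Proof.
by elim: rs => [|i rs IH]; rewrite ?big_nil ?Phi0 // !big_cons PhiD IH.
Qed.

Lemma Phi_semi_invariant g : g^T = g -> semi_invariant (Phi g).
Proof.
move=> gs gA gB x uA uB.
have <- : ev (Phi g) (tact gA gB 1%:M x) = ev (Phi g) (actA gA (actB gB x)).
  apply: ev_ext => i j k; rewrite tactE; apply: actA_ext => ? ? ?.
  by apply: actB_ext => ? ? ?; rewrite actC1.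
by rewrite Phi_cov ?unitmx1 // det1 trmx1 mulmx1 mul1mx mulr1.
Qed.

Lemma Phi_actC g h x : g^T = g -> h \in unitmx ->
  ev (Phi g) (actC h x) = \det h * ev (Phi (h^T *m g *m h)) x.
Proof.
move=> gs uh.
have <- : ev (Phi g) (tact 1%:M 1%:M h x) = ev (Phi g) (actC h x).
  by apply: ev_ext => i j k; rewrite tact_C.
by rewrite Phi_cov ?unitmx1 // !det1 !expr1n !mul1r.
Qed.

Lemma Phi_weight k l : has_weight k l (Phi (sym_unit F k l)).
Proof.
move=> r s x; rewrite -ev_scaleC (@meval_scale _ _ _ _ _ _ (hook_weight k l r)) //.
(* Covariance concerns invertible scalings only; through the degrees of the monomials the result
   extends to s = 0, the case that [Phi_slice0] uses. *)
apply: deg_on_scaling => {}s z s0;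
rewrite !(@ev_meval F 3 3 4).
set y := fun i j k => _; set y' := fun i j k => _.
pose h : 'M[F]_4 := diag_mx (\row_k vscale r s k).
have dh : \det h = s.
  rewrite det_diag (bigD1 r) //= mxE /vscale eqxx big1 ?mulr1 // => k' kr.
  by rewrite mxE (negPf kr).
have <- : ev (Phi (sym_unit F k l)) (actC h y') = ev (Phi (sym_unit F k l)) y.
  apply: ev_ext => i j k'; rewrite /actC (bigD1 k') //= big1 ?addr0 => [|k2 ne].
    rewrite !mxE eqxx mulr1n /y /y' /scale_on /sliceC /tidx mxtens_indexK /vscale /=.
    by case: (k' == r); rewrite ?mul1r.
  by rewrite !mxE eq_sym (negPf ne) mul0r.
rewrite Phi_actC ?sym_unit_tr ?unitmxE ?dh ?unitfE //.
have -> : h^T *m sym_unit F k l *m h = (vscale r s k * vscale r s l) *: sym_unit F k l.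
  rewrite tr_diag_mx mul_diag_mx mul_mx_diag; apply/matrixP=> i j; rewrite !mxE.
  rewrite mulrDr mulrDl [RHS]mulrDr.
  by congr (_ + _); case: andP => [[/eqP-> /eqP->]|_]; rewrite ?mulr0n ?mulr0 ?mul0r //; ring.
rewrite PhiZ evZ mulrA; congr (_ * _); rewrite /hook_weight exprS exprD mulrA -mulrA; congr (_ * _).
by rewrite /vscale !(eq_sym r); case: (k == r); case: (l == r); rewrite ?expr0 ?expr1.
Qed.

Lemma Phi_slice0 g r x : g^T = g -> (forall i j, x i j r = 0) -> ev (Phi g) x = 0.
Proof.
move=> gs x0; rewrite (sym_decomp gs) Phi_sum.
rewrite ev_sum big1 // => k _; rewrite Phi_sum ev_sum big1 // => l _.
rewrite PhiZ evZ -(@ev_ext _ _ _ _ _ (scaleC r 0 x) x) => [|i j k'].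
  by rewrite Phi_weight expr0n mul0r mulr0.
by rewrite /scaleC /vscale; case: eqP => [->|_]; rewrite ?x0 ?mul0r ?mul1r.
Qed.

(** A change of basis of C turns the vanishing combination of slices into slice [k0], and every
    weight that occurs has positive degree in each slice. *)
Lemma Phi_admissible g : g^T = g -> admissible (Phi g).
Proof.
move=> gs; split; [exact: Phi_homog | exact: Phi_semi_invariant |].
move=> x w k0 wk xw.
pose h : 'M[F]_4 := \matrix_(k, k') if k == k0 then w k' else (k == k')%:R.
have uh : h \in unitmx.
  rewrite unitmxE unitfE; suff -> : \det h = w k0 by [].
  rewrite (expand_det_col _ k0) (bigD1 k0) //= big1 ?addr0 => [|k kn].
    rewrite mxE eqxx /cofactor addnn -signr_odd odd_double mul1r.
    rewrite (_ : row' k0 (col' k0 h) = 1%:M) ?det1 ?mulr1 //.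
    apply/matrixP=> i j; rewrite !mxE eq_sym (negPf (neq_lift _ _)).
    by rewrite (inj_eq lift_inj).
  by rewrite mxE (negPf kn) mul0r.
have : ev (Phi ((invmx h)^T *m g *m invmx h)) (actC h x) = 0.
  apply: (@Phi_slice0 _ k0); first exact: congr_sym.
  by move=> i j; rewrite /actC -[RHS](xw i j); apply: eq_bigr => k _; rewrite mxE eqxx.
rewrite Phi_actC ?congr_sym // => /eqP; rewrite mulf_eq0 -(negbK (_ == 0)) -unitfE -unitmxE uh /=.
by rewrite trmx_inv !mulmxA mulmxV ?unitmx_tr // mul1mx mulmxKV // => /eqP.
Qed.

(** For invertible [h] this is covariance; density extends it to singular [h], which [Phi_inj_of]
    needs. *)
Lemma Phi_congr0 g h : g^T = g -> Phi g = 0 -> Phi (h^T *m g *m h) = 0.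
Proof.
move=> gs g0; apply: ev_zero => x.
apply: (@lp_dense F 'M[F]_4 (fun h => \det h) (fun h => ev (Phi (h^T *m g *m h)) x) 1%:M).
- by apply: lp_det => i j; apply: lp_lin => *; rewrite !mxE.
- apply: (@lp_ext _ _ (fun h => \sum_k \sum_l (h^T *m g *m h) k l * ev (Phi (delta_mx k l)) x)).
    move=> {}h; rewrite {2}(matrix_sum_delta (h^T *m g *m h)) Phi_sum.
    rewrite ev_sum; apply: eq_bigr => k _; rewrite Phi_sum ev_sum.
    by apply: eq_bigr => l _; rewrite PhiZ evZ.
  apply: lp_sum => k; apply: lp_sum => l; apply: lp_mul; last exact: lp_const.
  apply: (@lp_ext _ _ (fun h => \sum_j (\sum_i h i k * g i j) * h j l)) => [{}h|].
    rewrite mxE; apply: eq_bigr => j _; congr (_ * _); rewrite mxE.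
    by apply: eq_bigr => i _; rewrite mxE.
  apply: lp_sum => j; apply: lp_mul; last by apply: lp_lin => *; rewrite !mxE.
  apply: lp_sum => i; apply: lp_mul; last exact: lp_const.
  by apply: lp_lin => *; rewrite !mxE.
- by rewrite det1 oner_eq0.
move=> {}h dh; have uh : h \in unitmx by rewrite unitmxE unitfE.
apply/eqP; have /eqP := Phi_actC x gs uh.
by rewrite g0 /ev meval0 eq_sym mulf_eq0 (negPf dh).
Qed.

Lemma quadratic_zero g : g^T = g -> (forall v : 'cV[F]_4, (v^T *m g *m v) 0 0 = 0) -> g = 0.
Proof.
move=> gs q0; apply/matrixP=> k l; rewrite [RHS]mxE.
have e i j : (delta_mx 0 i *m g *m delta_mx j 0 : 'M_1) 0 0 = g i j.
  by rewrite -rowE -colE !mxE.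
have := q0 (delta_mx k 0 + delta_mx l 0).
rewrite [(_ + _)^T]linearD /= !trmx_delta !(mulmxDl, mulmxDr).
have := q0 (delta_mx k 0); have := q0 (delta_mx l 0); rewrite !trmx_delta.
rewrite ![(_ + _ : 'M__) 0 0]mxE !e => -> ->; rewrite add0r addr0.
have -> : g l k = g k l by rewrite -{1}gs mxE.
by move/eqP; rewrite -mulr2n mulrn_eq0 => /eqP.
Qed.

(** For the rank-one matrix h = v e_0^T the congruent matrix h^T g h is (v^T g v) E_00. So a [g] in
    the kernel satisfies v^T g v = 0 for all v, and injectivity only requires one form to be
    nonzero. *)
Lemma Phi_inj_of : Phi (delta_mx 0 0) != 0 -> forall g, g^T = g -> Phi g = 0 -> g = 0.
Proof.
move=> n0 g gs g0; apply: quadratic_zero => // v.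
have := Phi_congr0 (v *m delta_mx 0 0) gs g0.
rewrite trmx_mul trmx_delta !mulmxA -(mulmxA (delta_mx 0 0)) -(mulmxA (delta_mx 0 0)).
rewrite [v^T *m g *m v]mx11_scalar mul_mx_scalar -scalemxAl mul_delta_mx PhiZ.
by move/eqP; rewrite scaler_eq0 (negPf n0) orbF => /eqP->; rewrite mxE mul0rn.
Qed.

Hypothesis Phi_inj : forall g, g^T = g -> Phi g = 0 -> g = 0.

Lemma admissibleP p : admissible p <-> exists2 g, g^T = g & p = Phi g.
Proof.
split=> [|[g gs ->]]; last exact: Phi_admissible.
move: p; apply: admissible_ind.
- by exists 0; rewrite ?Phi0 ?linear0.
- by move=> p q [g gs ->] [h hs ->]; exists (g + h); rewrite ?PhiD // linearD /= gs hs.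
move=> k l p pad pw.
have s0 : Phi (sym_unit F k l) != 0.
  apply/eqP=> /(Phi_inj (sym_unit_tr F k l))/matrixP/(_ k l)/eqP.
  rewrite !mxE !eqxx /=; case: (_ && _); rewrite ?addr0 ?oner_eq0 //.
  by rewrite -(natrD _ 1 1) pnatr_eq0.
have [c ->] := weight_space_dim1 pad (Phi_admissible (sym_unit_tr F k l)) pw (Phi_weight k l) s0.
by exists (c *: sym_unit F k l); rewrite ?PhiZ // linearZ /= sym_unit_tr.
Qed.

End CovariantFamilies.

(** * An explicit embedding of the Schur module *)

Section Pairings.
Variable F : numFieldType.
Local Notation o6 k := (@Ordinal 6 k isT).

(** The value of [t] as a multilinear form at the vectors a_0, ..., a_(d-1). *)
Definition pairing n d (t : tpow F n d) (a : 'I_d -> 'I_n -> F) : F :=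
  \sum_i t i * \prod_r a r (i r).

Lemma sum_eps n (a : 'I_n -> 'I_n -> F) :
  \sum_(i : {ffun 'I_n -> 'I_n}) eps F i * \prod_r a r (i r)
    = \det (\matrix_(r, c) a r c).
Proof.
transitivity (\sum_(i : {ffun 'I_n -> 'I_n}) \sum_(s : 'S_n)
    (-1) ^+ s * \prod_r (a r (i r) * (i r == s r)%:R)).
  apply: eq_bigr => i _; rewrite mulr_suml; apply: eq_bigr => s _.
  rewrite -mulrA -big_split /=; congr (_ * _); apply: eq_bigr => r _.
  by rewrite mxE mulrC.
rewrite exchange_big; apply: eq_bigr => s _; rewrite -mulr_sumr; congr (_ * _).
rewrite -(bigA_distr_bigA (fun r c => a r c * (c == s r)%:R)).
apply: eq_bigr => r _; rewrite mxE (bigD1 (s r)) //= eqxx mulr1 big1 ?addr0 // => c.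
by move=> /negPf->; rewrite mulr0.
Qed.

Lemma prod_evens_odds (G : 'I_6 -> F) :
  \prod_m G m = (\prod_r G (evens r)) * \prod_r G (odds r).
Proof.
rewrite (perm_big ([seq evens r | r <- index_enum 'I_3] ++ [seq odds r | r <- index_enum 'I_3])).
  by rewrite big_cat !big_map.
apply: uniq_perm => [||m]; first exact: index_enum_uniq.
  rewrite cat_uniq !map_inj_uniq ?index_enum_uniq ?andbT /=;
    try exact: odds_inj; try exact: evens_inj.
  apply/hasPn=> _ /mapP[r _ ->]; apply/mapP=> -[r' _ e].
  by have := even_neq_odd r' r; rewrite e eqxx.
rewrite mem_index_enum mem_cat; have [[r ->]|[r ->]] := even_odd m.
  by rewrite map_f // mem_index_enum.
by rewrite [X in _ || X]map_f ?orbT // mem_index_enum.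
Qed.

Lemma prod_hook (G : 'I_6 -> F) :
  \prod_m G m = (\prod_r G (arm r)) * (G (o6 1) * G (o6 2)).
Proof.
rewrite (perm_big ([seq arm r | r <- index_enum 'I_4] ++ [:: o6 1; o6 2])).
  by rewrite big_cat big_map !big_cons big_nil; rewrite /= mulr1.
apply: uniq_perm => [||m]; first exact: index_enum_uniq.
  rewrite cat_uniq map_inj_uniq ?index_enum_uniq ?andbT /=; last exact: arm_inj.
  by rewrite orbF; apply/norP; split; apply/mapP=> -[[[|[|[|[|//]]]] ?] _].
rewrite mem_index_enum mem_cat !inE; have [->|->|[r ->]] := hook_positions m.
- by rewrite eqxx orbT.
- by rewrite eqxx !orbT.
by rewrite map_f // mem_index_enum.
Qed.

Lemma pairing_square (a : 'I_6 -> 'I_3 -> F) :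
  pairing (square_tensor F) a = \det (\matrix_(r, c) a (evens r) c)
                            * \det (\matrix_(r, c) a (odds r) c).
Proof.
rewrite -!sum_eps mulr_suml.
under [RHS]eq_bigr do rewrite mulr_sumr.
pose join (z : {ffun 'I_3 -> 'I_3} * {ffun 'I_3 -> 'I_3}) : {ffun 'I_6 -> 'I_3} :=
  graft evens z.1 (graft odds z.2 [ffun=> 0]).
have je z r : join z (evens r) = z.1 r by rewrite /join graft_in //; apply: evens_inj.
have jo z r : join z (odds r) = z.2 r.
  rewrite /join graft_out ?graft_in //; first exact: odds_inj.
  by move=> r'; apply: even_neq_odd.
rewrite pair_bigA /= /pairing (reindex join) /=; last first.
  exists (fun i : {ffun 'I_6 -> 'I_3} => ([ffun r => i (evens r)], [ffun r => i (odds r)])).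
    by move=> [z1 z2] _; congr pair; apply/ffunP=> r; rewrite ffunE ?je ?jo.
  move=> i _; apply/ffunP=> m; have [[r ->]|[r ->]] := even_odd m.
    by rewrite je ffunE.
  by rewrite jo ffunE.
apply: eq_bigr => z _; rewrite ffunE prod_evens_odds.
rewrite (eq_eps _ (je z)) (eq_eps _ (jo z)).
under eq_bigr do rewrite je; under [X in _ * (_ * X)]eq_bigr do rewrite jo.
by rewrite mulrACA.
Qed.

Lemma pairing_hook (g : 'M[F]_4) (a : 'I_6 -> 'I_4 -> F) :
  pairing (hook_tensor g) a = \det (\matrix_(r, c) a (arm r) c)
    * \sum_k \sum_l g k l * (a (o6 1) k * a (o6 2) l).
Proof.
rewrite -sum_eps pair_bigA mulr_suml.
under [RHS]eq_bigr do rewrite mulr_sumr.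
pose join (z : {ffun 'I_4 -> 'I_4} * ('I_4 * 'I_4)) : {ffun 'I_6 -> 'I_4} :=
  graft arm z.1 [ffun m => if m == o6 1 then z.2.1 else z.2.2].
have ja z r : join z (arm r) = z.1 r by rewrite /join graft_in //; apply: arm_inj.
have j1 z : join z (o6 1) = z.2.1.
  by rewrite /join graft_out ?ffunE // => -[[|[|[|[|//]]]] ?].
have j2 z : join z (o6 2) = z.2.2.
  by rewrite /join graft_out ?ffunE // => -[[|[|[|[|//]]]] ?].
rewrite pair_bigA /= /pairing (reindex join) /=; last first.
  exists (fun i : {ffun 'I_6 -> 'I_4} => ([ffun r => i (arm r)], (i (o6 1), i (o6 2)))).
    by move=> [z1 [k l]] _; rewrite j1 j2; congr pair; apply/ffunP=> r; rewrite ffunE ja.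
  move=> i _; apply/ffunP=> m; have [->|->|[r ->]] := hook_positions m.
  - by rewrite j1.
  - by rewrite j2.
  by rewrite ja ffunE.
apply: eq_bigr => z _; rewrite ffunE prod_hook j1 j2.
rewrite (eq_eps _ (ja z)).
under eq_bigr do rewrite ja.
by rewrite mulrACA.
Qed.

End Pairings.

Section Contraction.
Variable F : numFieldType.
Local Notation o6 k := (@Ordinal 6 k isT).
Local Notation index := ({ffun 'I_6 -> 'I_3} * {ffun 'I_6 -> 'I_3} * {ffun 'I_6 -> 'I_4})%type.
Implicit Types (t : {ffun index -> F^o}) (x : 'I_3 -> 'I_3 -> 'I_4 -> F).

(* In each monomial, the factor r takes its A-index from position sig r, its B-index from
   position tau r and its C-index from position r. These placements make the sum over lam in
   ev_square_hook cancel in rank 4 but not in rank 5. *)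
Definition sig (r : 'I_6) := nth (o6 0) [:: o6 0; o6 2; o6 3; o6 4; o6 5; o6 1] r.
Definition sigV (r : 'I_6) := nth (o6 0) [:: o6 0; o6 5; o6 1; o6 2; o6 3; o6 4] r.
Definition tau (r : 'I_6) := nth (o6 0) [:: o6 0; o6 2; o6 3; o6 1; o6 5; o6 4] r.
Definition tauV (r : 'I_6) := nth (o6 0) [:: o6 0; o6 3; o6 1; o6 2; o6 5; o6 4] r.

Lemma sigK : cancel sig sigV.
Proof. by move=> [[|[|[|[|[|[|//]]]]]] ?]; apply/val_inj. Qed.
Lemma sigVK : cancel sigV sig.
Proof. by move=> [[|[|[|[|[|[|//]]]]]] ?]; apply/val_inj. Qed.
Lemma tauK : cancel tau tauV.
Proof. by move=> [[|[|[|[|[|[|//]]]]]] ?]; apply/val_inj. Qed.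
Lemma tauVK : cancel tauV tau.
Proof. by move=> [[|[|[|[|[|[|//]]]]]] ?]; apply/val_inj. Qed.

Definition contraction t : {mpoly F[3 * 3 * 4]} :=
  \sum_(m : index) t m *: \prod_r 'X_(tidx (m.1.1 (sig r)) (m.1.2 (tau r)) (m.2 r)).

Fact contraction_is_linear : linear contraction.
Proof.
move=> c t u; rewrite /contraction scaler_sumr -big_split /=; apply: eq_bigr => m _.
by rewrite !ffunE scalerDl scalerA.
Qed.
HB.instance Definition _ := GRing.isLinear.Build F {ffun index -> F^o} {mpoly F[3 * 3 * 4]} _
  contraction contraction_is_linear.

Lemma ev_contraction t x : ev (contraction t) x
  = \sum_(m : index) t m * \prod_r x (m.1.1 (sig r)) (m.1.2 (tau r)) (m.2 r).
Proof.
rewrite /ev raddf_sum; apply: eq_bigr => m _ /=; rewrite mevalZ; congr (_ * _).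
by rewrite rmorph_prod; apply: eq_bigr => r _; rewrite /= mevalXU flatE.
Qed.

Lemma contraction_homog t : contraction t \is 6.-homog.
Proof.
apply: homog_of_scaling => s z _; rewrite !ev_meval !ev_contraction mulr_sumr.
apply: eq_bigr => m _; rewrite mulrCA; congr (_ * _).
by rewrite big_split /= prodr_const card_ord.
Qed.

Lemma reindex_positions n (e eV : 'I_6 -> 'I_6) (G : {ffun 'I_6 -> 'I_n} -> F) :
  cancel e eV -> cancel eV e ->
  \sum_i G i = \sum_(i : {ffun 'I_6 -> 'I_n}) G [ffun r => i (e r)].
Proof.
move=> eK eVK; rewrite (reindex (fun i : {ffun 'I_6 -> 'I_n} => [ffun r => i (e r)])) //.
exists (fun i : {ffun 'I_6 -> 'I_n} => [ffun r => i (eV r)]) => i _;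
  by apply/ffunP=> r; rewrite !ffunE ?eK ?eVK.
Qed.

Lemma prod_sum_index (G : 'I_6 -> 'I_3 -> 'I_3 -> 'I_4 -> F) :
  \prod_r \sum_i \sum_j \sum_k G r i j k
    = \sum_(m : index) \prod_r G r (m.1.1 (sig r)) (m.1.2 (tau r)) (m.2 r).
Proof.
rewrite bigA_distr_bigA (reindex_positions _ sigK sigVK) /=.
under eq_bigr do rewrite bigA_distr_bigA (reindex_positions _ tauK tauVK) /=.
under eq_bigr do under eq_bigr do rewrite bigA_distr_bigA.
rewrite pair_bigA pair_bigA /=; apply: eq_bigr => m _; apply: eq_bigr => r _.
by rewrite !ffunE.
Qed.

Lemma prod_positions (e eV : 'I_6 -> 'I_6) (G : 'I_6 -> F) :
  cancel e eV -> cancel eV e -> \prod_r G r = \prod_r G (e r).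
Proof. by move=> eK eVK; rewrite (reindex e) //; exists eV => r _. Qed.

Lemma ev_contraction_act gA gB gC t x :
  ev (contraction (dual_tpow_act gA gB gC t)) x
    = ev (contraction t) (tact (invmx gA) (invmx gB) (invmx gC) x).
Proof.
rewrite !ev_contraction; under eq_bigr do rewrite ffunE mulr_suml.
rewrite exchange_big; apply: eq_bigr => j _ /=.
rewrite /tact prod_sum_index mulr_sumr; apply: eq_bigr => m _.
rewrite mulrAC (mulrC _ (t j)); congr (_ * _); rewrite !big_split /= /tpow_coef.
rewrite (prod_positions (fun r => dual_mx gA _ _) sigK sigVK).
rewrite (prod_positions (fun r => dual_mx gB _ _) tauK tauVK).
by congr (_ * _ * _ * _); apply: eq_bigr => r _; rewrite !mxE.
Qed.

(** [lam] chooses a decomposable summand for each of the six factors of a monomial. The factor that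
    supplies A-position r is [sigV r], the one that supplies B-position r is [tauV r]. *)
Lemma ev_contraction_rank1s (I : finType) (a : tpow F 3 6) (b : tpow F 3 6) (c : tpow F 4 6) u v w :
  ev (contraction (tensor3 a b c)) (@rank1s F 3 3 4 I u v w)
    = \sum_(lam : {ffun 'I_6 -> I}) pairing a (fun r => u (lam (sigV r)))
        * pairing b (fun r => v (lam (tauV r))) * pairing c (fun r => w (lam r)).
Proof.
rewrite ev_contraction; under eq_bigr do rewrite bigA_distr_bigA mulr_sumr.
rewrite exchange_big; apply: eq_bigr => lam _ /=.
rewrite /pairing big_distrlr pair_bigA /= big_distrlr pair_bigA /=; apply: eq_bigr => m _.
rewrite ffunE !big_split /=.
rewrite (prod_positions (fun r => u (lam (sigV r)) _) sigK sigVK).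
rewrite (prod_positions (fun r => v (lam (tauV r)) _) tauK tauVK).
under [X in _ = _ * X * _ * _]eq_bigr do rewrite sigK.
by under [X in _ = _ * (_ * X) * _]eq_bigr do rewrite tauK; ring.
Qed.

End Contraction.

Section Brackets.
Variables (F : numFieldType) (I : finType).
Implicit Types (u v : I -> 'I_3 -> F) (w : I -> 'I_4 -> F) (lam : {ffun 'I_6 -> I}).
Local Notation o6 k := (@Ordinal 6 k isT).

Definition bracket u x y z : F := \det (\matrix_(r < 3, c < 3) u (nth x [:: x; y; z] r) c).

Lemma bracket_cycle u x y z : bracket u x y z = bracket u y z x.
Proof. by rewrite /bracket !det3 ![fun_of_matrix _ _ _]mxE /=; ring. Qed.

Lemma bracket_eq0 u x y z : [|| x == y, x == z | y == z] -> bracket u x y z = 0.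
Proof.
by case/or3P=> /eqP->; rewrite /bracket det3 ![fun_of_matrix _ _ _]mxE /=; ring.
Qed.

Definition square_hook (g : 'M[F]_4) :=
  tensor3 (square_tensor F : {ffun _ -> F^o}) (square_tensor F : {ffun _ -> F^o})
    (hook_tensor g : {ffun _ -> F^o}).

(** The labels are the values of [sigV] and [tauV] on [evens] and [odds]: columns 013 and 524 for A,
    015 and 324 for B. For C the determinant is on the column 0345, and [g] on the cells 1 and 2. *)
Definition bracket_term (g : 'M[F]_4) u v w lam : F :=
  bracket u (lam (o6 0)) (lam (o6 1)) (lam (o6 3))
  * bracket u (lam (o6 5)) (lam (o6 2)) (lam (o6 4))
  * (bracket v (lam (o6 0)) (lam (o6 1)) (lam (o6 5))
     * bracket v (lam (o6 3)) (lam (o6 2)) (lam (o6 4)))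
  * (\det (\matrix_(r < 4, c < 4) w (lam (arm r)) c)
     * \sum_k \sum_l g k l * (w (lam (o6 1)) k * w (lam (o6 2)) l)).

Lemma ev_square_hook g u v w :
  ev (contraction (square_hook g)) (rank1s u v w) = \sum_lam bracket_term g u v w lam.
Proof.
rewrite ev_contraction_rank1s; apply: eq_bigr => lam _.
rewrite !pairing_square pairing_hook /bracket_term /bracket.
by congr (_ * _ * (_ * _) * _); congr (\det _); apply/matrixP=> -[[|[|[|//]]] ?] c;
   rewrite !mxE; congr (_ _ _); congr (lam _); apply/val_inj.
Qed.

End Brackets.

(** * Vanishing of the explicit forms in rank 4 *)

Section RankFour.
Variables (F : numFieldType) (g : 'M[F]_4) (u v : 'I_4 -> 'I_3 -> F) (w : 'I_4 -> 'I_4 -> F).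
Implicit Types (lam : {ffun 'I_6 -> 'I_4}).
Local Notation o6 k := (@Ordinal 6 k isT).

(** With four summands, [lam] at 1 repeats a value of [lam] at 0, 3, 4 or 5, and the brackets 013
    and 015 leave only 4. Likewise the brackets 324 and 524 leave only 0 for [lam] at 2. *)
Lemma bracket_term_support lam : bracket_term g u v w lam != 0 ->
  lam (o6 1) = lam (o6 4) /\ lam (o6 2) = lam (o6 0).
Proof.
rewrite /bracket_term !mulf_eq0 !negb_or => /andP[/andP[/andP[A B] /andP[C E]] /andP[W _]].
(* The last determinant forces the four values of lam on arm to exhaust 'I_4. *)
have sur y : exists r, lam (arm r) = y.
  have ij : injective (fun r => lam (arm r)).
    apply/injectiveP; apply: contraNT W => /injectivePn[a [b ab e]].
    by apply/eqP/(determinant_alternate ab) => c; rewrite !mxE e.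
  by exists (invF ij y); rewrite (f_invF ij).
have armE r : [\/ arm r = o6 0, arm r = o6 3, arm r = o6 4 | arm r = o6 5].
  by case: r => [[|[|[|[|//]]]] ?]; [apply: Or41|apply: Or42|apply: Or43|apply: Or44].
split.
  have [r e] := sur (lam (o6 1)); case: (armE r) => a; rewrite a in e => //.
  - by move: A; rewrite bracket_eq0 ?e ?eqxx.
  - by move: A; rewrite bracket_eq0 ?e ?eqxx ?orbT.
  - by move: C; rewrite bracket_eq0 ?e ?eqxx ?orbT.
have [r e] := sur (lam (o6 2)); case: (armE r) => a; rewrite a in e => //.
- by move: E; rewrite bracket_eq0 ?e ?eqxx.
- by move: B; rewrite bracket_eq0 ?e ?eqxx ?orbT.
- by move: B; rewrite bracket_eq0 ?e ?eqxx ?orbT.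
Qed.

(** On the support let a, b, x, y be the values of [lam] at 0, 1, 3, 5. The brackets are [abx][yab]
    for A and [aby][xab] for B, both products being symmetric in x and y, while the determinant for
    C has the rows a, x, b, y and changes sign. *)
Lemma bracket_term_swap lam :
  bracket_term g u v w [ffun m => lam (tperm (o6 3) (o6 5) m)] = - bracket_term g u v w lam.
Proof.
set lam' := finfun _.
have l0 : lam' (o6 0) = lam (o6 0) by rewrite ffunE tpermD.
have l1 : lam' (o6 1) = lam (o6 1) by rewrite ffunE tpermD.
have l2 : lam' (o6 2) = lam (o6 2) by rewrite ffunE tpermD.
have l4 : lam' (o6 4) = lam (o6 4) by rewrite ffunE tpermD.
have l3 : lam' (o6 3) = lam (o6 5) by rewrite ffunE tpermL.
have l5 : lam' (o6 5) = lam (o6 3) by rewrite ffunE tpermR.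
have supp := @bracket_term_support lam; have supp' := @bracket_term_support lam'.
rewrite l0 l1 l2 l4 in supp'.
case: (eqVneq (lam (o6 1)) (lam (o6 4))) supp supp' => [e1|n1] supp supp'; last first.
  have -> : bracket_term g u v w lam = 0.
    by apply/eqP; apply: contraNT n1 => /supp[-> _].
  by rewrite oppr0; apply/eqP; apply: contraNT n1 => /supp'[-> _].
case: (eqVneq (lam (o6 2)) (lam (o6 0))) supp supp' => [e2|n2] supp supp'; last first.
  have -> : bracket_term g u v w lam = 0.
    by apply/eqP; apply: contraNT n2 => /supp[_ ->].
  by rewrite oppr0; apply/eqP; apply: contraNT n2 => /supp'[_ ->].
rewrite /bracket_term l0 l1 l2 l3 l4 l5 e1 e2.
rewrite [bracket u (lam (o6 5)) _ _]bracket_cycle [bracket u (lam (o6 3)) _ _]bracket_cycle.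
rewrite [bracket v (lam (o6 5)) _ _]bracket_cycle [bracket v (lam (o6 3)) _ _]bracket_cycle.
have -> : \matrix_(r < 4, c < 4) w (lam' (arm r)) c
    = \matrix_(r < 4, c < 4) (\matrix_(r < 4, c < 4) w (lam (arm r)) c) (tperm 1 3%:R r) c.
  apply/matrixP=> r c; rewrite !mxE ffunE; congr (w (lam _) c).
  by rewrite -[o6 3]/(arm 1) (_ : o6 5 = arm 3%:R) ?(inj_tperm _ _ _ arm_inj) //; apply/val_inj.
rewrite (eps_mul_row (\matrix_(r < 4, c < 4) w (lam (arm r)) c)) (eps_swap _ id) // eps_id.
ring.
Qed.

Lemma square_hook_rank4 : ev (contraction (square_hook g)) (rank1s u v w) = 0.
Proof.
rewrite ev_square_hook; set S := \sum_lam _.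
pose swap lam : {ffun 'I_6 -> 'I_4} := [ffun m => lam (tperm (o6 3) (o6 5) m)].
have SN : S = - S.
  rewrite {1}/S (reindex swap).
    by rewrite -sumrN; apply: eq_bigr => lam _; apply: bracket_term_swap.
  by exists swap => lam _; apply/ffunP=> m; rewrite !ffunE tpermK.
by apply/eqP; rewrite -[_ == 0](mulrn_eq0 _ 2) mulr2n {1}SN addNr.
Qed.

End RankFour.

Lemma square_hook_rank_ideal (F : numFieldType) (g : 'M[F]_4) :
  rank_ideal 4 6 (contraction (square_hook g)).
Proof.
split; first exact: contraction_homog.
by move=> u v w; apply: square_hook_rank4.
Qed.

(** * Nonvanishing at a sum of five decomposable tensors *)

Section Nonvanishing.

(** Laplace expansion along the first row, with entries indexed by natural numbers so that
    [vm_compute] can evaluate it. *)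
Fixpoint cdet n (A : nat -> nat -> int) : int :=
  if n is n'.+1 then
    foldr +%R 0 [seq (-1) ^+ j * A 0 j * cdet n' (fun r c => A r.+1 (bump j c)) | j <- iota 0 n]
  else 1.

Lemma cdetE n (A : nat -> nat -> int) : \det (\matrix_(i < n, j < n) A i j) = cdet n A.
Proof.
elim: n A => [|n IH] A; first by rewrite det_mx00.
rewrite /cdet -/cdet foldrE big_map (expand_det_row _ ord0).
rewrite -[iota 0 n.+1]/(index_iota 0 n.+1) big_mkord; apply: eq_bigr => j _.
rewrite mxE /cofactor add0n -IH mulrCA mulrA; congr (_ * \det _).
by apply/matrixP=> i k; rewrite !mxE.
Qed.

#[local] Arguments cdet : simpl never.

(* Five decomposable tensors e_i (x) e_j (x) e_k at whose sum every nonzero bracket term for the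
   square of e_0 equals 1. *)
Definition cell_u l := nth 0%N [:: 0; 2; 1; 0; 1]%N l.
Definition cell_v l := nth 0%N [:: 0; 2; 1; 1; 0]%N l.
Definition cell_w l := nth 0%N [:: 0; 0; 1; 2; 3]%N l.

Definition unit_row (cell : nat -> nat) (l : seq nat) (r c : nat) : int :=
  (cell (nth 0%N l r) == c)%:R.

(** For E_00 the factor of [g] is 1 or 0; it becomes the test that cells 1 and 2 both carry e_0. *)
Definition cell_term (l : seq nat) : int :=
  let a := nth 0%N l in
  if (cell_w (a 1%N) == 0%N) && (cell_w (a 2%N) == 0%N) then
    cdet 3 (unit_row cell_u [:: a 0; a 1; a 3]%N)
    * cdet 3 (unit_row cell_u [:: a 5; a 2; a 4]%N)
    * (cdet 3 (unit_row cell_v [:: a 0; a 1; a 5]%N)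
       * cdet 3 (unit_row cell_v [:: a 3; a 2; a 4]%N))
    * cdet 4 (unit_row cell_w [:: a 0; a 3; a 4; a 5]%N)
  else 0.

Definition nonneg (z : int) := if z is Posz _ then true else false.

(** Exhaustive check of the 5^6 labellings. Without negative terms nothing cancels, so one positive
    term makes the sum nonzero. *)
Lemma cell_term_ge0 : all (fun l0 => all (fun l1 => all (fun l2 => all (fun l3 =>
  all (fun l4 => all (fun l5 => nonneg (cell_term [:: l0; l1; l2; l3; l4; l5]))
  (iota 0 5)) (iota 0 5)) (iota 0 5)) (iota 0 5)) (iota 0 5)) (iota 0 5).
Proof. by vm_compute. Qed.

Variable F : numFieldType.
Local Notation o6 k := (@Ordinal 6 k isT).

Lemma unit_rowE n (cell : nat -> nat) (l : seq nat) :
  \det (\matrix_(r < n, c < n) (unit_row cell l r c)%:~R) = (cdet n (unit_row cell l))%:~R :> F.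
Proof.
rewrite -cdetE -det_map_mx; congr (\det _).
by apply/matrixP=> r c; rewrite !mxE.
Qed.

Lemma square_hook_neq0 : contraction (square_hook (delta_mx 0 0 : 'M[F]_4)) != 0.
Proof.
pose u (l : 'I_5) (c : 'I_3) : F := (cell_u l == c)%:R.
pose v (l : 'I_5) (c : 'I_3) : F := (cell_v l == c)%:R.
pose w (l : 'I_5) (c : 'I_4) : F := (cell_w l == c)%:R.
pose val6 (lam : {ffun 'I_6 -> 'I_5}) : seq nat :=
  [:: val (lam (o6 0)); val (lam (o6 1)); val (lam (o6 2)); val (lam (o6 3));
      val (lam (o6 4)); val (lam (o6 5))].
have termE lam : bracket_term (delta_mx 0 0) u v w lam = (cell_term (val6 lam))%:~R.
  have bE (cell : nat -> nat) (x y z : 'I_5) :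
      bracket (fun (l : 'I_5) (c : 'I_3) => (cell l == c)%:R : F) x y z
        = (cdet 3 (unit_row cell [:: val x; val y; val z]))%:~R.
    rewrite -unit_rowE /bracket; congr (\det _); apply/matrixP=> -[[|[|[|//]]] ?] c;
      by rewrite !mxE /unit_row rmorph_nat.
  rewrite /bracket_term.
  have -> : \sum_k \sum_l (delta_mx 0 0 : 'M[F]_4) k l * (w (lam (o6 1)) k * w (lam (o6 2)) l)
      = ((cell_w (lam (o6 1)) == 0%N) && (cell_w (lam (o6 2)) == 0%N))%:R.
    rewrite (bigD1 0) //= (bigD1 0) //= !big1 ?addr0.
    - by rewrite mxE mul1r /w -natrM mulnb.
    - by move=> k k0; rewrite big1 // => l _; rewrite mxE (negPf k0) mul0r.
    - by move=> l l0; rewrite mxE (negPf l0) andbF mul0r.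
  rewrite !bE /cell_term /=.
  have -> : \det (\matrix_(r < 4, c < 4) w (lam (arm r)) c)
      = (cdet 4 (unit_row cell_w [:: val (lam (o6 0)); val (lam (o6 3)); val (lam (o6 4));
                                    val (lam (o6 5))]))%:~R.
    rewrite -unit_rowE; congr (\det _); apply/matrixP=> -[[|[|[|[|//]]]] ?] c;
      by rewrite !mxE /unit_row rmorph_nat; congr ((cell_w (lam _) == c)%:R); apply/val_inj.
  by case: ifP => _; rewrite ?mulr0 ?mulr1 ?rmorphM.
apply/eqP=> p0; have := ev_square_hook (delta_mx 0 0) u v w.
rewrite p0 /ev meval0; under eq_bigr do rewrite termE.
rewrite -rmorph_sum => /esym/eqP; rewrite intr_eq0 => /eqP/psumr_eq0P S0.
have /S0 {}S0 : forall lam, true -> 0 <= cell_term (val6 lam).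
  move=> lam _.
  have mi (l : 'I_5) : val l \in iota 0 5 by rewrite mem_iota ltn_ord.
  have := cell_term_ge0 => /allP/(_ _ (mi (lam (o6 0))))/allP/(_ _ (mi (lam (o6 1)))).
  move=> /allP/(_ _ (mi (lam (o6 2))))/allP/(_ _ (mi (lam (o6 3)))).
  move=> /allP/(_ _ (mi (lam (o6 4))))/allP/(_ _ (mi (lam (o6 5)))).
  by rewrite -/(val6 lam); case: (cell_term _).
(* A labelling whose term is 1. *)
have := S0 [ffun m : 'I_6 => nth 0 [:: 0; 1; 1; 2%:R; 4%:R; 3%:R] m] isT.
by rewrite /val6 !ffunE.
Qed.

End Nonvanishing.

(** * The three modules coincide *)

Section TensorSpaces.
Variables (F : fieldType) (I J K : finType).
Variables (U : {vspace {ffun I -> F^o}}) (V : {vspace {ffun J -> F^o}})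
  (W : {vspace {ffun K -> F^o}}).

Lemma tensor3v_mem x y z : x \in U -> y \in V -> z \in W -> tensor3 x y z \in tensor3v U V W.
Proof.
move=> xU yV zW.
have zP (i : 'I_(\dim U)) (j : 'I_(\dim V)) :
    tensor3 (vbasis U)`_i (vbasis V)`_j z \in tensor3v U V W.
  have -> : tensor3 (vbasis U)`_i (vbasis V)`_j z
      = \sum_k coord (vbasis W) k z *: tensor3 (vbasis U)`_i (vbasis V)`_j (vbasis W)`_k.
    rewrite {1}(coord_vbasis zW); apply/ffunP=> m; rewrite !ffunE !sum_ffunE mulr_sumr.
    by apply: eq_bigr => k _; rewrite !ffunE mulrCA.
  apply: memv_suml => k _; apply/memvZ/memv_span.
  apply: (allpairs_f (fun xy z => tensor3 xy.1 xy.2 z) (x := ((vbasis U)`_i, (vbasis V)`_j))).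
    by apply: (allpairs_f (fun x y => (x, y))); rewrite mem_nth // size_tuple.
  by rewrite mem_nth // size_tuple.
have yP (i : 'I_(\dim U)) : tensor3 (vbasis U)`_i y z \in tensor3v U V W.
  have -> : tensor3 (vbasis U)`_i y z
      = \sum_j coord (vbasis V) j y *: tensor3 (vbasis U)`_i (vbasis V)`_j z.
    rewrite {1}(coord_vbasis yV); apply/ffunP=> m; rewrite !ffunE !sum_ffunE mulr_sumr mulr_suml.
    by apply: eq_bigr => k _; rewrite !ffunE /GRing.scale /=; ring.
  by apply: memv_suml => j _; apply: memvZ.
have -> : tensor3 x y z = \sum_i coord (vbasis U) i x *: tensor3 (vbasis U)`_i y z.
  rewrite {1}(coord_vbasis xU); apply/ffunP=> m; rewrite !ffunE !sum_ffunE !mulr_suml.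
  by apply: eq_bigr => k _; rewrite !ffunE /GRing.scale /=; ring.
by apply: memv_suml => i _; apply: memvZ.
Qed.

Lemma tensor3v_ind (P : {ffun I * J * K -> F^o} -> Prop) :
  P 0 -> (forall c t u, P t -> P u -> P (c *: t + u)) ->
  (forall x y z, x \in U -> y \in V -> z \in W -> P (tensor3 x y z)) ->
  forall t, t \in tensor3v U V W -> P t.
Proof.
move=> P0 PD Pt t; rewrite /tensor3v; set L := (X in <<X>>%VS) => tL.
have LP y : y \in L -> P y.
  case/allpairsP=> -[[x y'] z] /= [/allpairsP[[x1 y1] /= [xU yV [-> ->]]] zW ->].
  by apply: Pt; rewrite vbasis_mem.
rewrite (coord_span (X := in_tuple L) tL).
elim/big_ind: _ => // [u v Pu Pv|i _]; first by rewrite -[u]scale1r; apply: PD.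
by rewrite -[_ *: _]addr0; apply: PD => //; apply: LP; rewrite mem_nth.
Qed.

End TensorSpaces.

Section SquareHookSpace.
Variable F : numFieldType.
Implicit Types (g h : 'M[F]_4).
Local Notation square := [:: 2; 2; 2].
Local Notation hook := [:: 3; 1; 1; 1].
Local Notation S := (tensor3v (schur F 3 square) (schur F 3 square) (schur F 4 hook)).

Lemma square_hook_lin (c : F) g h : square_hook (c *: g + h) = c *: square_hook g + square_hook h.
Proof. by apply/ffunP=> m; rewrite !ffunE !mxE /GRing.scale /=; ring. Qed.

Lemma square_hook0 : square_hook (0 : 'M[F]_4) = 0.
Proof. by apply/ffunP=> m; rewrite !ffunE mxE !mulr0. Qed.

Lemma square_hook_mem g : g^T = g -> square_hook g \in S.
Proof.
move=> gs; apply: tensor3v_mem; try exact: square_tensor_schur.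
exact: hook_tensor_schur.
Qed.

Lemma square_hookP t : t \in S -> exists2 g, g^T = g & t = square_hook g.
Proof.
move: t; apply: tensor3v_ind.
- by exists 0; rewrite ?square_hook0 ?linear0.
- move=> c t u [g gs ->] [h hs ->]; exists (c *: g + h); rewrite ?square_hook_lin //.
  by rewrite linearP /= gs hs.
move=> x y z /schur_squareP[c ->] /schur_squareP[d ->] /schur_hookP[g gs ->].
exists ((c * d) *: g); first by rewrite linearZ /= gs.
by apply/ffunP=> m; rewrite !ffunE !mxE /GRing.scale /=; ring.
Qed.

(** Each coefficient of the transformed tensor is a product of pairings with rows of the dual
    matrices. A column of a diagram then yields [eps] times a determinant, and the two remaining
    cells of the hook yield the congruence. *)
Lemma square_hook_act (gA gB : 'M[F]_3) (gC g : 'M[F]_4) :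
  dual_tpow_act gA gB gC (square_hook g)
    = (\det (invmx gA) ^+ 2 * \det (invmx gB) ^+ 2 * \det (invmx gC))
        *: square_hook ((invmx gC)^T *m g *m invmx gC).
Proof.
apply/ffunP=> i; rewrite !ffunE.
transitivity (pairing (square_tensor F) (fun r => dual_mx gA (i.1.1 r))
  * pairing (square_tensor F) (fun r => dual_mx gB (i.1.2 r))
  * pairing (hook_tensor g) (fun r => dual_mx gC (i.2 r))).
  rewrite /pairing big_distrlr pair_bigA /= big_distrlr pair_bigA /=; apply: eq_bigr => j _.
  by rewrite !ffunE /tpow_coef; ring.
rewrite !pairing_square pairing_hook !eps_mul_row /dual_mx !det_tr /GRing.scale /=.
rewrite [(_ *m g *m _) _ _]mxE exchange_big /=.
have -> : \sum_l \sum_k g k l * ((invmx gC)^T (i.2 (@Ordinal 6 1 isT)) k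
      * (invmx gC)^T (i.2 (@Ordinal 6 2 isT)) l)
    = \sum_j ((invmx gC)^T *m g) (i.2 (@Ordinal 6 1 isT)) j * invmx gC j (i.2 (@Ordinal 6 2 isT)).
  apply: eq_bigr => l _; rewrite [(_ *m g) _ _]mxE mulr_suml; apply: eq_bigr => k _.
  by rewrite ![_^T _ _]mxE; ring.
ring.
Qed.

End SquareHookSpace.

Section TensorInverse.
Variable F : fieldType.

Lemma tensmx11 m n : 1%:M *t 1%:M = 1%:M :> 'M[F]_(m * n).
Proof.
apply/matrixP=> k l; case: (mxtens_indexP k) => i j; case: (mxtens_indexP l) => i1 j1.
by rewrite tensmxE !mxE -natrM mulnb (inj_eq (can_inj (@mxtens_indexK m n))) xpair_eqE.
Qed.

Lemma invmx_tens m n (A : 'M[F]_m) (B : 'M[F]_n) : A \in unitmx -> B \in unitmx ->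
  A *t B \in unitmx /\ invmx (A *t B) = invmx A *t invmx B.
Proof.
move=> uA uB; have e : (invmx A *t invmx B) *m (A *t B) = 1%:M.
  by rewrite tensmx_mul !mulVmx // tensmx11.
have [_ u] := mulmx1_unit e; split=> //.
by rewrite -[LHS]mul1mx -e mulmxK.
Qed.

Lemma invmx_tens3 a b c (gA : 'M[F]_a) (gB : 'M[F]_b) (gC : 'M[F]_c) :
  gA \in unitmx -> gB \in unitmx -> gC \in unitmx ->
  invmx (gA *t gB *t gC) = invmx gA *t invmx gB *t invmx gC.
Proof.
by move=> uA uB uC; have [uAB <-] := invmx_tens uA uB; have [_ ->] := invmx_tens uAB uC.
Qed.

End TensorInverse.

Section Main.
Variable F : numClosedFieldType.
Local Notation square := [:: 2; 2; 2].
Local Notation hook := [:: 3; 1; 1; 1].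
Local Notation S := (tensor3v (schur F 3 square) (schur F 3 square) (schur F 4 hook)).
Implicit Types (M : {mpoly F[3 * 3 * 4]} -> Prop).

Lemma contraction_act gA gB gC t : gA \in unitmx -> gB \in unitmx -> gC \in unitmx ->
  contraction (dual_tpow_act gA gB gC t)
    = mpoly_act (gA *t gB *t gC) (contraction t) :> {mpoly F[3 * 3 * 4]}.
Proof.
move=> uA uB uC; apply: ev_eq => x; rewrite ev_contraction_act -ev_lsub.
by rewrite -invmx_tens3.
Qed.

Let contraction_lin (s : F) (g g' : 'M[F]_4) :
  contraction (square_hook (s *: g + g'))
    = s *: contraction (square_hook g) + contraction (square_hook g').
Proof. by rewrite square_hook_lin linearP. Qed.

(** Both [mpoly_act] and [dual_tpow_act] contain inverses; equivariance is applied to the inverse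
    matrices, which yields the hypothesis [Phi_cov]. *)
Lemma covariant_family (f : {ffun _ -> F^o} -> {mpoly F[3 * 3 * 4]}) :
  linear f ->
  (forall gA gB gC, gA \in unitmx -> gB \in unitmx -> gC \in unitmx ->
    {in S, forall t, f (dual_tpow_act gA gB gC t) = mpoly_act (gA *t gB *t gC) (f t)}) ->
  forall (gA gB : 'M[F]_3) (h g : 'M[F]_4) x, g^T = g ->
    gA \in unitmx -> gB \in unitmx -> h \in unitmx ->
    ev (f (square_hook g)) (tact gA gB h x)
      = \det gA ^+ 2 * \det gB ^+ 2 * \det h * ev (f (square_hook (h^T *m g *m h))) x.
Proof.
move=> fl feq gA gB h g x gs uA uB uC; rewrite -ev_lsub.
have -> : lsub (gA *t gB *t h) (f (square_hook g))
    = mpoly_act (invmx gA *t invmx gB *t invmx h) (f (square_hook g)).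
  by rewrite /mpoly_act -/(lsub _ _) invmx_tens3 ?unitmx_inv // !invmxK.
rewrite -feq ?unitmx_inv ?square_hook_mem // square_hook_act !invmxK.
have := fl (\det gA ^+ 2 * \det gB ^+ 2 * \det h) (square_hook (h^T *m g *m h)) 0.
have f0 : f 0 = 0.
  have := fl 1 0 0; rewrite !scale1r addr0 => /eqP.
  by rewrite -subr_eq subrr eq_sym => /eqP.
by rewrite f0 !addr0 => ->; rewrite evZ.
Qed.

Lemma contraction_inj (g : 'M[F]_4) : g^T = g -> contraction (square_hook g) = 0 -> g = 0.
Proof.
apply: (Phi_inj_of contraction_lin _ (square_hook_neq0 F)).
apply: covariant_family => [|gA gB gC uA uB uC t _]; [exact: linearP | exact: contraction_act].
Qed.

Lemma contraction_admissibleP p :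
  admissible p <-> exists2 g : 'M[F]_4, g^T = g & p = contraction (square_hook g).
Proof.
apply: (admissibleP contraction_lin (fun g _ => contraction_homog _) _ contraction_inj).
apply: covariant_family => [|gA gB gC uA uB uC t _]; [exact: linearP | exact: contraction_act].
Qed.

(** The explicit copy closes the circle: forms vanishing in rank 4 are admissible, admissible forms
    lie in the copy, and the copy vanishes in rank 4. *)
Lemma rank_idealP (p : {mpoly F[3 * 3 * 4]}) : rank_ideal 4 6 p <-> admissible p.
Proof.
split=> [|/contraction_admissibleP[g _ ->]]; first exact: rank_ideal_admissible.
exact: square_hook_rank_ideal.
Qed.

Lemma M6_admissible M : is_M6 M -> forall p, M p <-> admissible p.
Proof.
case=> -[Mh _ _ _] [f [finj Mf feq]] p.
pose Phi (g : 'M[F]_4) := f (square_hook g).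
have Plin (s : F) (g g' : 'M[F]_4) : Phi (s *: g + g') = s *: Phi g + Phi g'.
  by rewrite /Phi square_hook_lin linearP.
have Pmem g : g^T = g -> M (Phi g).
  by move=> gs; apply/Mf; exists (square_hook g) => //; apply: square_hook_mem.
have Phom g (gs : g^T = g) := Mh _ (Pmem g gs).
have Pcov := covariant_family (linearP f) feq.
have Pinj g : g^T = g -> Phi g = 0 -> g = 0.
  (* That [square_hook] has trivial kernel on symmetric matrices is inherited from [contraction]. *)
  move=> gs g0; apply: contraction_inj => //.
  suff -> : square_hook g = 0 by rewrite linear0.
  rewrite -(square_hook0 F); apply: finj; rewrite ?square_hook_mem ?linear0 //.
  by rewrite -/(Phi g) g0 square_hook0 linear0.
split=> [/Mf[t /square_hookP[g gs ->] ->]|].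
  exact: (Phi_admissible Plin Phom Pcov gs).
by case/(admissibleP Plin Phom Pcov Pinj) => g gs ->; apply: Pmem.
Qed.

Lemma rank_ideal_M6 : is_M6 (rank_ideal 4 6 : {mpoly F[3 * 3 * 4]} -> Prop).
Proof.
split.
  split=> [p []|||gA gB gC uA uB uC p pI] //.
  - by apply/rank_idealP/admissible0.
  - by move=> k p q /rank_idealP pa /rank_idealP qa; apply/rank_idealP/admissible_lin.
  by rewrite /mpoly_act -/(lsub _ _) invmx_tens3 //; apply: rank_ideal_act.
pose f : {linear {ffun {ffun 'I_6 -> 'I_3} * {ffun 'I_6 -> 'I_3} * {ffun 'I_6 -> 'I_4} -> F^o}
  -> {mpoly F[3 * 3 * 4]}} := @contraction F.
exists f; split.
- move=> t u /square_hookP[g gs ->] /square_hookP[h hs ->] e.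
  have /eqP : g - h = 0.
    apply: contraction_inj; first by rewrite linearB /= gs hs.
    rewrite addrC -scaleN1r contraction_lin e scaleN1r addNr //.
  by rewrite subr_eq0 => /eqP->.
- move=> p; split=> [/rank_idealP/contraction_admissibleP[g gs ->]|].
    by exists (square_hook g) => //; apply: square_hook_mem.
  by case=> t /square_hookP[g gs ->] ->; apply: square_hook_rank_ideal.
by move=> gA gB gC uA uB uC t _; apply: contraction_act.
Qed.

End Main.

(** The second clause is the multiplicity one of the Schur module in the sextic forms: any two
    copies coincide as subspaces, not only up to isomorphism. *)
Theorem proposition2p1 (R : realType) :
  exists M6 : {mpoly R[i][3 * 3 * 4]} -> Prop,
    [/\ is_M6 M6,
        forall M, is_M6 M -> forall p, M p <-> M6 p
      & forall p, M6 p <->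
          homog_ideal 6 (secant 4 (@segre R[i] 3 3 4)) p].
Proof.
exists (rank_ideal 4 6); split; first exact: rank_ideal_M6.
  move=> M MM p; apply: iff_trans (M6_admissible MM p) _.
  by apply: iff_sym; apply: rank_idealP.
by move=> p; apply: iff_sym; apply: secant_ideal.
Qed.
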